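(* Let $R$ be a commutative Noetherian ring, $\mathfrak{a}$ an ideal of $R$, $\mathcal{S}$ a Serre class of $R$-modules, and $M$ a finitely generated $R$-module. Then the following hold: (i) If $\underline{x}=x_1,\dots,x_r$ is a maximal weak $M$-sequence with respect to $\mathcal{S}$ in $\mathfrak{a}$, then $r=\mathcal{S}\text{-}E.\mathrm{grade}_R(\mathfrak{a},M)$. (ii) $\mathcal{S}\text{-}C.\mathrm{grade}_R(\mathfrak{a},M)=\mathcal{S}\text{-}E.\mathrm{grade}_R(\mathfrak{a},M)=\mathcal{S}\text{-}K.\mathrm{grade}_R(\mathfrak{a},M)$. (iii) If $\mathcal{S}$ is closed under taking direct sums, then $\mathcal{S}\text{-}E.\mathrm{grade}_R(\mathfrak{a},M)=\mathcal{S}\text{-}H.\mathrm{grade}_R(\mathfrak{a},M)$. (iv) If $M/\mathfrak{a}M\notin\mathcal{S}$, then $\mathcal{S}\text{-}K.\mathrm{grade}_R(\mathfrak{a},M)<\infty$ and all maximal $M$-sequences with respect to $\mathcal{S}$ in $\mathfrak{a}$ have a common length.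
   Context: A Serre class $\mathcal{S}$ of $R$-modules is a (nonempty) class of $R$-modules such that for every exact sequence $0\to L\to M\to N\to 0$ of $R$-modules, $M\in\mathcal{S}$ if and only if $L\in\mathcal{S}$ and $N\in\mathcal{S}$. ''Closed under taking direct sums'' means closed under arbitrary (possibly infinite) direct sums. For an $R$-module $M$, a sequence $x_1,\dots,x_r$ of elements of $R$ is a weak $M$-sequence with respect to $\mathcal{S}$ if for each $i=1,\dots,r$ the $R$-module $((x_1,\dots,x_{i-1})M:_M x_i)/(x_1,\dots,x_{i-1})M$ belongs to $\mathcal{S}$, where $(N:_M x)=\{m\in M: xm\in N\}$. If in addition $M/(x_1,\dots,x_r)M\notin\mathcal{S}$, it is called an $M$-sequence with respect to $\mathcal{S}$. Such a sequence is in $\mathfrak{a}$ if all its elements lie in $\mathfrak{a}$; it is maximal (in $\mathfrak{a}$) if it cannot be extended by appending one further element of $\mathfrak{a}$ to a longer sequence of the same kind. The empty sequence (length $0$) is a weak $M$-sequence. Let $\underline{y}$ be a finite generating sequence of $\mathfrak{a}$ and $K^\bullet(\underline{y},M)=\mathrm{Hom}_R(K_\bullet(\underline{y}),M)$ the Koszul (cochain) complex with coefficients in $M$. Define - $\mathcal{S}\text{-}H.\mathrm{grade}_R(\mathfrak{a},M)=\inf\{i\ge 0: H^i_{\mathfrak{a}}(M)\notin\mathcal{S}\}$ (local cohomology), - $\mathcal{S}\text{-}E.\mathrm{grade}_R(\mathfrak{a},M)=\inf\{i\ge 0:\mathrm{Ext}^i_R(R/\mathfrak{a},M)\notin\mathcal{S}\}$,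 - $\mathcal{S}\text{-}K.\mathrm{grade}_R(\mathfrak{a},M)=\inf\{i\ge 0: H^i(K^\bullet(\underline{y},M))\notin\mathcal{S}\}$ (independent of the choice of $\underline{y}$), - $\mathcal{S}\text{-}C.\mathrm{grade}_R(\mathfrak{a},M)=\sup\{\ell\ge 0:\text{ there is a weak }M\text{-sequence } y_1,\dots,y_\ell \text{ with respect to } \mathcal{S} \text{ in } \mathfrak{a}\}$. Here $\inf$ and $\sup$ are taken in $\mathbb{Z}\cup\{\pm\infty\}$, with $\inf\emptyset=+\infty$ and $\sup\emptyset=-\infty$. *)

(* Defs.v *)
From HB Require Import structures.
From mathcomp Require Import all_boot all_order all_algebra.
From mathcomp Require Import finmap.
From mathcomp Require Import all_classical.
From mathcomp Require Import constructive_ereal.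

Set Implicit Arguments.
Unset Strict Implicit.
Unset Printing Implicit Defensive.

Import Order.TTheory GRing.Theory Num.Theory.

Local Open Scope ring_scope.
Local Open Scope classical_set_scope.

Section Submodules.
Variable R : comPzRingType.
Implicit Types U V W : lmodType R.

Definition fullmod V : {pred V} := predT.

Lemma fullmod_closed V : submod_closed (@fullmod V).
Proof. by []. Qed.
HB.instance Definition _ V := GRing.isSubmodClosed.Build R V (@fullmod V)
  (fullmod_closed V).

Definition zeromod V : {pred V} := pred1 0.

Lemma zeromod_closed V : submod_closed (@zeromod V).
Proof.
split; first exact: eqxx.
by move=> r u v /eqP -> /eqP ->; rewrite unfold_in scaler0 addr0 eqxx.
Qed.
HB.instance Definition _ V := GRing.isSubmodClosed.Build R V (@zeromod V)
  (zeromod_closed V).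

Definition comap U V (f : {linear U -> V}) (B : submodClosed V) : {pred U} :=
  fun u => f u \in B.

Lemma comap_closed U V (f : {linear U -> V}) (B : submodClosed V) :
  submod_closed (comap f B).
Proof.
split=> [|r u v fu fv]; first by rewrite unfold_in linear0 rpred0.
by rewrite unfold_in linearP rpredD // rpredZ.
Qed.
HB.instance Definition _ U V (f : {linear U -> V}) (B : submodClosed V) :=
  GRing.isSubmodClosed.Build R U (comap f B) (comap_closed f B).

Definition kerm U V (f : {linear U -> V}) : submodClosed U :=
  comap f (@zeromod V).

Definition imm U V (f : {linear U -> V}) : {pred V} :=
  fun v => `[< exists u, f u = v >].

Lemma imm_closed U V (f : {linear U -> V}) : submod_closed (imm f).
Proof.
split; first by apply/asboolP; exists 0; rewrite linear0.
move=> r _ _ /asboolP[u <-] /asboolP[v <-].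
by apply/asboolP; exists (r *: u + v); rewrite linearP.
Qed.
HB.instance Definition _ U V (f : {linear U -> V}) :=
  GRing.isSubmodClosed.Build R V (imm f) (imm_closed f).

(* P A : the finite sums of products r *: v with r in P and v in A *)
Definition smul V (P : {pred R}) (A : submodClosed V) : {pred V} :=
  fun v => `[< exists s : seq (R * V),
    (forall p, p \in s -> p.1 \in P /\ p.2 \in A) /\
    v = \sum_(p <- s) p.1 *: p.2 >].

Lemma smul_closed V (P : {pred R}) (A : submodClosed V) :
  submod_closed (smul P A).
Proof.
split; first by apply/asboolP; exists [::]; rewrite big_nil.
move=> r _ _ /asboolP[s [sPA ->]] /asboolP[t [tPA ->]]; apply/asboolP.
exists ([seq (p.1, r *: p.2) | p <- s] ++ t); split.
  move=> p; rewrite mem_cat => /orP[/mapP[q /sPA[qP qA] ->]|/tPA//].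
  by split=> //=; rewrite rpredZ.
rewrite big_cat big_map scaler_sumr; congr (_ + _).
by apply: eq_bigr => p _; rewrite /= !scalerA mulrC.
Qed.
HB.instance Definition _ V (P : {pred R}) (A : submodClosed V) :=
  GRing.isSubmodClosed.Build R V (smul P A) (smul_closed P A).

Definition colon V (N : submodClosed V) (x : R) : {pred V} :=
  fun v => x *: v \in N.

Lemma colon_closed V (N : submodClosed V) x : submod_closed (colon N x).
Proof.
split=> [|r u v xu xv]; first by rewrite unfold_in scaler0 rpred0.
by rewrite unfold_in scalerDr scalerA mulrC -scalerA rpredD // rpredZ.
Qed.
HB.instance Definition _ V (N : submodClosed V) x :=
  GRing.isSubmodClosed.Build R V (colon N x) (colon_closed N x).

Definition genmod V (s : seq V) : {pred V} :=
  fun v => `[< exists c : 'I_(size s) -> R, v = \sum_i c i *: s`_i >].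

Lemma genmod_closed V (s : seq V) : submod_closed (genmod s).
Proof.
split.
  by apply/asboolP; exists (fun=> 0); rewrite big1 // => i _; rewrite scale0r.
move=> r _ _ /asboolP[c ->] /asboolP[d ->]; apply/asboolP.
exists (fun i => r * c i + d i); rewrite scaler_sumr -big_split.
by apply: eq_bigr => i _; rewrite /= scalerDl scalerA.
Qed.
HB.instance Definition _ V (s : seq V) :=
  GRing.isSubmodClosed.Build R V (genmod s) (genmod_closed s).

Section SubmoduleType.
Variables (V : lmodType R) (A : submodClosed V).

Definition submod : Type := {v : V | v \in A}.

HB.instance Definition _ := SubType.on submod.
HB.instance Definition _ := Choice.on submod.
HB.instance Definition _ := [SubChoice_isSubLmodule of submod by <:].
End SubmoduleType.

Section QuotientModule.
Variables (V : lmodType R) (A : submodClosed V).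
Local Open Scope quotient_scope.

Definition submod_pred : {pred V} := A.

HB.instance Definition _ := GRing.isZmodClosed.Build V submod_pred
  (GRing.submod_closedB (submodClosedP A)).

Let I : zmodClosed V := submod_pred.

Definition quotmod : Type := Quotient.quot I.

HB.instance Definition _ := GRing.Zmodule.on quotmod.

Definition quotmod_pi (v : V) : quotmod := \pi_(Quotient.quot I) v.

Definition quotmod_scale (r : R) (x : quotmod) : quotmod :=
  quotmod_pi (r *: repr (x : Quotient.quot I)).

Lemma quotmod_eq u v : (quotmod_pi u = quotmod_pi v) <-> (u - v \in A).
Proof.
by rewrite -[u - v \in A]/(u - v \in I) Quotient.idealrBE; split=> /eqP.
Qed.

Lemma quotmod_piK (x : quotmod) : quotmod_pi (repr (x : Quotient.quot I)) = x.
Proof. exact: reprK. Qed.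

Lemma quotmod_piD u v : quotmod_pi (u + v) = quotmod_pi u + quotmod_pi v.
Proof. exact: raddfD. Qed.

Lemma quotmod_piZ r u : quotmod_pi (r *: u) = quotmod_scale r (quotmod_pi u).
Proof.
apply/quotmod_eq; rewrite -scalerBr rpredZ //; apply/quotmod_eq.
by rewrite quotmod_piK.
Qed.

Lemma quotmod_scaleA r s x :
  quotmod_scale r (quotmod_scale s x) = quotmod_scale (r * s) x.
Proof. by rewrite -[x]quotmod_piK -!quotmod_piZ scalerA. Qed.

Lemma quotmod_scale1 : left_id 1 quotmod_scale.
Proof. by move=> x; rewrite -[x in LHS]quotmod_piK -quotmod_piZ scale1r quotmod_piK. Qed.

Lemma quotmod_scaleDr : right_distributive quotmod_scale +%R.
Proof.
move=> r x y; rewrite -[x]quotmod_piK -[y]quotmod_piK.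
by rewrite -quotmod_piD -!quotmod_piZ scalerDr quotmod_piD.
Qed.

Lemma quotmod_scaleDl x :
  {morph quotmod_scale^~ x : r s / r + s >-> r + s}.
Proof.
move=> r s; rewrite -[x]quotmod_piK -!quotmod_piZ.
by rewrite -quotmod_piD scalerDl.
Qed.

HB.instance Definition _ := GRing.Zmodule_isLmodule.Build R quotmod
  quotmod_scaleA quotmod_scale1 quotmod_scaleDr quotmod_scaleDl.

Lemma quotmod_pi_linear : linear quotmod_pi.
Proof. by move=> r u v; rewrite quotmod_piD quotmod_piZ. Qed.
HB.instance Definition _ := GRing.isLinear.Build R V quotmod *:%R quotmod_pi
  quotmod_pi_linear.
End QuotientModule.

(* A / (A :&: B), which is A / B when B is contained in A *)
Definition subquot V (A B : submodClosed V) : lmodType R :=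
  quotmod (comap (val : {linear submod A -> V}) B).

End Submodules.

Section Products.
Variable R : comPzRingType.

Section Product.
Variables (I : Type) (N : I -> lmodType R).

Definition prodmod : Type := forall i, N i.

HB.instance Definition _ := gen_eqMixin prodmod.
HB.instance Definition _ := gen_choiceMixin prodmod.

Implicit Types f g h : prodmod.

Definition prodmod_zero : prodmod := fun=> 0.
Definition prodmod_opp f : prodmod := fun i => - f i.
Definition prodmod_add f g : prodmod := fun i => f i + g i.
Definition prodmod_scale (r : R) f : prodmod := fun i => r *: f i.

Let fext := @functional_extensionality_dep I N.
Let addA : associative prodmod_add.
Proof. by move=> f g h; apply: fext => i; exact: addrA. Qed.
Let addC : commutative prodmod_add.
Proof. by move=> f g; apply: fext => i; exact: addrC. Qed.
Let add0 : left_id prodmod_zero prodmod_add.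
Proof. by move=> f; apply: fext => i; exact: add0r. Qed.
Let addN : left_inverse prodmod_zero prodmod_opp prodmod_add.
Proof. by move=> f; apply: fext => i; exact: addNr. Qed.

HB.instance Definition _ := GRing.isZmodule.Build prodmod addA addC add0 addN.

Let scaleA r s f : prodmod_scale r (prodmod_scale s f) = prodmod_scale (r * s) f.
Proof. by apply: fext => i; exact: scalerA. Qed.
Let scale1 : left_id 1 prodmod_scale.
Proof. by move=> f; apply: fext => i; exact: scale1r. Qed.
Let scaleDr : right_distributive prodmod_scale +%R.
Proof. by move=> r f g; apply: fext => i; exact: scalerDr. Qed.
Let scaleDl f : {morph prodmod_scale^~ f : r s / r + s >-> r + s}.
Proof. by move=> r s; apply: fext => i; exact: scalerDl. Qed.

HB.instance Definition _ := GRing.Zmodule_isLmodule.Build R prodmod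
  scaleA scale1 scaleDr scaleDl.

Definition finite_supp : {pred prodmod} :=
  fun f => `[< finite_set [set i | f i != 0] >].

Lemma finite_supp_closed : submod_closed finite_supp.
Proof.
split=> [|r f g /asboolP fF /asboolP gF]; apply/asboolP.
  rewrite (_ : [set _ | _] = set0); first exact: finite_set0.
  by apply/seteqP; split=> i //=; rewrite eqxx.
apply: (sub_finite_set _ (_ : finite_set (_ `|` _))); last first.
  by rewrite finite_setU; split; [exact: fF|exact: gF].
move=> i /= fgi; have [fi0|] := eqVneq (f i) 0; last by left.
right; apply: contraNneq fgi => gi0.
by rewrite -[X in X == _]/(r *: f i + g i) fi0 gi0 scaler0 addr0.
Qed.
HB.instance Definition _ := GRing.isSubmodClosed.Build R prodmod finite_supp
  finite_supp_closed.

Definition dirsum : lmodType R := submod finite_supp.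
End Product.

Definition freemod (X : Type) : lmodType R := dirsum (fun _ : X => R^o).

(* The map from the free module on the elements of N to N *)
Definition free_aug (N : lmodType R) (c : freemod N) : N :=
  \sum_(x \in [set: N]) (val c x : R) *: x.

Lemma free_aug_finite (N : lmodType R) (c : freemod N) (D : set N) :
  finite_set D -> [set x | val c x != 0] `<=` D ->
  free_aug c = \sum_(x <- fset_set D) (val c x : R) *: x.
Proof.
move=> Dfin cD; rewrite -fsbig_finite // /free_aug; apply/esym/fsbig_widen => //.
move=> x [_ /= xD]; apply: contra_notP xD => h; apply: cD => /=.
by apply/eqP; apply: contra_not h => ->; rewrite scale0r.
Qed.

Lemma free_aug_linear (N : lmodType R) : linear (@free_aug N).
Proof.
move=> r c d; have suppF (e : freemod N) : finite_set [set x | val e x != 0].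
  by have /asboolP := valP e.
have valE x : val (r *: c + d) x = r *: val c x + val d x by [].
have Dfin : finite_set ([set x | val c x != 0] `|` [set x | val d x != 0]).
  by rewrite finite_setU; split; exact: suppF.
rewrite !(free_aug_finite Dfin); first last.
- move=> x cdx; have [c0|] := eqVneq (val c x) 0; last by left.
  by right; apply: contraNneq cdx => d0; rewrite valE c0 d0 scaler0 addr0.
- by move=> x cx; left.
- by move=> x dx; right.
rewrite scaler_sumr -big_split; apply: eq_bigr => x _ /=.
by rewrite [X in X *: _ = _]valE scalerDl scalerA.
Qed.
HB.instance Definition _ (N : lmodType R) :=
  GRing.isLinear.Build R (freemod N) N *:%R (@free_aug N) (@free_aug_linear N).

Lemma free_aug_surj (N : lmodType R) (x : N) : exists c, @free_aug N c = x.
Proof.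
pose e : prodmod (fun _ : N => R^o) := fun y => if y == x then 1 else 0.
have eE : [set y | e y != 0] `<=` [set x].
  by move=> y; rewrite /e /=; case: (eqVneq y x) => // _; rewrite eqxx.
have eF : e \in finite_supp (N := fun _ : N => R^o).
  by apply/asboolP; apply: sub_finite_set eE _; exact: finite_set1.
exists (Sub e eF); rewrite (@free_aug_finite _ _ [set x]) //.
rewrite fset_set1 big_seq_fset1 /= /e eqxx; exact: scale1r.
Qed.

Section HomModule.
Implicit Types U V W : lmodType R.

Definition linmaps U V : {pred (U -> V)} := fun f => `[< linear f >].

Lemma linmaps_closed U V : submod_closed (@linmaps U V).
Proof.
split=> [|r f g /asboolP fL /asboolP gL]; apply/asboolP => s u v.
  by rewrite [LHS](_ : _ = 0) // scaler0 add0r.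
rewrite -![(_ + _ : U -> V) _]/(r *: f _ + g _) fL gL.
by rewrite !scalerDr !scalerA mulrC addrACA.
Qed.
HB.instance Definition _ U V := GRing.isSubmodClosed.Build R (U -> V)
  (@linmaps U V) (@linmaps_closed U V).

Definition homMod U V : lmodType R := submod (@linmaps U V).

Lemma homMod_comp_subproof U V W (f : {linear U -> V}) (phi : homMod V W) :
  (val phi \o f) \in @linmaps U W.
Proof.
case: phi => phi /= /asboolP phiL; apply/asboolP => r u v /=.
by rewrite linearP phiL.
Qed.

Definition homMod_comp U V W (f : {linear U -> V}) (phi : homMod V W) :
    homMod U W :=
  Sub (val phi \o f) (homMod_comp_subproof f phi).

Lemma homMod_comp_linear U V W (f : {linear U -> V}) :
  linear (@homMod_comp U V W f).
Proof. by move=> r phi psi; apply: val_inj. Qed.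
HB.instance Definition _ U V W (f : {linear U -> V}) :=
  GRing.isLinear.Build R (homMod V W) (homMod U W) *:%R (@homMod_comp U V W f)
    (@homMod_comp_linear U V W f).
End HomModule.
End Products.

Section DivisibleExtension.
Variables (B C D : zmodType) (i : B -> C) (f : B -> D).
Hypotheses (iD : zmod_morphism i) (fD : zmod_morphism f) (i_inj : injective i).
Hypothesis divD : forall (x : D) (n : nat), (0 < n)%N -> exists y, y *+ n = x.

Let good (G : set (C * D)) :=
  [/\ forall b, G (i b, f b),
      forall x y x' y', G (x, y) -> G (x', y') -> G (x - x', y - y')
    & forall y, G (0, y) -> y = 0].

Let good_graph : good [set p | exists b, p = (i b, f b)].
Proof.
have i0 : i 0 = 0 by rewrite -[X in i X](subrr 0) iD subrr.
have f0 : f 0 = 0 by rewrite -[X in f X](subrr 0) fD subrr.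
split=> [b|x y x' y' [b [-> ->]] [b' [-> ->]]|y [b [ib ->]]]; first by exists b.
  by exists (b - b'); rewrite iD fD.
by rewrite -(i_inj (etrans i0 ib)).
Qed.

Let good_max : exists A, good A /\ forall G, A `<=` G -> good G -> G `<=` A.
Proof.
have [|A [[A0|gA] maxA]] := @Zorn_bigcup _ (fun G => G = set0 \/ good G).
- move=> F FP Ftot; have [[X FX gX]|noX] := pselect (exists2 X, F X & good X).
    right; case: (gX) => Xg _ _; split=> [b|x y x' y' [Y FY Yx] [Z FZ Zx]|y].
    + by exists X.
    + have [YZ|ZY] := Ftot _ _ FY FZ.
        exists Z => //; have [Z0|[_ Zs _]] := FP _ FZ; first by rewrite Z0 in Zx.
        by apply: Zs => //; exact: YZ.
      exists Y => //; have [Y0|[_ Ys _]] := FP _ FY; first by rewrite Y0 in Yx.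
      by apply: Ys => //; exact: ZY.
    + case=> Y FY Yy; have [Y0|[_ _ Yf]] := FP _ FY; first by rewrite Y0 in Yy.
      exact: Yf.
  left; apply/seteqP; split=> // p [X FX Xp].
  have [X0|gX] := FP _ FX; first by rewrite X0 in Xp.
  by case: noX; exists X.
- case: (maxA [set p | exists b, p = (i b, f b)]); last by right.
  by rewrite A0; split=> // /(_ (i 0, f 0)); apply; exists 0.
exists A; split=> // G AG gG; apply: contrapT => nGA.
by case: (maxA G); [split|right].
Qed.

Lemma divisible_extension :
  exists g : C -> D, zmod_morphism g /\ forall b, g (i b) = f b.
Proof.
have [A [[Af As A1] maxA]] := good_max.
have A0 : A (0, 0) by have := As _ _ _ _ (Af 0) (Af 0); rewrite !subrr.
have AN x y : A (x, y) -> A (- x, - y) by move=> /(As _ _ _ _ A0); rewrite !sub0r.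
have AD x y x' y' : A (x, y) -> A (x', y') -> A (x + x', y + y').
  by move=> xy /AN /(As _ _ _ _ xy); rewrite !opprK.
have AMn x y n : A (x, y) -> A (x *+ n, y *+ n).
  by move=> xy; elim: n => [|n IH]; rewrite ?mulr0n ?mulrS //; exact: AD.
have AMz x y (n : int) : A (x, y) -> A (x *~ n, y *~ n).
  by move=> xy; case: n => n; [|rewrite NegzE !mulrNz; apply: AN]; exact: AMn.
have Atot c : exists d, A (c, d).
  have [d dP] : exists d, forall (n : int) y, A (c *~ n, y) -> y = d *~ n.
    have [exk|nok] := pselect (exists k, (0 < k)%N && `[< exists e, A (c *+ k, e) >]).
      case: (ex_minnP exk) => k /andP[k0 /asboolP[e ke]] kmin.
      have [d de] := divD e k0; exists d => n y ny.
      have nE := divz_eq n k; set q := divz n k in nE *; set r := modz n k in nE *.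
      have r_ge0 : 0 <= r by rewrite modz_ge0 // -lt0n.
      have : A (c *~ r, y - e *~ q).
        have /(As _ _ _ _ ny) := AMz _ _ q ke.
        rewrite pmulrn -mulrzA [k%:Z * q]mulrC -mulrzBr.
        by rewrite {1}nE addrC addKr.
      have rk : r < k%:Z by rewrite ltz_pmod.
      case: r nE r_ge0 rk => // r nE _ rk rA.
      have [r0|r0] := posnP r; last first.
        have /kmin : (0 < r)%N && `[< exists e, A (c *+ r, e) >].
          by rewrite r0; apply/asboolP; exists (y - e *~ q); rewrite pmulrn.
        by rewrite leqNgt -ltz_nat rk.
      move: rA; rewrite r0 mulr0z => /A1/eqP; rewrite subr_eq0 => /eqP ->.
      by rewrite nE r0 addr0 -de pmulrn -mulrzA mulrC.
    exists 0 => n y; rewrite mul0rz.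
    have kA k e : (0 < k)%N -> ~ A (c *+ k, e).
      by move=> k0 kA; apply: nok; exists k; rewrite k0; apply/asboolP; exists e.
    case: n => n; last by move/AN; rewrite NegzE mulrNz opprK => /kA; case.
    by have [->|n0 /kA] := posnP n; [exact: A1|case].
  pose G := [set p | exists x y (n : int), A (x, y) /\ p = (x + c *~ n, y + d *~ n)].
  have AG : A `<=` G.
    by case=> x y xy; exists x, y, 0; split=> //; rewrite !mulr0z !addr0.
  exists d; apply: (maxA G AG); last first.
    by exists 0, 0, 1; split=> //; rewrite !add0r !mulr1z.
  split=> [b||_ [x [y [n [xy [x0 ->]]]]]]; first exact: AG.
    move=> _ _ _ _ [x [y [n [xy [-> ->]]]]] [x' [y' [n' [xy' [-> ->]]]]].
    exists (x - x'), (y - y'), (n - n'); split; first exact: As.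
    by rewrite !mulrzBr; congr (_, _); rewrite opprD addrACA.
  have xE : x = c *~ (- n) by apply/eqP; rewrite mulrNz -addr_eq0 -x0.
  rewrite xE in xy; rewrite (dP _ _ xy).
  by rewrite mulrNz addNr.
have [g gP] := choice Atot; have Aeq x y z : A (x, y) -> A (x, z) -> y = z.
  by move=> /As h /h; rewrite subrr => /A1/eqP; rewrite subr_eq0 => /eqP.
exists g; split=> [x y|b]; last exact: Aeq (gP _) (Af b).
exact: Aeq (gP _) (As _ _ _ _ (gP x) (gP y)).
Qed.
End DivisibleExtension.

Definition int_rat : {pred rat} := [pred x : rat | x \is a Num.int].

Lemma int_rat_closed : zmod_closed int_rat.
Proof.
by split=> [|x y xZ yZ]; rewrite inE; [exact: rpred0|exact: rpredB].
Qed.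
HB.instance Definition _ := GRing.isZmodClosed.Build rat int_rat int_rat_closed.

Definition QmodZ : zmodType := Quotient.quot int_rat.

Definition QmodZ_pi (x : rat) : QmodZ := (\pi_(Quotient.quot int_rat) x)%qT.

Lemma QmodZ_piB : zmod_morphism QmodZ_pi.
Proof. by move=> x y; exact: raddfB. Qed.
HB.instance Definition _ := GRing.isZmodMorphism.Build rat QmodZ QmodZ_pi
  QmodZ_piB.

Lemma QmodZ_pi_eq0 x : (QmodZ_pi x == 0) = (x \is a Num.int).
Proof.
have -> : (0 : QmodZ) = QmodZ_pi 0 by rewrite raddf0.
by rewrite -(Quotient.idealrBE int_rat) subr0.
Qed.

Lemma QmodZ_divisible (x : QmodZ) n : (0 < n)%N -> exists y, y *+ n = x.
Proof.
move=> n0; exists (QmodZ_pi (repr (x : Quotient.quot int_rat) / n%:R)).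
rewrite -raddfMn -[_ *+ n]mulr_natr divfK ?pnatr_eq0 -?lt0n //.
exact: reprK.
Qed.

Lemma QmodZ_inv_neq0 (k : nat) : (1 < k)%N ->
  exists u : QmodZ, u != 0 /\ u *+ k = 0.
Proof.
move=> k1; have k0 : (k%:R : rat) != 0 by rewrite pnatr_eq0 -lt0n (ltn_trans _ k1).
exists (QmodZ_pi (k%:R^-1)); split.
  rewrite QmodZ_pi_eq0; apply/negP => /intrP[z zE].
  have /intr_inj : (k%:Z * z)%:~R = 1%:~R :> rat.
    by rewrite intrM -zE -pmulrn divff.
  move=> /(congr1 absz) /eqP; rewrite abszM muln_eq1 absz_nat.
  by rewrite gtn_eqF.
by apply/eqP; rewrite -raddfMn QmodZ_pi_eq0 -[_^-1 *+ _]mulr_natr mulVf.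
Qed.

Lemma QmodZ_separates (M : zmodType) (m : M) : m != 0 ->
  exists chi : M -> QmodZ, zmod_morphism chi /\ chi m != 0.
Proof.
move=> m0; have [u [u0 uP]] : exists u : QmodZ,
    u != 0 /\ forall n : int, m *~ n = 0 -> u *~ n = 0.
  have [exk|nok] := pselect (exists k, (0 < k)%N && (m *+ k == 0)).
    case: (ex_minnP exk) => k /andP[k0 /eqP mk] kmin.
    have [|u [u0 uk]] := @QmodZ_inv_neq0 k.
      by rewrite ltn_neqAle k0 andbT; apply: contraNneq m0 => k1; rewrite -mk -k1.
    exists u; split=> // n mn.
    have nE := divz_eq n k; set q := divz n k in nE *; set r := modz n k in nE *.
    have r_ge0 : 0 <= r by rewrite modz_ge0 // -lt0n.
    have rk : r < k%:Z by rewrite ltz_pmod.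
    have red (N : zmodType) (x : N) : x *+ k = 0 -> x *~ n = x *~ r.
      by move=> xk; rewrite {1}nE mulrzDr mulrC mulrzA -pmulrn xk mul0rz add0r.
    move: mn; rewrite (red _ _ mk) (red _ _ uk).
    case: r r_ge0 rk {nE red} => // r _; rewrite ltz_nat -!pmulrn => rk mr.
    have [->//|r0] := posnP r.
    have /kmin : (0 < r)%N && (m *+ r == 0) by rewrite r0 mr eqxx.
    by rewrite leqNgt rk.
  have [u [u0 _]] := @QmodZ_inv_neq0 2 isT; exists u; split=> // n mn.
  have [->//|n0] := eqVneq n 0; case: nok; exists `|n|%N.
  rewrite absz_gt0 n0 /=; case: n mn {n0} => n; first by rewrite -pmulrn => ->.
  by rewrite NegzE mulrNz -pmulrn => /eqP; rewrite oppr_eq0.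
pose P : {pred M} := fun x => `[< exists n : int, x = m *~ n >].
have PD : zmod_closed P.
  split=> [|_ _ /asboolP[n ->] /asboolP[p ->]]; apply/asboolP.
    by exists 0; rewrite mulr0z.
  by exists (n - p); rewrite mulrzBr.
pose cP := GRing.isZmodClosed.Build M P PD.
pose PZ : zmodClosed M := HB.pack P cP.
pose B : zmodType := HB.pack {x | x \in PZ} (SubType.on {x | x \in PZ})
  [SubChoice_isSubZmodule of {x | x \in PZ} by <:].
have /choice[n nP] (b : {x | x \in PZ}) : exists n : int, val b = m *~ n.
  by have /asboolP := valP b.
have mn0 (p q : int) : m *~ p = m *~ q -> u *~ p = u *~ q.
  move=> mpq; apply/eqP; rewrite -subr_eq0 -mulrzBr; apply/eqP/uP.
  by rewrite mulrzBr mpq subrr.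
have [||||chi [chiD chiE]] :=
  @divisible_extension B M QmodZ (fun b => val b) (fun b => u *~ n b).
- by move=> x y.
- by move=> x y; rewrite -mulrzBr; apply: mn0; rewrite -nP mulrzBr -!nP.
- exact: val_inj.
- exact: QmodZ_divisible.
exists chi; split=> //.
have mP : m \in PZ by apply/asboolP; exists 1; rewrite mulr1z.
rewrite -[m]/(val (Sub m mP : {x | x \in PZ})) chiE.
by rewrite (mn0 _ 1) ?mulr1z // -nP.
Qed.

Lemma zmod_morphismD (A D : zmodType) (f : A -> D) :
  zmod_morphism f -> {morph f : x y / x + y}.
Proof.
move=> fB x y; have fN z : f (- z) = - f z.
  by rewrite -[- z]sub0r fB -[X in f X](subrr 0) fB subrr sub0r.
by rewrite -[y in LHS]opprK fB fN opprK.
Qed.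

Section AdditiveMaps.
Variables (A D : zmodType).

Definition addmaps : {pred (A -> D)} := fun f => `[< zmod_morphism f >].

Lemma addmaps_closed : zmod_closed addmaps.
Proof.
split=> [|f g /asboolP fD /asboolP gD]; apply/asboolP => x y.
  by rewrite [RHS]subr0.
rewrite -![(f - g) _]/(f _ - g _) fD gD !opprD addrACA.
by congr (_ + _); rewrite opprK addrC.
Qed.
HB.instance Definition _ := GRing.isZmodClosed.Build (A -> D) addmaps
  addmaps_closed.

Definition addhom : Type := {f : A -> D | f \in addmaps}.
HB.instance Definition _ := SubType.on addhom.
HB.instance Definition _ := Choice.on addhom.
HB.instance Definition _ := [SubChoice_isSubZmodule of addhom by <:].
End AdditiveMaps.

Section InjectiveHull.
Variable R : comPzRingType.

(* Hom_Z(R, Q/Z), with R acting by (r f)(s) = f(s r) *)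
Definition coind : Type := addhom R QmodZ.
HB.instance Definition _ := GRing.Zmodule.on coind.

Lemma coind_scale_subproof (r : R) (f : coind) :
  (fun s => val f (s * r)) \in @addmaps R QmodZ.
Proof.
by have /asboolP fD := valP f; apply/asboolP => s t; rewrite mulrBl fD.
Qed.

Definition coind_scale (r : R) (f : coind) : coind :=
  Sub (fun s => val f (s * r)) (coind_scale_subproof r f).

Let scaleA r s f : coind_scale r (coind_scale s f) = coind_scale (r * s) f.
Proof. by apply: val_inj; apply/funext => t /=; rewrite mulrA. Qed.
Let scale1 : left_id 1 coind_scale.
Proof. by move=> f; apply: val_inj; apply/funext => t /=; rewrite mulr1. Qed.
Let scaleDr : right_distributive coind_scale +%R.
Proof. by move=> r f g; apply: val_inj. Qed.
Let scaleDl f : {morph coind_scale^~ f : r s / r + s >-> r + s}.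
Proof.
move=> r s; apply: val_inj; apply/funext => t /=.
have /asboolP/zmod_morphismD fD := valP f.
by rewrite mulrDr fD.
Qed.

HB.instance Definition _ := GRing.Zmodule_isLmodule.Build R coind
  scaleA scale1 scaleDr scaleDl.

(* The product of copies of Hom_Z(R, Q/Z) indexed by the characters M -> Q/Z;
   it is injective and contains M (injmod_injective, inj_emb_inj) *)
Definition injmod (M : lmodType R) : lmodType R := addhom M QmodZ -> coind.

Lemma inj_emb_subproof (M : lmodType R) (m : M) (chi : addhom M QmodZ) :
  (fun r : R => val chi (r *: m)) \in @addmaps R QmodZ.
Proof.
by have /asboolP chiD := valP chi; apply/asboolP => r s; rewrite scalerBl chiD.
Qed.

Definition inj_emb (M : lmodType R) (m : M) : injmod M :=
  fun chi => Sub (fun r : R => val chi (r *: m)) (inj_emb_subproof m chi).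

Lemma inj_emb_linear (M : lmodType R) : linear (@inj_emb M).
Proof.
move=> r m n; apply/funext => chi; apply: val_inj; apply/funext => s.
have /asboolP/zmod_morphismD chiD := valP chi.
transitivity (val chi (s *: (r *: m + n))) => //.
by rewrite scalerDr scalerA chiD.
Qed.
HB.instance Definition _ (M : lmodType R) :=
  GRing.isLinear.Build R M (injmod M) *:%R (@inj_emb M) (@inj_emb_linear M).

Definition injective_module (E : lmodType R) : Prop :=
  forall (B C : lmodType R) (i : {linear B -> C}) (f : {linear B -> E}),
  injective i -> exists g : {linear C -> E}, forall b, g (i b) = f b.

Lemma inj_emb_inj (M : lmodType R) : injective (@inj_emb M).
Proof.
move=> m n mn; apply/eqP; rewrite -subr_eq0; apply: contraT => /QmodZ_separates.
case=> chi [chiD]; rewrite chiD subr_eq0 => /eqP[]; move/asboolP: chiD => chiD.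
have /(congr1 (fun f : addhom R QmodZ => val f 1)) := congr1 (fun f => f (Sub chi chiD)) mn.
by rewrite /= !scale1r.
Qed.

Lemma injmod_injective (M : lmodType R) : injective_module (injmod M).
Proof.
move=> B C i f i_inj.
have ext (chi : addhom M QmodZ) : exists g : C -> QmodZ,
    zmod_morphism g /\ forall b, g (i b) = val (f b chi) 1.
  apply: divisible_extension => //; last exact: QmodZ_divisible.
    by move=> x y; rewrite raddfB.
  by move=> x y; rewrite raddfB.
have [g gP] := choice ext.
have gD chi c : (fun r : R => g chi (r *: c)) \in @addmaps R QmodZ.
  by apply/asboolP => r s; rewrite scalerBl; case: (gP chi) => ->.
pose h c : injmod M := fun chi => Sub (fun r : R => g chi (r *: c)) (gD chi c).
have hL : linear h.
  move=> r c d; apply/funext => chi; apply: val_inj; apply/funext => s.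
  have [/zmod_morphismD gchiD _] := gP chi.
  transitivity (g chi (s *: (r *: c + d))) => //.
  by rewrite scalerDr scalerA gchiD.
pose hM := GRing.isLinear.Build R C (injmod M) *:%R h hL.
pose hl : {linear C -> injmod M} := HB.pack h hM.
exists hl => b; apply/funext => chi; apply: val_inj; apply/funext => r /=.
have [_ giE] := gP chi; rewrite -linearZ giE linearZ /=.
by rewrite -[LHS]/(val (f b chi) (1 * r)) mul1r.
Qed.
End InjectiveHull.

(* An ideal of R is a submodule of the regular module R^o *)
Notation ideal R := (submodClosed R^o).

Section Cohomology.
Variable R : comPzRingType.
Implicit Types U V W M N : lmodType R.

Section CochainComplex.
Variables (K : nat -> lmodType R) (d : forall n, {linear K n -> K n.+1}).

Definition coboundaries (i : nat) : submodClosed (K i) :=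
  match i with
  | 0 => @zeromod R (K 0)
  | j.+1 => imm (d j)
  end.

Definition cohomology (i : nat) : lmodType R :=
  subquot (kerm (d i)) (coboundaries i).
End CochainComplex.

(* The i-th cohomology of Hom(C, M), for a chain complex
   ... -> C 2 -> C 1 -> C 0 *)
Definition Hom_cohomology (C : nat -> lmodType R)
    (d : forall n, {linear C n.+1 -> C n}) (M : lmodType R) (i : nat) :
    lmodType R :=
  cohomology (K := fun n => homMod (C n) M)
    (fun n => @homMod_comp R _ _ M (d n)) i.

(* The canonical free resolution of N: syzygy N 0 = N, and syzygy N n.+1 is the
   kernel of the free module on syzygy N n mapping onto syzygy N n *)
Fixpoint syzygy N (n : nat) : lmodType R :=
  match n with
  | 0 => N
  | n'.+1 => submod (kerm (@free_aug R (syzygy N n')))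
  end.

Definition free_res N (n : nat) : lmodType R := freemod R (syzygy N n).

Definition free_res_diff N (n : nat) :
    {linear free_res N n.+1 -> free_res N n} :=
  (val : {linear submod (kerm (@free_aug R (syzygy N n))) -> free_res N n})
    \o (@free_aug R (syzygy N n.+1)).

Lemma free_aug_eq0 N (c : freemod R N) : free_aug c = 0 <->
  exists b : freemod R (submod (kerm (@free_aug R N))), val (free_aug b) = c.
Proof.
split=> [c0|[b <-]]; last by apply/eqP; exact: (valP (free_aug b)).
have cK : c \in kerm (@free_aug R N) by apply/eqP.
have [b bE] := free_aug_surj (Sub c cK : submod (kerm (@free_aug R N))).
by exists b; rewrite bE.
Qed.

Lemma submod_val_eq0 V (A : submodClosed V) (u : submod A) :
  val u = 0 <-> u = 0.
Proof. by split=> [u0|-> //]; apply: val_inj. Qed.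

Lemma free_res_exact0 N c :
  free_aug c = 0 <-> exists b, free_res_diff N 0 b = c.
Proof. exact: free_aug_eq0. Qed.

Lemma free_res_exactS N n c :
  free_res_diff N n c = 0 <-> exists b, free_res_diff N n.+1 b = c.
Proof.
apply: (iff_trans (@submod_val_eq0 _ (kerm (@free_aug R (syzygy N n))) _)).
exact: (@free_aug_eq0 (syzygy N n.+1) c).
Qed.

Definition Ext (i : nat) N M : lmodType R :=
  Hom_cohomology (free_res_diff N) M i.

(* The canonical injective resolution of M: cosyzygy M 0 = M, and
   cosyzygy M n.+1 is the cokernel of cosyzygy M n -> injmod (cosyzygy M n) *)
Fixpoint cosyzygy M (n : nat) : lmodType R :=
  match n with
  | 0 => M
  | n'.+1 => quotmod (imm (@inj_emb R (cosyzygy M n')))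
  end.

Definition inj_res M (n : nat) : lmodType R := injmod (cosyzygy M n).

Definition inj_res_diff M (n : nat) : {linear inj_res M n -> inj_res M n.+1} :=
  (@inj_emb R (cosyzygy M n.+1))
    \o (@quotmod_pi R (inj_res M n) (imm (@inj_emb R (cosyzygy M n)))).

Lemma inj_emb_pi_eq0 V (A : submodClosed V) (v : V) :
  inj_emb (quotmod_pi A v) = 0 <-> v \in A.
Proof.
have e0 : inj_emb (0 : quotmod A) = 0 := linear0 _.
have p0 : quotmod_pi A 0 = 0 := linear0 _.
split=> [|vA].
  by rewrite -e0 => /inj_emb_inj; rewrite -p0 => /quotmod_eq; rewrite subr0.
by rewrite -e0 -p0; congr inj_emb; apply/quotmod_eq; rewrite subr0.
Qed.

Lemma inj_res_exact0 M x : inj_res_diff M 0 x = 0 <-> exists m, inj_emb m = x.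
Proof.
apply: (iff_trans (inj_emb_pi_eq0 (imm (@inj_emb R M)) x)).
exact: iff_sym (rwP (asboolP _)).
Qed.

Lemma inj_res_exactS M n x :
  inj_res_diff M n.+1 x = 0 <-> exists y, inj_res_diff M n y = x.
Proof.
apply: (iff_trans (inj_emb_pi_eq0 (imm (@inj_emb R (cosyzygy M n.+1))) x)).
apply: (iff_trans (iff_sym (rwP (asboolP _)))); split=> [[y yx]|[y yx]].
  exists (repr (y : Quotient.quot _)); rewrite -yx.
  exact: (congr1 (@inj_emb R (cosyzygy M n.+1)) (quotmod_piK _)).
by exists (quotmod_pi _ y).
Qed.

Definition ideal_pow (a : ideal R) (n : nat) : submodClosed R^o :=
  iter n (fun b : submodClosed R^o => @smul R R^o a b : ideal R)
    (@fullmod R R^o : ideal R).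

Lemma ideal_powW (a : ideal R) n m r :
  (n <= m)%N -> r \in ideal_pow a m -> r \in ideal_pow a n.
Proof.
move=> /subnK <-; elim: (m - n)%N r => // k IH r /asboolP[s [sP ->]]; apply: IH.
by rewrite big_seq; apply: rpred_sum => p /sP[_ ?]; apply: rpredZ.
Qed.

Definition torsion (a : ideal R) M : {pred M} :=
  fun m => `[< exists n, forall r : R, r \in ideal_pow a n -> r *: m = 0 >].

Lemma torsion_closed (a : ideal R) M : submod_closed (torsion a (M := M)).
Proof.
split=> [|r u v /asboolP[n un] /asboolP[m vm]]; apply/asboolP.
  by exists 0 => r _; rewrite scaler0.
exists (maxn n m) => s sI; rewrite scalerDr scalerA mulrC -scalerA.
rewrite un ?vm ?scaler0 ?addr0 //; apply: ideal_powW sI.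
  exact: leq_maxr.
exact: leq_maxl.
Qed.
HB.instance Definition _ (a : ideal R) M :=
  GRing.isSubmodClosed.Build R M (torsion a (M := M)) (@torsion_closed a M).

Definition Gamma (a : ideal R) M : lmodType R :=
  submod (torsion a (M := M)).

Lemma Gamma_map_subproof (a : ideal R) M N (f : {linear M -> N})
  (m : Gamma a M) : f (val m) \in torsion a (M := N).
Proof.
have /asboolP[n mn] := valP m; apply/asboolP; exists n => r rI.
by rewrite -linearZ mn // linear0.
Qed.

Definition Gamma_map (a : ideal R) M N (f : {linear M -> N})
    (m : Gamma a M) : Gamma a N :=
  Sub (f (val m)) (Gamma_map_subproof f m).

Lemma Gamma_map_linear (a : ideal R) M N (f : {linear M -> N}) :
  linear (@Gamma_map a M N f).
Proof. by move=> r u v; apply: val_inj; rewrite /= linearP. Qed.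
HB.instance Definition _ (a : ideal R) M N (f : {linear M -> N}) :=
  GRing.isLinear.Build R (Gamma a M) (Gamma a N) *:%R (@Gamma_map a M N f)
    (@Gamma_map_linear a M N f).

(* The i-th right derived functor of Gamma_a, where Gamma_a(M) consists of the
   elements of M killed by a power of a *)
Definition local_cohomology (i : nat) (a : ideal R) M : lmodType R :=
  cohomology (K := fun n => Gamma a (inj_res M n))
    (fun n => @Gamma_map a _ _ (inj_res_diff M n)) i.

(* The Koszul complex of ys: koszul n is the free module on the n-element
   subsets J of the index set, standing for the e_j1 /\ ... /\ e_jn with
   j1 < ... < jn the elements of J *)
Section Koszul.
Variable ys : seq R.

Definition koszul (n : nat) : lmodType R :=
  {ffun {J : {set 'I_(size ys)} | #|J| == n} -> R^o}.

Definition koszul_coef n (c : koszul n) (J : {set 'I_(size ys)}) : R :=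
  if insub J is Some J' then c J' else 0.

(* e_J is sent to the sum over j in J of
   (-1)^#{k in J | k < j} y_j e_(J :\ j) *)
Definition koszul_diff n (c : koszul n.+1) : koszul n :=
  [ffun J : {J : {set 'I_(size ys)} | #|J| == n} =>
     \sum_(j : 'I_(size ys) | j \notin val J)
       (-1) ^+ #|[set k : 'I_(size ys) in val J | (k < j)%N]| * ys`_j
         * koszul_coef c (j |: val J)].

Lemma koszul_diff_linear n : linear (@koszul_diff n).
Proof.
move=> r c d; apply/ffunP => J; rewrite !ffunE scaler_sumr -big_split /=.
apply: eq_bigr => j _; rewrite /koszul_coef; case: insubP => [J' _ _|_].
  by rewrite !ffunE mulrDr; congr (_ + _); rewrite [LHS]mulrCA.
by rewrite !mulr0 scaler0 addr0.
Qed.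
HB.instance Definition _ n := GRing.isLinear.Build R (koszul n.+1) (koszul n)
  *:%R (@koszul_diff n) (@koszul_diff_linear n).

Definition koszul_cohomology (i : nat) M : lmodType R :=
  Hom_cohomology (fun n => @koszul_diff n) M i.
End Koszul.
End Cohomology.

Section Grades.
Variable R : comPzRingType.
Implicit Types (a : ideal R) (M : lmodType R) (S : lmodType R -> Prop).

Definition generates (ys : seq R) a : Prop := a =i @genmod R R^o ys.

Definition noetherian : Prop := forall a, exists ys, generates ys a.

Definition finitely_generated M : Prop :=
  exists s : seq M, forall m, m \in @genmod R M s.

Definition short_exact (L M N : lmodType R) (f : {linear L -> M})
    (g : {linear M -> N}) : Prop :=
  [/\ injective f, forall m, g m = 0 <-> (exists l, f l = m)
    & forall n, exists m, g m = n].

Definition serre_class S : Prop :=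
  (exists M, S M) /\
  forall (L M N : lmodType R) (f : {linear L -> M}) (g : {linear M -> N}),
    short_exact f g -> (S M <-> S L /\ S N).

Definition closed_under_direct_sums S : Prop :=
  forall (I : Type) (N : I -> lmodType R), (forall i, S (N i)) -> S (dirsum N).

(* P M, for P an ideal or a (finite) sequence of elements of R *)
Definition mulM (P : {pred R}) M : submodClosed M :=
  @smul R M P (@fullmod R M).

Section Sequences.
Variables (S : lmodType R -> Prop) (a : ideal R) (M : lmodType R).

Definition weak_Mseq (xs : seq R) : Prop :=
  forall i, (i < size xs)%N ->
  S (subquot (colon (mulM [in take i xs] M) xs`_i) (mulM [in take i xs] M)).

Definition Mseq (xs : seq R) : Prop :=
  weak_Mseq xs /\ ~ S (quotmod (mulM [in xs] M)).

Definition seq_in (xs : seq R) : Prop := forall x, x \in xs -> x \in a.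

(* xs is a sequence in a with property P that cannot be extended by appending
   an element of a *)
Definition maximal_in (P : seq R -> Prop) (xs : seq R) : Prop :=
  [/\ P xs, seq_in xs & forall x, x \in a -> ~ P (rcons xs x)].
End Sequences.

Definition inf_degree (P : nat -> Prop) : \bar int :=
  infimum +oo%E [set (i%:Z)%:E%E | i in [set i | P i]].

Definition sup_degree (P : nat -> Prop) : \bar int :=
  supremum -oo%E [set (i%:Z)%:E%E | i in [set i | P i]].

Definition Hgrade S a M : \bar int :=
  inf_degree (fun i => ~ S (local_cohomology i a M)).

Definition Egrade S a M : \bar int :=
  inf_degree (fun i => ~ S (Ext i (quotmod a) M)).

Definition Kgrade S (ys : seq R) M : \bar int :=
  inf_degree (fun i => ~ S (koszul_cohomology ys i M)).

Definition Cgrade S a M : \bar int :=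
  sup_degree (fun l =>
    exists ys : seq R, [/\ size ys = l, seq_in a ys & weak_Mseq S M ys]).
End Grades.

(* Main.v *)
(* Membership in S of a subquotient A / B is handled through linear relations: A / B
   is in S as soon as it is a subquotient of a module of S along some relation, so
   that no induced maps on cohomology are needed.

   The key point is that if (0 :_M a) is in S, for M finitely generated, then
   (0 :_M x) is in S for some x in a: for the largest submodule N of M lying in S,
   the Noetherian module M / N has no nonzero element killed by a, hence a contains
   a nonzerodivisor on M / N.  Let T be the cohomology of Hom(C, -), for a complex C
   of projective modules such that T preserves S and each x in a acts nilpotently.
   If (0 :_M x) is in S, then modulo S the long exact sequences of
   0 -> (0 :_M x) -> M -> x M -> 0 and 0 -> x M -> M -> M / x M -> 0
   relate T^i(M) to T^(i-1)(M / x M), because x acts nilpotently on T^i(M).  Thus the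
   first n modules T^i(M) are in S if and only if a contains a weak M-sequence of
   length n, provided T^0(M) in S implies (0 :_M a) in S.  This applies to Koszul
   cohomology and to Ext(R/a, -); for N finitely generated and killed by powers of the
   elements of a, a weak M-sequence of length n in a still puts Ext^i(N, M) in S for
   i < n.  Finally H^i_a(M) is the union of the images of Ext^i(R/a^k, M), and the
   kernel of Ext^i(R/a, M) -> H^i_a(M) is a union of images of Ext^(i-1)(N, M), for N
   the kernel of R/a^k -> R/a. *)
Require Import Defs.
From HB Require Import structures.
From mathcomp Require Import all_boot all_order all_algebra.
From mathcomp Require Import finmap.
From mathcomp Require Import all_classical.
From mathcomp Require Import constructive_ereal.

Set Implicit Arguments.
Unset Strict Implicit.
Unset Printing Implicit Defensive.

Import Order.TTheory GRing.Theory Num.Theory.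

Local Open Scope ring_scope.

(** * Subquotients in a Serre class *)

Section Linearity.
Variable R : comPzRingType.
Implicit Types U V W : lmodType R.

(** Submodules as bare propositional predicates, so that intersections, images and colons can be
    written as formulas on the spot; [submod_pack] turns one back into a [submodClosed]. *)
Definition linear_pred V (A : V -> Prop) : Prop :=
  A 0 /\ forall r u v, A u -> A v -> A (r *: u + v).

(** A submodule of U x V. Such relations act as partially defined, multivalued homomorphisms; the
    maps between subquotients used below, connecting maps included, are given by them. *)
Definition linear_rel U V (rho : U -> V -> Prop) : Prop :=
  rho 0 0 /\ forall r u v u' v',
    rho u v -> rho u' v' -> rho (r *: u + u') (r *: v + v').

Lemma linear_predD V (A : V -> Prop) u v :
  linear_pred A -> A u -> A v -> A (u + v).
Proof. by move=> [_ AL] Au /(AL 1 _ _ Au); rewrite scale1r. Qed.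

Lemma linear_predZ V (A : V -> Prop) r u : linear_pred A -> A u -> A (r *: u).
Proof. by move=> [A0 AL] Au; have := AL r _ _ Au A0; rewrite addr0. Qed.

Lemma linear_predN V (A : V -> Prop) u : linear_pred A -> A u -> A (- u).
Proof. by move=> AL /(linear_predZ (-1) AL); rewrite scaleN1r. Qed.

Lemma linear_predB V (A : V -> Prop) u v :
  linear_pred A -> A u -> A v -> A (u - v).
Proof. by move=> AL Au Av; apply: linear_predD => //; apply: linear_predN. Qed.

Lemma linear_pred_submod V (A : submodClosed V) : linear_pred (fun v => v \in A).
Proof. by split=> [|r u v uA vA]; rewrite ?rpred0 // rpredD // rpredZ. Qed.

Lemma linear_pred_sum V (A : V -> Prop) (I : Type) (s : seq I) (P : pred I)
    (F : I -> V) :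
  linear_pred A -> (forall i, P i -> A (F i)) -> A (\sum_(i <- s | P i) F i).
Proof.
move=> AL AF; elim/big_ind: _ => // [|u v Au Av]; first by case: AL.
exact: linear_predD.
Qed.

Lemma linear_predI V (A B : V -> Prop) :
  linear_pred A -> linear_pred B -> linear_pred (fun v => A v /\ B v).
Proof.
by move=> [A0 AL] [B0 BL]; split=> // r u v [? ?] [? ?]; split; [exact: AL|exact: BL].
Qed.

Lemma linear_pred_comap U V (f : {linear U -> V}) (B : V -> Prop) :
  linear_pred B -> linear_pred (fun u => B (f u)).
Proof.
by move=> [B0 BL]; split=> [|r u v fu fv]; rewrite ?linear0 ?linearP //; exact: BL.
Qed.

Lemma linear_pred0 V : linear_pred (fun v : V => v = 0).
Proof. by split=> // r u v -> ->; rewrite scaler0 addr0. Qed.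

Lemma linear_pred_colon V (A : V -> Prop) (P : R -> Prop) :
  linear_pred A -> linear_pred (fun v => forall r, P r -> A (r *: v)).
Proof.
move=> [A0 AL]; split=> [r _|s u v Au Av r Pr]; first by rewrite scaler0.
by rewrite scalerDr scalerA mulrC -scalerA; apply: AL; [exact: Au|exact: Av].
Qed.

Lemma linear_pred_im U V (f : {linear U -> V}) (A : U -> Prop) :
  linear_pred A -> linear_pred (fun v => exists2 u, A u & f u = v).
Proof.
move=> [A0 AL]; split=> [|r _ _ [u Au <-] [v Av <-]].
  by exists 0; rewrite ?linear0.
by exists (r *: u + v); rewrite ?linearP //; exact: AL.
Qed.

Lemma linear_rel_fun U V (f : {linear U -> V}) : linear_rel (fun u v => f u = v).
Proof.
by split=> [|r u v u' v' <- <-]; rewrite ?linear0 ?linearP.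
Qed.

Lemma linear_rel_cofun U V (f : {linear V -> U}) : linear_rel (fun u v => f v = u).
Proof.
by split=> [|r u v u' v' <- <-]; rewrite ?linear0 ?linearP.
Qed.

Lemma linear_rel_span U V W (f : {linear W -> U}) (g : {linear W -> V}) :
  linear_rel (fun u v => exists2 w, u = f w & v = g w).
Proof.
split=> [|r _ _ _ _ [w -> ->] [w' -> ->]]; first by exists 0; rewrite linear0.
by exists (r *: w + w'); rewrite linearP.
Qed.

Lemma linear_rel_eq V : linear_rel (@eq V).
Proof. by split=> // r u v u' v' -> ->. Qed.

Definition lin_pack U V (f : U -> V) (fL : linear f) : {linear U -> V} :=
  HB.pack f (GRing.isLinear.Build R U V *:%R f fL).

Definition pred_submod V (A : V -> Prop) : {pred V} := fun v => `[< A v >].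

Lemma pred_submod_closed V (A : V -> Prop) :
  linear_pred A -> submod_closed (pred_submod A).
Proof.
case=> A0 AL; split=> [|r u v /asboolP Au /asboolP Av]; apply/asboolP => //.
exact: AL.
Qed.

Definition submod_pack V (A : V -> Prop) (AL : linear_pred A) : submodClosed V :=
  HB.pack (pred_submod A)
    (GRing.isSubmodClosed.Build R V (pred_submod A) (pred_submod_closed AL)).

Lemma submod_packE V (A : V -> Prop) (AL : linear_pred A) v :
  v \in submod_pack AL <-> A v.
Proof. exact: (iff_sym (rwP (asboolP _))). Qed.

Lemma quotmod_pi_eq0 V (A : submodClosed V) v : quotmod_pi A v = 0 <-> v \in A.
Proof. by rewrite -(linear0 (quotmod_pi A)) -{2}[v]subr0; exact: quotmod_eq. Qed.

Lemma quotmod_pi_surj V (A : submodClosed V) (x : quotmod A) :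
  exists v, quotmod_pi A v = x.
Proof. by eexists; exact: quotmod_piK. Qed.

(** Two values at u differ by a value at 0, so the relation is single-valued, and uniqueness forces
    the chosen function to be linear. *)
Lemma linear_rel_total U V (rho : U -> V -> Prop) :
    linear_rel rho -> (forall u, exists v, rho u v) ->
    (forall v, rho 0 v -> v = 0) ->
  exists f : {linear U -> V}, forall u, rho u (f u).
Proof.
move=> [_ rhoL] /choice[f fP] rho0.
have rho_inj u v w : rho u v -> rho u w -> v = w.
  move=> uv uw; apply/esym/eqP; rewrite -subr_eq0 addrC -scaleN1r; apply/eqP/rho0.
  by rewrite -[X in rho X](addNr u) -scaleN1r; exact: rhoL.
have fL : linear f by move=> r u v; apply: rho_inj (fP _) _; exact: rhoL.
by exists (lin_pack fL).
Qed.

End Linearity.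

(** * Closure properties of subquotients in S *)

Section Serre.
Variables (R : comPzRingType) (S : lmodType R -> Prop).
Hypothesis S_serre : serre_class S.
Implicit Types U V W : lmodType R.

Lemma serre_ext V (A : submodClosed V) :
  S V <-> S (submod A) /\ S (quotmod A).
Proof.
apply: (S_serre.2 _ _ _ (val : {linear submod A -> V}) (quotmod_pi A)).
split=> [|v|]; [exact: val_inj| |exact: quotmod_pi_surj].
apply: (iff_trans (quotmod_pi_eq0 _ _)); split=> [vA|[u <-]]; last exact: valP.
by exists (Sub v vA).
Qed.

(** The domain of [rho] is a submodule of U on which [rho] is the graph of a surjection onto V, so V
    is a subquotient of U. *)
Lemma serre_relation U V (rho : U -> V -> Prop) :
  linear_rel rho -> (forall v, exists u, rho u v) ->
  (forall v, rho 0 v -> v = 0) -> S U -> S V.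
Proof.
move=> rhoL rho_surj rho0 SU.
have domL : linear_pred (fun u => exists v, rho u v).
  split=> [|r u u' [v uv] [v' uv']]; first by exists 0; case: rhoL.
  by exists (r *: v + v'); case: rhoL => _; exact.
set A := submod_pack domL.
have SA : S (submod A) by case/(serre_ext A): SU.
have rho'L : linear_rel (fun (u : submod A) v => rho (val u) v).
  by split=> [|r u v u' v']; [case: rhoL|exact: rhoL.2].
have [f fP] : exists f : {linear submod A -> V}, forall u, rho (val u) (f u).
  by apply: (linear_rel_total rho'L) => // u; exact: (submod_packE _ _).1 (valP u).
suff fE : short_exact (val : {linear submod (kerm f) -> submod A}) f.
  by have [] := (S_serre.2 _ _ _ _ _ fE).1 SA.
split=> [|u|v]; first exact: val_inj.
  split=> [fu|[w <-]]; last by apply/eqP; exact: valP w.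
  by have uK : u \in kerm f by [apply/eqP]; exists (Sub u uK : submod (kerm f)).
have [u uv] := rho_surj v; have uA : u \in A by apply/submod_packE; exists v.
exists (Sub u uA); apply/eqP; rewrite -subr_eq0; apply/eqP/rho0.
have := (rhoL.2 (-1) _ _ _ _ uv (fP (Sub u uA))).
by rewrite /= !scaleN1r addNr addrC.
Qed.

(* "A / (A :&: B) is in S", witnessed by a presentation of A / (A :&: B) as a
   subquotient of a module of S *)
Definition sq_in V (A B : V -> Prop) : Prop :=
  exists (X : lmodType R) (rho : X -> V -> Prop), [/\ S X, linear_rel rho,
    forall v, A v -> exists x, rho x v & forall v, A v -> rho 0 v -> B v].

Lemma sq_module V : sq_in (fun _ : V => True) (fun v => v = 0) <-> S V.
Proof.
split=> [[X [rho [SX rhoL rho_surj rho0]]]|SV].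
  by apply: (serre_relation rhoL) SX => v; [exact: rho_surj|exact: rho0].
exists V, eq; split=> //; first exact: linear_rel_eq.
by move=> v _; exists v.
Qed.

(** Composing the presentation of C / D with [rho] restricted to C presents A / B. This takes the
    place of induced maps between subquotients. *)
Lemma sq_transfer U V (C D : U -> Prop) (A B : V -> Prop)
    (rho : U -> V -> Prop) :
  linear_pred C -> linear_rel rho ->
  (forall v, A v -> exists2 u, C u & rho u v) ->
  (forall u v, C u -> A v -> rho u v -> D u -> B v) ->
  sq_in C D -> sq_in A B.
Proof.
move=> [C0 CL] rhoL rho_surj rhoD [X [sigma [SX sigmaL sigma_surj sigma0]]].
exists X, (fun x v => exists u, [/\ C u, sigma x u & rho u v]); split=> //.
- split=> [|r u v u' v' [w [Cw ? ?]] [w' [Cw' ? ?]]].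
    by exists 0; split=> //; [case: sigmaL|case: rhoL].
  exists (r *: w + w'); split; first exact: CL.
    by case: sigmaL => _; exact.
  by case: rhoL => _; exact.
- by move=> v /rho_surj[u Cu uv]; have [x xu] := sigma_surj _ Cu; exists x, u.
- by move=> v Av [u [Cu u0 uv]]; exact: rhoD Cu Av uv (sigma0 _ Cu u0).
Qed.

Lemma sq_subset V (A B A' B' : V -> Prop) :
  linear_pred A -> (forall v, A' v -> A v) -> (forall v, A' v -> B v -> B' v) ->
  sq_in A B -> sq_in A' B'.
Proof.
move=> AL A'A BB'; apply: (sq_transfer AL (linear_rel_eq V)) => //.
- by move=> v A'v; exists v; first exact: A'A.
- by move=> u v _ A'v -> Bv; exact: BB'.
Qed.

Lemma sq_subquot V (A B : submodClosed V) :
  S (subquot A B) <-> sq_in (fun v => v \in A) (fun v => v \in B).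
Proof.
split=> [/sq_module|].
  apply: (sq_transfer (rho := fun x v => exists2 u : submod A,
      x = quotmod_pi _ u & v = val u)) => //.
  - exact: linear_rel_span (quotmod_pi _) (val : {linear submod A -> V}).
  - by move=> v vA; exists (quotmod_pi _ (Sub v vA : submod A)) => //; exists (Sub v vA).
  - by move=> _ _ _ _ [u -> ->] /quotmod_pi_eq0.
move=> h; apply/sq_module; move: h.
apply: (sq_transfer (rho := fun v x => exists2 u : submod A,
      v = val u & x = quotmod_pi _ u)) => //.
- exact: linear_pred_submod.
- exact: linear_rel_span (val : {linear submod A -> V}) (quotmod_pi _).
- by move=> x _; have [u <-] := quotmod_pi_surj x; exists (val u); [exact: valP|exists u].
- by move=> _ _ _ _ [u -> ->] uB; apply/quotmod_pi_eq0.
Qed.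

(** In Q = A / (A :&: B), the image of A :&: A' is in S by the first assumption on S, and the
    quotient of Q by that image is a quotient of A / (A :&: A'). *)
Lemma sq_ext V (A A' B : V -> Prop) :
    linear_pred A -> linear_pred A' -> linear_pred B ->
  sq_in (fun v => A v /\ A' v) B -> sq_in A A' -> sq_in A B.
Proof.
move=> AL A'L BL SAB SAA.
set Q := subquot (submod_pack AL) (submod_pack BL).
have piL : linear_pred (fun x : Q => exists2 u : submod (submod_pack AL),
    A' (val u) & x = quotmod_pi _ u).
  split; first by exists 0; rewrite ?linear0 //; case: A'L.
  move=> r x y [u ? ->] [v ? ->]; exists (r *: u + v); rewrite linearP //.
  by case: A'L => _; exact.
pose rho v (x : Q) := exists2 u : submod (submod_pack AL), 
  v = val u & x = quotmod_pi _ u.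
have rhoL : linear_rel rho.
  exact: linear_rel_span (val : {linear submod (submod_pack AL) -> V}) (quotmod_pi _).
have SQ : S Q.
  apply/(serre_ext (submod_pack piL)); split; apply/sq_module.
    apply: (sq_transfer (rho := fun v x => rho v (val x))) SAB.
    - exact: linear_predI.
    - split=> [|r x v x' v' xv xv']; first exact: rhoL.1.
      by rewrite linearP; exact: rhoL.2.
    - move=> x _; have [u A'u xu] := (submod_packE _ _).1 (valP x).
      exists (val u); last by exists u.
      by split=> //; exact: (submod_packE _ _).1 (valP u).
    - move=> _ x _ _ [u -> xu] Bu; apply: val_inj; rewrite /= xu.
      by apply/quotmod_pi_eq0; exact: (submod_packE BL _).2.
  apply: (sq_transfer (rho := fun v x => exists2 y, rho v y & x = quotmod_pi _ y)) SAA => //.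
  - split=> [|r x v x' v' [y xy ->] [y' xy' ->]].
      by exists 0; rewrite ?linear0 //; exact: rhoL.1.
    by exists (r *: y + y'); [exact: rhoL.2|exact/esym/linearP].
  - move=> x _; have [y <-] := quotmod_pi_surj x; have [u <-] := quotmod_pi_surj y.
    by exists (val u); [exact: (submod_packE _ _).1 (valP u)|exists (quotmod_pi _ u) => //; exists u].
  - move=> v _ _ _ [y [u -> ->] ->] A'v.
    by apply/quotmod_pi_eq0/(submod_packE piL _).2; exists u.
apply: sq_subset ((sq_subquot (submod_pack AL) (submod_pack BL)).1 SQ) => //.
- exact: linear_pred_submod.
- by move=> v Av; exact: (submod_packE _ _).2.
- by move=> v _ /(submod_packE BL _).1.
Qed.

Lemma serre_zero V : (forall v : V, v = 0) -> S V.
Proof.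
move=> V0; have [X SX] := S_serre.1; apply/sq_module.
exists X, (fun _ _ => True); split=> // v _; by exists 0.
Qed.

Lemma sq_trivial V (A B : V -> Prop) : (forall v, A v -> B v) -> sq_in A B.
Proof.
move=> AB; have [X SX] := S_serre.1; exists X, (fun _ _ => True); split=> // v Av.
  by exists 0.
by move=> _; exact: AB.
Qed.

Lemma sq_comap U V (f : {linear V -> U}) (C D : U -> Prop) (A B : V -> Prop) :
  linear_pred C -> (forall v, A v -> C (f v)) ->
  (forall v, A v -> D (f v) -> B v) -> sq_in C D -> sq_in A B.
Proof.
move=> CL AC DB; apply: (sq_transfer CL (linear_rel_cofun f)).
  by move=> v Av; exists (f v) => //; exact: AC.
by move=> u v _ Av <-; exact: DB.
Qed.

(** The maps [e i] together embed A / B into a finite power of C / D. Instead of forming the power,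
    the induction splits off the kernel of one map at a time. *)
Lemma sq_jointly_inj U V (C D : U -> Prop) (A B : V -> Prop) (I : eqType)
    (s : seq I) (e : I -> {linear V -> U}) :
    linear_pred A -> linear_pred B -> linear_pred C -> linear_pred D ->
    (forall i v, i \in s -> A v -> C (e i v)) ->
    (forall v, A v -> (forall i, i \in s -> D (e i v)) -> B v) ->
  sq_in C D -> sq_in A B.
Proof.
move=> + BL CL DL + + SCD; elim: s A => [|i s IH] A AL AC DB.
  by apply: sq_trivial => v Av; exact: DB.
apply: (sq_ext (A' := fun v => D (e i v))) => //.
- exact: linear_pred_comap.
- apply: IH => [|j v js [Av _]|v [Av Div] Dv].
  + by apply: linear_predI => //; exact: linear_pred_comap.
  + by apply: AC => //; rewrite inE js orbT.
  + by apply: DB => // j; rewrite inE => /predU1P[-> //|]; exact: Dv.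
- apply: (sq_comap (f := e i) CL) SCD => // v Av.
  by apply: AC => //; rewrite mem_head.
Qed.

(** Filter A / B by the kernels of the powers of x: modulo the kernel of x, multiplication by x
    embeds the kernel of x^(k+1) into that of x^k. *)
Lemma sq_nilpotent V (A B : V -> Prop) (x : R) (n : nat) :
    linear_pred A -> linear_pred B -> (forall v, A v -> B (x ^+ n *: v)) ->
  sq_in (fun v => A v /\ B (x *: v)) B -> sq_in A B.
Proof.
move=> AL BL An SB.
suff H k : sq_in (fun v => A v /\ B (x ^+ k *: v)) B.
  apply: sq_subset (H n) => [|v Av|//]; last by split=> //; exact: An.
  by apply: linear_predI => //; exact: (linear_pred_comap ( *:%R (x ^+ n))).
have kL j : linear_pred (fun v => A v /\ B (x ^+ j *: v)).
  by apply: linear_predI => //; exact: (linear_pred_comap ( *:%R (x ^+ j))).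
elim: k => [|k IH]; first by apply: sq_trivial => v []; rewrite expr0 scale1r.
have xL : linear_pred (fun v => B (x *: v)) by exact: (linear_pred_comap ( *:%R x)).
apply: (sq_ext (A' := fun v => B (x *: v))) => //.
  apply: sq_subset SB => [|v [[Av _] ?]|//]; last by [].
  exact: linear_predI.
apply: (sq_comap (f := *:%R x) (kL k)) IH => [v [Av Bv]|//].
by split; [exact: linear_predZ|rewrite scalerA -exprSr].
Qed.

(** A / B is a subquotient of the direct sum of the An / B, by adding up representatives of the
    components; the An are not assumed to form a chain. *)
Lemma sq_union V (A : V -> Prop) (An : nat -> V -> Prop) (B : V -> Prop) :
    closed_under_direct_sums S -> linear_pred B ->
    (forall n, linear_pred (An n)) -> (forall v, A v -> exists n, An n v) ->
  (forall n, sq_in (An n) B) -> sq_in A B.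
Proof.
move=> S_sum BL AnL AAn SAn.
pose Q n := subquot (submod_pack (AnL n)) (submod_pack BL).
have SQ : S (dirsum Q).
  apply: S_sum => n; apply/sq_subquot; apply: sq_subset (AnL n) _ _ (SAn n).
    by move=> v /(submod_packE _ _).1.
  by move=> v _ /(submod_packE BL _).2.
(* [w] lifts the components of [f], vanishes from N on, and adds up to v modulo B. Since N may be
   enlarged, two such lifts can be combined. *)
pose sec (w : forall n, submod (submod_pack (AnL n))) (f : dirsum Q) (v : V) N :=
  [/\ forall n, val f n = quotmod_pi _ (w n), forall n, (N <= n)%N -> w n = 0
    & B (v - \sum_(i < N) val (w i))].
have sec_widen w f v N N' : sec w f v N -> (N <= N')%N -> sec w f v N'.
  move=> [wf w0 Bv] NN'; split=> // [n /(leq_trans NN')/w0//|].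
  rewrite -(subnKC NN') big_split_ord /= [X in _ - (_ + X)]big1 ?addr0 // => i _.
  by rewrite w0 ?leq_addr.
exists (dirsum Q), (fun f v => exists w N, sec w f v N); split=> //.
- split=> [|r f v f' v' [w [N wN]] [w' [N' wN']]].
    exists (fun=> 0), 0%N; split=> // [n|]; first exact: (esym (linear0 _)).
    by rewrite big_ord0 subr0; exact: BL.1.
  exists (fun n => r *: w n + w' n), (maxn N N').
  have [wf w0 Bv] := sec_widen _ _ _ _ _ wN (leq_maxl N N').
  have [w'f w'0 Bv'] := sec_widen _ _ _ _ _ wN' (leq_maxr N N').
  split=> [n|n nN|]; first by rewrite -[LHS]/(r *: val f n + val f' n) wf w'f linearP.
    by rewrite w0 // w'0 // scaler0 addr0.
  rewrite big_split /= -scaler_sumr opprD addrACA -scalerBr.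
  exact: BL.2.
- move=> v /AAn[k Akv].
  have vk : v \in submod_pack (AnL k) by exact: (submod_packE _ _).2.
  (* The element v in position k and 0 elsewhere; its membership proof is transported along n =
     k. *)
  pose w n : submod (submod_pack (AnL n)) :=
    if n =P k is ReflectT nk then
      Sub v (eq_ind_r (fun m => v \in submod_pack (AnL m)) vk nk) else 0.
  have w0 n : n != k -> w n = 0 by rewrite /w; case: eqP.
  have wk : val (w k) = v by rewrite /w; case: eqP.
  have fF : (fun n => quotmod_pi _ (w n) : Q n) \in finite_supp (N := Q).
    apply/asboolP; apply: sub_finite_set (finite_set1 k) => n /=.
    move=> wn; apply/eqP; apply: contraNT wn => /w0 ->.
    by apply/eqP; exact: linear0.
  exists (Sub (fun n => quotmod_pi _ (w n) : Q n) fF), w, k.+1; split=> //.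
    by move=> n kn; apply: w0; rewrite gtn_eqF.
  rewrite big_ord_recr /= wk big1 ?add0r ?subrr; first exact: BL.1.
  by move=> i _; rewrite w0 // ltn_eqF.
move=> v _ [w [N [wf _ Bv]]].
rewrite -[v](subrK (\sum_(i < N) val (w i))); apply: linear_predD => //.
apply: linear_pred_sum => // i _.
by have /esym/quotmod_pi_eq0/(submod_packE BL _).1 := wf i.
Qed.

End Serre.

(** * Noetherian modules and regular elements *)

Section Noetherian.
Variable R : comPzRingType.
Implicit Types V : lmodType R.

Lemma genmod_sub V (s : seq V) (A : V -> Prop) v :
  linear_pred A -> (forall u, u \in s -> A u) -> v \in genmod s -> A v.
Proof.
move=> AL As /asboolP[c ->]; apply: linear_pred_sum => // i _.
by apply: linear_predZ => //; apply/As/mem_nth.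
Qed.

Lemma mem_genmod V (s : seq V) v : v \in s -> v \in genmod s.
Proof.
move=> vs; apply/asboolP; have vi : (index v s < size s)%N by rewrite index_mem.
exists (fun i => (val i == index v s)%:R).
rewrite (bigD1 (Ordinal vi)) //= eqxx scale1r nth_index // big1 ?addr0 // => i.
by rewrite -val_eqE /= => /negPf ->; rewrite scale0r.
Qed.

Lemma genmod_subset V (s t : seq V) v :
  {subset s <= t} -> v \in genmod s -> v \in genmod t.
Proof.
move=> st; apply: (genmod_sub (linear_pred_submod (genmod t))) => u /st.
exact: mem_genmod.
Qed.

Lemma genmod_consP V (x : V) (s : seq V) v :
  v \in genmod (x :: s) -> exists r, v - r *: x \in genmod s.
Proof.
apply: (@genmod_sub _ _ (fun v => exists r, v - r *: x \in genmod s)) => [|u]; last first.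
  rewrite inE => /predU1P[->|us]; first by exists 1; rewrite scale1r subrr rpred0.
  by exists 0; rewrite scale0r subr0; exact: mem_genmod.
split=> [|r u u' [a ua] [b ub]]; first by exists 0; rewrite scale0r subr0 rpred0.
exists (r * a + b); rewrite scalerDl opprD addrACA -scalerA -scalerBr.
by rewrite rpredD // rpredZ.
Qed.

Definition noetherian_module V : Prop := forall A : V -> Prop,
  linear_pred A -> exists t, (forall v, v \in t -> A v) /\
    forall v, A v -> v \in genmod t.

(** Induction on the generators: the coefficients of x in elements of A form an ideal, which is
    finitely generated, and the elements of A in the span of s are covered by the induction
    hypothesis. *)
Lemma sub_fg_noetherian (R_noeth : noetherian R) V (s : seq V) (A : V -> Prop) :
    linear_pred A -> (forall v, A v -> v \in genmod s) ->
  exists t, (forall v, v \in t -> A v) /\ forall v, A v -> v \in genmod t.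
Proof.
elim: s A => [|x s IH] A AL As; first by exists [::].
have IL : linear_pred (fun r : R^o => exists2 v, A v & v - (r : R) *: x \in genmod s).
  split=> [|r a b [u Au ua] [v Av vb]].
    by exists 0; [exact: AL.1|rewrite scale0r subr0 rpred0].
  exists (r *: u + v); first exact: AL.2.
  rewrite [X in X *: x](_ : _ = r * a + b) //.
  by rewrite scalerDl opprD addrACA -scalerA -scalerBr rpredD // rpredZ.
have [ys ysP] := R_noeth (submod_pack IL).
have /choice[g gP] (y : R) : exists v, y \in ys -> A v /\ v - y *: x \in genmod s.
  have [yys|] := boolP (y \in ys); last by exists 0.
  have : y \in submod_pack IL by rewrite ysP; exact: (mem_genmod (V := R^o)).
  by move/(submod_packE IL _).1 => [v Av vx]; exists v.
have [t [At tP]] : exists t, (forall v, v \in t -> A v) /\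
    forall v, A v -> v \in genmod s -> v \in genmod t.
  have [||t [At tP]] := IH (fun v => A v /\ v \in genmod s).
  - by apply: linear_predI => //; exact: linear_pred_submod.
  - by move=> v [].
  by exists t; split=> [v /At[]//|v Av vs]; apply: tP.
exists (map g ys ++ t); split=> [v|v Av].
  by rewrite mem_cat => /orP[/mapP[y /gP[? _] ->]|/At].
have /genmod_consP[r vr] := As v Av.
have : (r : R^o) \in submod_pack IL by apply/(submod_packE IL _).2; exists v.
rewrite ysP => /asboolP[c rE].
(* [u] has the same coefficient r of x as v, so v - u lies both in A and in the span of s. *)
pose u := \sum_i c i *: g ys`_i.
have Au : A u.
  by apply: linear_pred_sum => // i _; apply: linear_predZ => //; case: (gP _ (mem_nth 0 (ltn_ord i))).
have us : u - r *: x \in genmod s.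
  rewrite rE scaler_suml -sumrB; apply: rpred_sum => i _.
  rewrite -[(c i *: _ : R^o)]/(c i * ys`_i) -scalerA -scalerBr rpredZ //.
  by case: (gP _ (mem_nth 0 (ltn_ord i))).
rewrite -[v](subrK u); apply: rpredD; last first.
  apply: rpred_sum => i _; apply: rpredZ; apply: mem_genmod.
  by rewrite mem_cat map_f ?mem_nth.
apply: (genmod_subset (s := t)); first by move=> w wt; rewrite mem_cat wt orbT.
apply: tP; first exact: linear_predB.
have -> : v - u = v - r *: x - (u - r *: x) by rewrite opprB addrA subrK.
exact: rpredB.
Qed.

Lemma fg_noetherian (R_noeth : noetherian R) V :
  finitely_generated V -> noetherian_module V.
Proof. by move=> [s sP] A AL; exact: (@sub_fg_noetherian R_noeth _ s). Qed.

Lemma regular_noetherian : noetherian R -> noetherian_module R^o.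
Proof.
move=> R_noeth; apply: fg_noetherian => //; exists [:: 1] => r; apply/asboolP.
by exists (fun=> r); rewrite big_ord1; exact/esym/mulr1.
Qed.

(** Without a maximal member, iterated choice gives a strictly increasing chain. Its union is
    finitely generated, so all generators, hence the whole union, lie in one stage. *)
Lemma noetherian_max V (F : (V -> Prop) -> Prop) :
    noetherian_module V -> (forall A, F A -> linear_pred A) -> (exists A, F A) ->
  exists2 A, F A & forall B, F B -> (forall v, A v -> B v) -> forall v, B v -> A v.
Proof.
move=> V_noeth FL [A0 FA0]; apply: contrapT => nomax.
have grow (A : {A | F A}) : exists B : {B | F B},
    (forall v, sval A v -> sval B v) /\ exists v, sval B v /\ ~ sval A v.
  case: A => A FA /=; apply: contrapT => nogrow; apply: nomax; exists A => // B FB AB v Bv.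
  by apply: contrapT => nAv; apply: nogrow; exists (exist _ B FB); split=> //; exists v.
have [next nextP] := choice grow.
pose chain n := sval (iter n next (exist _ A0 FA0)).
have chainL n : linear_pred (chain n) by apply: FL; exact: svalP.
have chainS m n v : (m <= n)%N -> chain m v -> chain n v.
  by move=> /subnK <-; elim: (n - m)%N => // k IH /IH; exact: (nextP _).1.
have UL : linear_pred (fun v => exists n, chain n v).
  split=> [|r u v [m mu] [n nv]]; first by exists 0%N; exact: (chainL 0%N).1.
  exists (maxn m n); apply: (chainL _).2.
    by apply: chainS mu; exact: leq_maxl.
  by apply: chainS nv; exact: leq_maxr.
have [t [Ut tP]] := V_noeth _ UL.
have [N NP] : exists N, forall v, v \in t -> chain N v.
  elim: t Ut {tP} => [|x t IH] Ut; first by exists 0%N.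
  have [|N NP] := IH; first by move=> v vt; apply: Ut; rewrite inE vt orbT.
  have [|m mx] := Ut x; first exact: mem_head.
  exists (maxn m N) => v; rewrite inE => /predU1P[->|/NP].
    by apply: chainS mx; exact: leq_maxl.
  by apply: chainS; exact: leq_maxr.
have [v [v1 v0]] := (nextP (iter N next (exist _ A0 FA0))).2.
by apply: v0; apply: (genmod_sub (chainL N) NP); apply: tP; exists N.+1.
Qed.

(* The primes are assumed pairwise equal or incomparable, so that the induction
   need not discard those contained in another one. *)
Lemma prime_avoidance (a : R -> Prop) (I : eqType) (s : seq I) (p : I -> R -> Prop) :
    linear_pred (V := R^o) a -> (forall i, linear_pred (V := R^o) (p i)) ->
    (forall i, i \in s -> forall x y, p i (x * y) -> p i x \/ p i y) ->
    (forall i, i \in s -> ~ p i 1) ->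
    (forall i j, i \in s -> j \in s -> (forall x, p i x -> p j x) ->
       forall x, p j x -> p i x) ->
    (forall i, i \in s -> exists2 x, a x & ~ p i x) ->
  exists2 x, a x & forall i, i \in s -> ~ p i x.
Proof.
move=> aL pL; elim: s => [|i s IH] pM p1 p_max ap; first by exists 0; [exact: aL.1|].
have sub j : j \in s -> j \in i :: s by move=> js; rewrite inE js orbT.
have [|||j js|x ax xs] := IH.
- by move=> j /sub; exact: pM.
- by move=> j /sub; exact: p1.
- by move=> j k /sub js /sub ks; exact: p_max.
- by apply/ap/sub.
have [px|npx] := pselect (p i x); last first.
  by exists x => // j; rewrite inE => /predU1P[->//|]; exact: xs.
have im : i \in i :: s by exact: mem_head.
(* [y] is the product of an element of a outside p_i with one element of p_j outside p_i for each j
   in s; primality of p_i keeps the product outside p_i. *)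
have [y [ay piy ys]] : exists y, [/\ a y, ~ p i y & forall j, j \in s -> p j y].
  have [z az pz] := ap i im.
  have : forall j, j \in s -> exists2 r, p j r & ~ p i r.
    (* An inclusion of p_j in p_i would be an equality, whereas x lies in p_i but not in p_j. *)
    move=> j js; apply: contrapT => H; apply: (xs j js); apply: (p_max j i) (px) => //.
      exact: sub.
    by move=> r pjr; apply: contrapT => pir; apply: H; exists r.
  elim: s {IH pM p1 p_max ap xs sub im} (pM i im) => [|j s IH] piM H; first by exists z.
  have [|y [ay piy ys]] := IH piM; first by move=> k ks; apply: H; rewrite inE ks orbT.
  have [|r pjr pir] := H j; first exact: mem_head.
  exists (r * y); split.
  - exact: (linear_predZ (V := R^o)).
  - by case/piM.
  move=> k; rewrite inE => /predU1P[->|/ys pky]; last exact: (linear_predZ (V := R^o)).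
  by rewrite mulrC; exact: (linear_predZ (V := R^o)).
exists (x + y); first exact: (linear_predD (V := R^o)).
move=> j; rewrite inE => /predU1P[->|js] pxy.
  apply: piy; rewrite -[y](addKr x) addrC.
  exact: (linear_predB (V := R^o)).
apply: (xs j js); rewrite -[x](addrK y).
by apply: (linear_predB (V := R^o)) => //; exact: ys.
Qed.

End Noetherian.

(** * Regular elements modulo a submodule *)

Section RegularElement.
Variable R : comPzRingType.
Hypothesis R_noeth : noetherian R.
Implicit Types V : lmodType R.

(* The maximal ones among the ideals (N : m), m not in N, are prime, and finitely
   many of them suffice to cover the zero divisors of V / N. *)
Lemma regular_element V (N : V -> Prop) (a : R -> Prop) :
    noetherian_module V -> linear_pred N -> linear_pred (V := R^o) a ->
    (forall m, (forall r, a r -> N (r *: m)) -> N m) ->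
  exists2 x, a x & forall m, N (x *: m) -> N m.
Proof.
move=> V_noeth NL aL aN.
pose ann m : R -> Prop := fun r => N (r *: m).
have annL m : linear_pred (V := R^o) (ann m).
  split=> [|r x y xm ym]; rewrite /ann; first by rewrite scale0r; exact: NL.1.
  by rewrite scalerDl -scalerA; exact: NL.2.
pose maxi m := ~ N m /\ forall m', ~ N m' -> (forall r, ann m r -> ann m' r) ->
  forall r, ann m' r -> ann m r.
(* If y m is not in N, its annihilator contains that of m, so the two agree by maximality; it
   contains x. *)
have maxi_prime m : maxi m -> forall x y, ann m (x * y) -> ann m x \/ ann m y.
  move=> [Nm mP] x y xy; have [|ny] := pselect (ann m y); [by right|left].
  apply: (mP (y *: m)) => //; last by rewrite /ann scalerA.
  by move=> r rm; rewrite /ann scalerA mulrC -scalerA; exact: linear_predZ.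
have maxi_above m : ~ N m -> exists2 m', maxi m' & forall r, ann m r -> ann m' r.
  move=> Nm; pose F (A : R^o -> Prop) := exists m', [/\ A = ann m', ~ N m' &
    forall r, ann m r -> ann m' r].
  have [||_ [m' [-> Nm' mm']] m'P] := noetherian_max (F := F) (regular_noetherian R_noeth).
  - by move=> _ [m' [-> _ _]]; exact: annL.
  - by exists (ann m), m.
  exists m' => //; split=> // n Nn m'n; apply: m'P => //.
  by exists n; split=> // r /mm'/m'n.
(* A maximal submodule spanned by finitely many such m contains all of them, which yields the finite
   list [t]. *)
pose F (A : V -> Prop) := exists2 t : seq V, A = (fun v => v \in genmod t) &
  forall m, m \in t -> maxi m.
have [||_ [t -> t_maxi] tP] := noetherian_max (F := F) V_noeth.
- by move=> _ [t -> _]; exact: linear_pred_submod.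
- by exists (fun v => v \in genmod [::]), [::].
have t_span m : maxi m -> m \in genmod t.
  move=> mm; apply: (tP (fun v => v \in genmod (m :: t))).
  - by exists (m :: t) => // n; rewrite inE => /predU1P[->|/t_maxi].
  - by move=> v; apply: genmod_subset => n nt; rewrite inE nt orbT.
  - by apply: mem_genmod; exact: mem_head.
(* As m is in the span of t, the intersection of the [ann n], n in t, lies in the prime [ann m]; so
   some [ann n] lies in [ann m], with equality because [ann n] is maximal. *)
have t_ann m : maxi m -> exists2 n, n \in t & forall r, ann m r -> ann n r.
  move=> mm; suff [n nt nm] : exists2 n, n \in t & forall r, ann n r -> ann m r.
    exists n => //; have [Nn nP] := t_maxi _ nt; have [Nm _] := mm.
    exact: nP.
  apply: contrapT => none.
  have [x xt xm] : exists2 x, (forall n, n \in t -> ann n x) & ~ ann m x.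
    have : forall n, n \in t -> exists2 x, ann n x & ~ ann m x.
      move=> n nt; apply: contrapT => H; apply: none; exists n => // r nr.
      by apply: contrapT => mr; apply: H; exists r.
    elim: t {t_maxi tP t_span none} => [|n t IH] H.
      by exists 1 => //; rewrite /ann scale1r; case: mm.
    have [|x xt xm] := IH; first by move=> k kt; apply: H; rewrite inE kt orbT.
    have [|y yn ym] := H n; first exact: mem_head.
    exists (x * y); last by case/(maxi_prime _ mm).
    move=> k; rewrite inE => /predU1P[->|/xt xk]; first exact: (linear_predZ (V := R^o)).
    by rewrite mulrC; exact: (linear_predZ (V := R^o)).
  apply: xm; apply: (genmod_sub (A := fun n => N (x *: n)) _ xt (t_span _ mm)).
  exact: (linear_pred_comap ( *:%R x)).
have [||||x ax xt] := @prime_avoidance R a V t ann aL annL.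
- by move=> m /t_maxi; exact: maxi_prime.
- by move=> m /t_maxi[Nm _]; rewrite /ann scale1r.
- by move=> m n /t_maxi[Nm mP] /t_maxi[Nn _]; exact: mP.
- move=> m /t_maxi[Nm _]; apply: contrapT => H; apply: Nm; apply: aN => r ar.
  by apply: contrapT => rm; apply: H; exists r.
exists x => // m xm; apply: contrapT => Nm.
have [n nm mn] := maxi_above m Nm; have [k kt nk] := t_ann n nm.
by apply: (xt k kt); exact/nk/mn.
Qed.

(** Let N be maximal among the submodules in S. Modulo (0 : a), the submodule (N : a) embeds into a
    finite power of N through multiplication by generators of a, so it is in S and equals N. Some x
    in a is then regular on V / N, and (0 : x) lies in N. *)
Lemma serre_regular_element (S : lmodType R -> Prop) V (a : R -> Prop) :
    serre_class S -> finitely_generated V -> linear_pred (V := R^o) a ->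
    sq_in S (fun m : V => forall r, a r -> r *: m = 0) (fun m => m = 0) ->
  exists2 x, a x & sq_in S (fun m : V => x *: m = 0) (fun m => m = 0).
Proof.
move=> S_serre /(fg_noetherian R_noeth) V_noeth aL Sa.
pose F (A : V -> Prop) := linear_pred A /\ sq_in S A (fun m => m = 0).
have [||N [NL SN] NP] := noetherian_max (F := F) V_noeth; first by move=> A [].
  exists (fun m => m = 0); split; first exact: linear_pred0.
  exact: sq_trivial.
have annL (A : V -> Prop) := @linear_pred_colon R V A a.
have [m aN|x ax xN] := regular_element V_noeth NL aL.
  apply: (NP (fun m => forall r, a r -> N (r *: m))) => // [|v Nv r _]; last exact: linear_predZ.
  split; first exact: annL.
  apply: (sq_ext S_serre (A' := fun m => forall r, a r -> r *: m = 0)).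
  - exact: annL.
  - exact: (annL _ (@linear_pred0 R V)).
  - exact: linear_pred0.
  - apply: sq_subset Sa => [|v []//|//]; exact: (annL _ (@linear_pred0 R V)).
  have [ys [ay yP]] := regular_noetherian R_noeth aL.
  apply: (sq_jointly_inj S_serre (s := ys) (e := fun y => *:%R y)) SN => //.
  - exact: annL.
  - exact: (annL _ (@linear_pred0 R V)).
  - exact: linear_pred0.
  - by move=> y v /ay ary; apply.
  move=> v _ yv r /yP; apply: (genmod_sub (V := R^o) (A := fun r => r *: v = 0)) => //.
  split=> [|s x y xv zv]; first exact: scale0r.
  by rewrite scalerDl -scalerA xv zv scaler0 addr0.
exists x => //; apply: (sq_subset NL _ _ SN) => // m xm.
by apply: xN; rewrite xm; exact: NL.1.
Qed.

End RegularElement.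

(** * Long exact sequences modulo a Serre class *)

Section Complexes.
Variable R : comPzRingType.
Implicit Types K : nat -> lmodType R.

Definition cocycle K (d : forall n, {linear K n -> K n.+1}) i (v : K i) : Prop :=
  d i v = 0.

Definition cobound K (d : forall n, {linear K n -> K n.+1}) i : K i -> Prop :=
  match i with
  | 0 => fun v => v = 0
  | j.+1 => fun v => exists u, d j u = v
  end.

Lemma cocycle_linear K d i : linear_pred (@cocycle K d i).
Proof. exact: (linear_pred_comap (d i) (@linear_pred0 R _)). Qed.

Lemma cobound_linear K d i : linear_pred (@cobound K d i).
Proof.
case: i => [|i]; first exact: linear_pred0.
split=> [|r _ _ [u <-] [v <-]]; first by exists 0; rewrite linear0.
by exists (r *: u + v); rewrite linearP.
Qed.

Lemma coboundariesE K d i v : v \in @coboundaries R K d i <-> @cobound K d i v.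
Proof. by case: i v => [|i] v; [exact: (iff_sym (rwP eqP))|exact: (iff_sym (rwP (asboolP _)))]. Qed.

Lemma sq_cohomology (S : lmodType R -> Prop) (S_serre : serre_class S) K d i :
  S (@cohomology R K d i) <-> sq_in S (@cocycle K d i) (@cobound K d i).
Proof.
split=> [/(sq_subquot S_serre) h|h].
  apply: (sq_subset (linear_pred_submod _) _ _ h) => v; first by move=> dv; apply/eqP.
  by move=> _ /coboundariesE.
apply/(sq_subquot S_serre); apply: (sq_subset (cocycle_linear d i) _ _ h) => v.
  by move/eqP.
by move=> _ /coboundariesE.
Qed.

Lemma cobound_map K K' (d : forall n, {linear K n -> K n.+1})
    (d' : forall n, {linear K' n -> K' n.+1}) (f : forall n, {linear K n -> K' n}) :
  (forall i v, f i.+1 (d i v) = d' i (f i v)) ->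
  forall i v, @cobound K d i v -> @cobound K' d' i (f i v).
Proof.
move=> fd [|i] v /=; first by move=> ->; rewrite linear0.
by case=> u <-; exists (f i u); rewrite fd.
Qed.

Lemma cobound_cocycle K (d : forall n, {linear K n -> K n.+1}) :
  (forall i v, d i.+1 (d i v) = 0) -> forall i v, @cobound K d i v -> @cocycle K d i v.
Proof.
move=> dd [|i] v /=; first by move=> ->; rewrite /cocycle linear0.
by case=> u <-; exact: dd.
Qed.

End Complexes.

Arguments cocycle {R K} d {i} v.
Arguments cobound {R K} d {i} v.

Section LongExactSequence.
Variables (R : comPzRingType) (S : lmodType R -> Prop).
Hypothesis S_serre : serre_class S.
Variables (K' K K'' : nat -> lmodType R).
Variables (d' : forall n, {linear K' n -> K' n.+1}).
Variables (d : forall n, {linear K n -> K n.+1}).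
Variables (d'' : forall n, {linear K'' n -> K'' n.+1}).
Variables (f : forall n, {linear K' n -> K n}) (g : forall n, {linear K n -> K'' n}).
Hypothesis dd : forall i v, d i.+1 (d i v) = 0.
Hypothesis fd : forall i v, f i.+1 (d' i v) = d i (f i v).
Hypothesis gd : forall i v, g i.+1 (d i v) = d'' i (g i v).
Hypothesis fg : forall i, short_exact (f i) (g i).

Let f_inj i u : f i u = 0 -> u = 0.
Proof. by case: (fg i) => inj _ _; rewrite -{1}(linear0 (f i)) => /inj. Qed.

Let gf i u : g i (f i u) = 0.
Proof. by case: (fg i) => _ ex _; apply/ex; exists u. Qed.

Let g_ker i v : g i v = 0 -> exists u, f i u = v.
Proof. by case: (fg i) => _ ex _ /ex. Qed.

Let g_surj i w : exists v, g i v = w.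
Proof. by case: (fg i). Qed.

Let cobound_lift i v : cobound d'' (g i v) -> exists2 b, cobound d b & g i (v - b) = 0.
Proof.
case: i v => [|i] v /=; first by exists 0; rewrite // subr0.
case=> w; have [u <-] := g_surj w; rewrite -gd => guv.
by exists (d i u); [exists u|rewrite linearB guv subrr].
Qed.

Let cocycle_f i u : cocycle d (f i u) -> cocycle d' u.
Proof. by rewrite /cocycle -fd => /f_inj. Qed.

(** The kernel of H^i(K) -> H^i(K'') is a quotient of H^i(K'): a cocycle that becomes a coboundary
    in K'' is some f u up to a coboundary of K. *)
Lemma les_mid i : sq_in S (cocycle d' (i := i)) (cobound d' (i := i)) ->
  sq_in S (fun v : K i => cocycle d v /\ cobound d'' (g i v)) (cobound d (i := i)).
Proof.
apply: (sq_transfer (rho := fun u v => exists2 b, cobound d b & v = f i u + b)).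
- exact: cocycle_linear.
- split=> [|r u _ u' _ [b db ->] [b' db' ->]].
    by exists 0; [exact: (cobound_linear d i).1|rewrite linear0 addr0].
  exists (r *: b + b'); first exact: (cobound_linear d i).2.
  by rewrite linearP scalerDr addrACA.
- move=> v [dv /cobound_lift[b db /g_ker[u uE]]]; exists u.
    apply: cocycle_f; rewrite uE; apply: linear_predB => //.
      exact: cocycle_linear.
    exact: cobound_cocycle db.
  by exists b => //; rewrite uE subrK.
- move=> u _ _ _ [b db ->] u0; apply: linear_predD => //; first exact: cobound_linear.
  exact: cobound_map u0.
Qed.

(** The kernel of H^i(K') -> H^i(K) is a quotient of H^(i-1)(K'') by the connecting relation, and it
    is zero in degree 0, where the hypothesis is vacuous. *)
Lemma les_left i :
  (forall j, i = j.+1 -> sq_in S (cocycle d'' (i := j)) (cobound d'' (i := j))) ->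
  sq_in S (fun u : K' i => cocycle d' u /\ cobound d (f i u)) (cobound d' (i := i)).
Proof.
case: i => [_|i /(_ _ erefl)].
  by apply: sq_trivial => // u [_ /= /f_inj].
apply: (sq_transfer (rho := fun c u => exists2 w, g i w = c & d i w = f i.+1 u)).
- exact: cocycle_linear.
- split=> [|r c u c' u' [w wc wu] [w' wc' wu']].
    by exists 0; rewrite !linear0.
  by exists (r *: w + w'); rewrite !linearP ?wc ?wu ?wc' ?wu'.
- move=> u [du [w wu]]; exists (g i w); last by exists w.
  by rewrite /cocycle -gd wu gf.
- move=> _ u _ _ [w <- wu] /cobound_lift[b db /g_ker[t tE]]; exists t.
  apply/eqP; rewrite -subr_eq0; apply/eqP/f_inj.
  by rewrite linearB fd tE linearB (cobound_cocycle dd db) wu subr0 subrr.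
Qed.

Lemma les_middle i :
  sq_in S (cocycle d' (i := i)) (cobound d' (i := i)) ->
  sq_in S (cocycle d'' (i := i)) (cobound d'' (i := i)) ->
  sq_in S (cocycle d (i := i)) (cobound d (i := i)).
Proof.
move=> /les_mid S' S''; apply: (sq_ext S_serre _ _ _ S').
- exact: cocycle_linear.
- exact: (linear_pred_comap (g i) (cobound_linear d'' i)).
- exact: cobound_linear.
apply: (sq_comap (f := g i) (cocycle_linear d'' i) _ _ S'') => // v dv.
by rewrite /cocycle -gd dv linear0.
Qed.

Lemma les_first i :
  sq_in S (cocycle d (i := i)) (cobound d (i := i)) ->
  (forall j, i = j.+1 -> sq_in S (cocycle d'' (i := j)) (cobound d'' (i := j))) ->
  sq_in S (cocycle d' (i := i)) (cobound d' (i := i)).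
Proof.
move=> SK /les_left S'; apply: (sq_ext S_serre _ _ _ S').
- exact: cocycle_linear.
- exact: (linear_pred_comap (f i) (cobound_linear d i)).
- exact: cobound_linear.
apply: (sq_comap (f := f i) (cocycle_linear d i) _ _ SK) => // v dv.
by rewrite /cocycle -fd dv linear0.
Qed.

(** Split H^i(K'') along the image of H^i(K): what remains embeds into H^(i+1)(K') by the connecting
    relation. *)
Lemma les_last i :
  sq_in S (cocycle d (i := i)) (cobound d (i := i)) ->
  sq_in S (cocycle d' (i := i.+1)) (cobound d' (i := i.+1)) ->
  sq_in S (cocycle d'' (i := i)) (cobound d'' (i := i)).
Proof.
move=> SK S'; apply: (sq_ext S_serre (A' := fun z => exists2 k, cocycle d k & g i k = z)).
- exact: cocycle_linear.
- exact: linear_pred_im (cocycle_linear d i).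
- exact: cobound_linear.
- apply: (sq_transfer (cocycle_linear d i) (linear_rel_fun (g i)) _ _ SK) => [z [_ //]|].
  by move=> k _ _ _ <-; exact: cobound_map.
apply: (sq_transfer (rho := fun u z => exists2 k, g i k = z & f i.+1 u = d i k)) S'.
- exact: cocycle_linear.
- split=> [|r c u c' u' [w wc wu] [w' wc' wu']].
    by exists 0; rewrite !linear0.
  by exists (r *: w + w'); rewrite !linearP ?wc ?wu ?wc' ?wu'.
- move=> z dz; have [k kz] := g_surj z.
  have [u uk] : exists u, f i.+1 u = d i k by apply: g_ker; rewrite gd kz.
  by exists u; [apply: cocycle_f; rewrite uk; exact: dd|exists k].
- move=> u _ _ _ [k <- uk] [t tu]; exists (k - f i t); last by rewrite linearB gf subr0.
  by rewrite /cocycle linearB -uk -tu fd subrr.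
Qed.

End LongExactSequence.

Section Hom.
Variable R : comPzRingType.
Implicit Types U V W M N L : lmodType R.

Lemma hom_linear U V (phi : homMod U V) : linear (val phi).
Proof. exact/asboolP/(valP phi). Qed.

Definition hom_fun U V (phi : homMod U V) : {linear U -> V} :=
  lin_pack (hom_linear phi).

Lemma mkhom_subproof U V (f : {linear U -> V}) : (f : U -> V) \in @linmaps R U V.
Proof. by apply/asboolP => r u v; rewrite linearP. Qed.

Definition mkhom U V (f : {linear U -> V}) : homMod U V :=
  Sub (f : U -> V) (mkhom_subproof f).

Lemma hom_ext U V (phi psi : homMod U V) :
  (forall u, val phi u = val psi u) -> phi = psi.
Proof. by move=> h; apply/val_inj/funext. Qed.

Lemma hom0 U V (phi : homMod U V) : val phi 0 = 0.
Proof. exact: (linear0 (hom_fun phi)). Qed.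

Lemma homZ U V (phi : homMod U V) r u : val phi (r *: u) = r *: val phi u.
Proof. exact: (linearZ_LR (hom_fun phi)). Qed.

Definition hom_post U M N (s : {linear M -> N}) (phi : homMod U M) : homMod U N :=
  mkhom (s \o hom_fun phi).

Lemma hom_post_linear U M N (s : {linear M -> N}) : linear (@hom_post U M N s).
Proof. by move=> r phi psi; apply: hom_ext => u; exact: linearP. Qed.
HB.instance Definition _ U M N (s : {linear M -> N}) :=
  GRing.isLinear.Build R (homMod U M) (homMod U N) *:%R (@hom_post U M N s)
    (@hom_post_linear U M N s).

Lemma hom_eval_linear U M u : linear (fun phi : homMod U M => val phi u).
Proof. by []. Qed.

Definition hom_eval U M u : {linear homMod U M -> M} := lin_pack (@hom_eval_linear U M u).

Lemma hom_rel U V (rho : U -> V -> Prop) :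
    linear_rel rho -> (forall u, exists v, rho u v) ->
    (forall v, rho 0 v -> v = 0) ->
  exists phi : homMod U V, forall u, rho u (val phi u).
Proof. by move=> rhoL tot rho0; have [f fP] := linear_rel_total rhoL tot rho0; exists (mkhom f). Qed.

Lemma linear_rel_comp U V M (f : {linear U -> M}) (g : {linear V -> M}) :
  linear_rel (fun u v => f u = g v).
Proof. by split=> [|r u v u' v' uv uv']; rewrite ?linear0 // !linearP uv uv'. Qed.

Lemma linear_pred_rel U V (A : U -> Prop) (rho : U -> V -> Prop) :
  linear_pred A -> linear_rel rho -> linear_pred (fun v => exists2 u, A u & rho u v).
Proof.
move=> [A0 AL] [rho0 rhoL]; split=> [|r v w [u Au uv] [u' Au' uw]]; first by exists 0.
by exists (r *: u + u'); [exact: AL|exact: rhoL].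
Qed.

Definition projective_module P : Prop :=
  forall M N (s : {linear M -> N}), (forall n, exists m, s m = n) ->
  forall phi : homMod P N, exists psi : homMod P M, hom_post s psi = phi.

Lemma hom_short_exact P L M N (f : {linear L -> M}) (g : {linear M -> N}) :
  projective_module P -> short_exact f g ->
  short_exact (@hom_post P L M f) (@hom_post P M N g).
Proof.
move=> P_proj [f_inj fg g_surj]; split=> [phi psi|phi|]; last exact: P_proj.
  move=> e; apply: hom_ext => u; apply: f_inj.
  exact: (congr1 (fun h : homMod P M => val h u) e).
split=> [gphi|[psi <-]]; last first.
  by apply: hom_ext => u; apply/fg; exists (val psi u).
have [|u||psi psiP] := @hom_rel P L (fun u l => hom_fun phi u = f l).
- exact: linear_rel_comp.
- have [l lE] : exists l, f l = val phi u.
    by apply/fg; exact: (congr1 (fun h : homMod P N => val h u) gphi).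
  by exists l.
- by move=> l; rewrite linear0 -(linear0 f) => /f_inj.
by exists psi; apply: hom_ext => u; exact: (esym (psiP u)).
Qed.

End Hom.

(** * Cohomology of Hom(C, M) for a complex C of projective modules *)

Section HomComplex.
Variables (R : comPzRingType) (S : lmodType R -> Prop).
Hypothesis S_serre : serre_class S.
Variables (C : nat -> lmodType R) (dC : forall n, {linear C n.+1 -> C n}).
Hypothesis C_proj : forall n, projective_module (C n).
Hypothesis dCdC : forall n c, dC n (dC n.+1 c) = 0.
Implicit Types L M N : lmodType R.

Definition hom_diff M n : {linear homMod (C n) M -> homMod (C n.+1) M} :=
  @homMod_comp R _ _ M (dC n).

Definition hom_cocycle M i : homMod (C i) M -> Prop := cocycle (hom_diff M) (i := i).
Definition hom_cobound M i : homMod (C i) M -> Prop := cobound (hom_diff M) (i := i).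

Lemma hom_diff2 M i (phi : homMod (C i) M) : hom_diff M i.+1 (hom_diff M i phi) = 0.
Proof. by apply: hom_ext => u /=; rewrite dCdC hom0. Qed.

Lemma hom_diff_post M N (s : {linear M -> N}) i (phi : homMod (C i) M) :
  hom_post s (hom_diff M i phi) = hom_diff N i (hom_post s phi).
Proof. exact: hom_ext. Qed.

Lemma sq_Hom_cohomology M i :
  S (Hom_cohomology dC M i) <-> sq_in S (@hom_cocycle M i) (@hom_cobound M i).
Proof. exact: sq_cohomology. Qed.

Definition vanish_below n M : Prop :=
  forall i, (i < n)%N -> S (Hom_cohomology dC M i).

Hypothesis Hom_cohomology_serre : forall L, S L -> forall i, S (Hom_cohomology dC L i).

Section ShortExact.
Variables (L M N : lmodType R) (f : {linear L -> M}) (g : {linear M -> N}).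
Hypothesis fg : short_exact f g.

Let hfg i : short_exact (@hom_post R (C i) L M f) (@hom_post R (C i) M N g).
Proof. exact: hom_short_exact. Qed.

Lemma Hom_les_mid i : S (Hom_cohomology dC L i) ->
  sq_in S (fun v => hom_cocycle v /\ hom_cobound (hom_post g v)) (@hom_cobound M i).
Proof.
move=> /sq_Hom_cohomology.
by apply: (les_mid _ _ _ hfg) => //; [exact: hom_diff2|exact: hom_diff_post..].
Qed.

Lemma Hom_les_left i : (forall j, i = j.+1 -> S (Hom_cohomology dC N j)) ->
  sq_in S (fun v => hom_cocycle v /\ hom_cobound (hom_post f v)) (@hom_cobound L i).
Proof.
move=> SN; apply: (les_left S_serre _ _ _ hfg); [exact: hom_diff2|exact: hom_diff_post..|].
by move=> j /SN/sq_Hom_cohomology.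
Qed.

Lemma Hom_les_middle i : S (Hom_cohomology dC L i) ->
  S (Hom_cohomology dC N i) -> S (Hom_cohomology dC M i).
Proof.
move=> /sq_Hom_cohomology SL /sq_Hom_cohomology SN; apply/sq_Hom_cohomology.
by apply: (les_middle S_serre _ _ _ hfg) SL SN; [exact: hom_diff2|exact: hom_diff_post..].
Qed.

Lemma Hom_les_last i : S (Hom_cohomology dC M i) ->
  S (Hom_cohomology dC L i.+1) -> S (Hom_cohomology dC N i).
Proof.
move=> /sq_Hom_cohomology SM /sq_Hom_cohomology SL; apply/sq_Hom_cohomology.
by apply: (les_last S_serre _ _ _ hfg) SM SL; [exact: hom_diff2|exact: hom_diff_post..].
Qed.

End ShortExact.

Lemma vanish_below_mod_serre M N (s : {linear M -> N}) n :
  (forall y, exists m, s m = y) -> S (submod (kerm s)) ->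
  vanish_below n M <-> vanish_below n N.
Proof.
move=> s_surj Sker.
have se : short_exact (val : {linear submod (kerm s) -> M}) s.
  split=> [|m|//]; first exact: val_inj.
  split=> [sm|[u <-]]; last by apply/eqP; exact: valP u.
  by have mK : m \in kerm s by [apply/eqP]; exists (Sub m mK : submod (kerm s)).
have Sker_coh := Hom_cohomology_serre Sker.
split=> v i /v Si; first exact: Hom_les_last se _ Si (Sker_coh _).
exact: Hom_les_middle se _ (Sker_coh _) Si.
Qed.

(** Write T^i for the cohomology. From M to N, T^(i+1)(x M) comes from T^(i+1)(M) and T^(i+2)(0 :
    x), then T^i(N) from T^i(M) and T^(i+1)(x M). Conversely, x acts nilpotently on T^i(M), so only
    the kernel of x on it matters. Since x factors as M -> x M -> M, this kernel is built from a
    quotient of T^i(0 : x) and from the kernel of T^i(x M) -> T^i(M), a quotient of T^(i-1)(N). *)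
Lemma vanish_below_shift (x : R) k M N (s : {linear M -> N}) n :
    (forall P i (phi : homMod (C i) P),
       hom_cocycle phi -> hom_cobound (x ^+ k *: phi)) ->
    (forall y, exists m, s m = y) ->
    (forall m, s m = 0 <-> exists m', x *: m' = m) ->
    S (submod (kerm ( *:%R x : {linear M -> M}))) ->
  vanish_below n.+1 M <-> vanish_below n N.
Proof.
set scal : {linear M -> M} := *:%R x.
move=> xk s_surj s_ker Sker.
have im m : scal m \in imm scal by apply/asboolP; exists m.
have pL : linear (fun m => Sub (scal m) (im m) : submod (imm scal)).
  by move=> r u v; apply: val_inj; rewrite /= linearP.
pose p := lin_pack pL.
have se1 : short_exact (val : {linear submod (kerm scal) -> M}) p.
  split=> [|m|y]; first exact: val_inj.
    split=> [/(congr1 val) xm|[u <-]]; last first.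
      by apply: val_inj; apply/eqP; exact: valP u.
    by have mK : m \in kerm scal by [apply/eqP]; exists (Sub m mK : submod (kerm scal)).
  by have /asboolP[m my] := valP y; exists m; apply: val_inj.
have se2 : short_exact (val : {linear submod (imm scal) -> M}) s.
  split=> [|m|//]; first exact: val_inj.
  split=> [/s_ker[m' m'm]|[u <-]]; first by exists (p m').
  by apply/s_ker; have /asboolP := valP u.
have Sker_coh := Hom_cohomology_serre Sker.
split=> v i ni.
  apply: (Hom_les_last se2); first by apply: v; exact: ltnW.
  by apply: (Hom_les_last se1) => //; exact: v.
have vN j : i = j.+1 -> S (Hom_cohomology dC N j) by move=> ij; apply: v; rewrite -ltnS -ij.
apply/sq_Hom_cohomology; apply: (sq_nilpotent S_serre (x := x) (n := k)).
- exact: cocycle_linear.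
- exact: cobound_linear.
- by move=> phi; exact: xk.
apply: (sq_ext S_serre (A' := fun phi => hom_cobound (hom_post p phi))).
- apply: linear_predI; first exact: cocycle_linear.
  exact: (linear_pred_comap ( *:%R x) (cobound_linear (hom_diff M) i)).
- exact: (linear_pred_comap (hom_post p) (cobound_linear (hom_diff _) i)).
- exact: cobound_linear.
- apply: (sq_subset _ _ _ (Hom_les_mid se1 (Sker_coh i))) => //.
    apply: linear_predI; first exact: cocycle_linear.
    exact: (linear_pred_comap (hom_post p) (cobound_linear (hom_diff _) i)).
  by move=> phi [[? _] ?].
apply: (sq_comap (f := hom_post p) _ _ _ (Hom_les_left se2 vN)).
- apply: linear_predI; first exact: cocycle_linear.
  exact: (linear_pred_comap (hom_post _) (cobound_linear (hom_diff _) i)).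
- move=> phi [dphi xphi]; split.
    by rewrite /hom_cocycle /cocycle -hom_diff_post dphi linear0.
  by rewrite (_ : hom_post _ _ = x *: phi) //; exact: hom_ext.
- by move=> phi _.
Qed.

End HomComplex.

(** * Weak sequences *)

Section MulM.
Variables (R : comPzRingType) (M : lmodType R).

Lemma mulM_sub (P : {pred R}) (A : M -> Prop) v :
  linear_pred A -> (forall r m, r \in P -> A (r *: m)) ->
  v \in mulM P M -> A v.
Proof.
move=> AL AP /asboolP[s [sP ->]]; rewrite big_seq.
by apply: linear_pred_sum => // p /sP[pP _]; exact: AP.
Qed.

Lemma mem_mulM (P : {pred R}) r m : r \in P -> r *: m \in mulM P M.
Proof.
move=> rP; apply/asboolP; exists [:: (r, m)]; rewrite big_seq1; split=> // p.
by rewrite inE => /eqP ->.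
Qed.

Lemma mulM_subset (P Q : {pred R}) v :
  {subset P <= Q} -> v \in mulM P M -> v \in mulM Q M.
Proof.
move=> PQ; apply: (@mulM_sub P (fun v => v \in mulM Q M)).
  exact: linear_pred_submod.
by move=> r m /PQ; exact: mem_mulM.
Qed.

Lemma mulM_rconsP xs x v : v \in mulM [in rcons xs x] M <->
  exists m, v - x *: m \in mulM [in xs] M.
Proof.
split=> [|[m vm]].
  apply: (@mulM_sub _ (fun v => exists m, v - x *: m \in mulM [in xs] M)).
    split=> [|r u w [m um] [n wn]]; first by exists 0; rewrite scaler0 subr0 rpred0.
    exists (r *: m + n); rewrite scalerDr opprD addrACA scalerA mulrC -scalerA.
    by rewrite -scalerBr rpredD // rpredZ.
  move=> r m; rewrite -[r \in _]/(r \in rcons xs x) mem_rcons inE.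
  case/predU1P=> [->|rxs].
    by exists m; rewrite subrr rpred0.
  by exists 0; rewrite scaler0 subr0; exact: mem_mulM.
rewrite -[v](subrK (x *: m)) rpredD //.
  apply: mulM_subset vm => r rxs; rewrite -[_ \in _]/(r \in rcons xs x).
  by rewrite mem_rcons inE (rxs : r \in xs) orbT.
by apply: mem_mulM; rewrite -[_ \in _]/(x \in rcons xs x) mem_rcons mem_head.
Qed.

Lemma mulM_nil v : v \in mulM [in [::]] M -> v = 0.
Proof. by apply: (@mulM_sub _ (fun v => v = 0)) => //; exact: linear_pred0. Qed.

End MulM.

Section WeakSequences.
Variables (R : comPzRingType) (S : lmodType R -> Prop).
Hypothesis S_serre : serre_class S.
Implicit Types M N : lmodType R.

Lemma sq_submod M (A : submodClosed M) :
  S (submod A) <-> sq_in S (fun m => m \in A) (fun m => m = 0).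
Proof.
apply: (iff_trans (iff_sym (sq_module S_serre _))); split=> h.
  apply: (sq_transfer _ (linear_rel_fun (val : {linear submod A -> M})) _ _ h) => //.
    by move=> v vA; exists (Sub v vA).
  by move=> u _ _ _ <- ->.
apply: (sq_comap (f := (val : {linear submod A -> M})) _ _ _ h).
- exact: linear_pred_submod.
- by move=> v _; exact: valP.
- by move=> v _ /submod_val_eq0.
Qed.

(** The last colon module is the kernel of x on M / (xs) M; in this form the definition supports
    induction from the end of the sequence. *)
Lemma weak_Mseq_rcons M xs x : weak_Mseq S M (rcons xs x) <->
  weak_Mseq S M xs /\
  S (submod (kerm ( *:%R x : {linear quotmod (mulM [in xs] M) -> _}))).
Proof.
have colonE : S (subquot (colon (mulM [in xs] M) x) (mulM [in xs] M)) <->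
    S (submod (kerm ( *:%R x : {linear quotmod (mulM [in xs] M) -> _}))).
  apply: (iff_trans (sq_subquot S_serre _ _)).
  apply: (iff_trans _ (iff_sym (sq_submod _))); split=> h.
    apply: (sq_transfer _ (linear_rel_fun (quotmod_pi (mulM [in xs] M))) _ _ h).
    - exact: linear_pred_submod.
    - move=> y /eqP xy; have [m my] := quotmod_pi_surj y; exists m => //.
      suff : x *: m \in mulM [in xs] M by [].
      apply/quotmod_pi_eq0; rewrite linearZ_LR.
      exact: (etrans (congr1 ( *:%R x) my) xy).
    - by move=> m _ _ _ <- /quotmod_pi_eq0.
  apply: (sq_comap (f := quotmod_pi (mulM [in xs] M)) _ _ _ h).
  - exact: linear_pred_submod.
  - move=> m xm; apply/eqP; rewrite /= -linearZ_LR; exact/quotmod_pi_eq0.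
  - by move=> m _ /quotmod_pi_eq0.
have taker i : (i <= size xs)%N -> take i (rcons xs x) = take i xs.
  by move=> ixs; rewrite -cats1 takel_cat.
split=> [w|[w wx] i].
  split=> [i ixs|].
    have := w i; rewrite size_rcons nth_rcons ixs (taker i (ltnW ixs)).
    by apply; exact: ltnW.
  apply/colonE; have := w (size xs).
  by rewrite size_rcons nth_rcons ltnn eqxx taker // take_size; apply.
rewrite size_rcons ltnS leq_eqVlt => /predU1P[->|ixs].
  by rewrite nth_rcons ltnn eqxx taker // take_size; exact/colonE.
by rewrite nth_rcons ixs (taker i (ltnW ixs)); exact: w.
Qed.

Lemma quotmod_fg M (A : submodClosed M) :
  finitely_generated M -> finitely_generated (quotmod A).
Proof.
move=> [s sP]; exists (map (quotmod_pi A) s) => y.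
have [m <-] := quotmod_pi_surj y.
apply: (@genmod_sub _ _ s (fun m => quotmod_pi A m \in _) m _ _ (sP m)).
  exact: (linear_pred_comap (quotmod_pi A) (linear_pred_submod _)).
by move=> u us; apply: mem_genmod; exact: map_f.
Qed.

Variables (C : nat -> lmodType R) (dC : forall n, {linear C n.+1 -> C n}).
Hypothesis C_proj : forall n, projective_module (C n).
Hypothesis dCdC : forall n c, dC n (dC n.+1 c) = 0.
Hypothesis Hom_cohomology_serre :
  forall L, S L -> forall i, S (Hom_cohomology dC L i).
Variable a : ideal R.
Hypothesis a_nilpotent : forall x : R, x \in a -> exists k,
  forall P i (phi : homMod (C i) P),
    hom_cocycle dC phi -> hom_cobound dC (x ^+ k *: phi).

(** Each element of the sequence trades one degree: [vanish_below_shift] applies to the projection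
    of M / (xs) M onto M / (xs, x) M, whose kernel is x (M / (xs) M). *)
Lemma weak_Mseq_vanish M xs n : seq_in a xs -> weak_Mseq S M xs ->
  vanish_below S dC (size xs + n) M <-> vanish_below S dC n (quotmod (mulM [in xs] M)).
Proof.
elim/last_ind: xs n => [|xs x IH] n axs.
  move=> _; apply: (vanish_below_mod_serre S_serre C_proj dCdC Hom_cohomology_serre
    (s := quotmod_pi (mulM [in [::]] M))); first exact: quotmod_pi_surj.
  apply: serre_zero => // u; apply/submod_val_eq0.
  by apply/mulM_nil/quotmod_pi_eq0/eqP; exact: valP u.
move=> /weak_Mseq_rcons[w Sx].
have xa : x \in a by apply: axs; rewrite mem_rcons mem_head.
have [k xk] := a_nilpotent xa.
rewrite size_rcons addSnnS; apply: (iff_trans (IH _ _ w)).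
  by move=> y yxs; apply: axs; rewrite mem_rcons inE yxs orbT.
(* The projection [s] is the relation between the two classes of a same m. *)
have [|y|y [m /esym/quotmod_pi_eq0 m0 ->]|s sP] := @linear_rel_total R (quotmod (mulM [in xs] M))
  (quotmod (mulM [in rcons xs x] M))
  (fun y y' => exists2 m, y = quotmod_pi _ m & y' = quotmod_pi _ m).
- exact: linear_rel_span.
- by have [m <-] := quotmod_pi_surj y; exists (quotmod_pi _ m), m.
- apply/quotmod_pi_eq0/mulM_rconsP; exists 0; by rewrite scaler0 subr0.
apply: (vanish_below_shift S_serre C_proj dCdC Hom_cohomology_serre (x := x) (k := k) (s := s)) => //.
  move=> y'; have [m <-] := quotmod_pi_surj y'; exists (quotmod_pi _ m).
  have [m' /quotmod_eq mm' ->] := sP (quotmod_pi _ m); apply/quotmod_eq.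
  apply/mulM_rconsP; exists 0; rewrite scaler0 subr0.
  by rewrite -opprB rpredN.
move=> y; have [m -> ->] := sP y; split.
  move=> /quotmod_pi_eq0/mulM_rconsP[m' mm']; exists (quotmod_pi _ m').
  by rewrite -linearZ_LR; apply/quotmod_eq; rewrite -opprB rpredN.
move=> [y']; have [m' <-] := quotmod_pi_surj y'; rewrite -linearZ_LR => /quotmod_eq mm'.
by apply/quotmod_pi_eq0/mulM_rconsP; exists m'; rewrite -opprB rpredN.
Qed.

Hypothesis R_noeth : noetherian R.
Hypothesis Hom_cohomology0 : forall M, S (Hom_cohomology dC M 0) ->
  sq_in S (fun m : M => forall r : R, r \in a -> r *: m = 0) (fun m => m = 0).

(** By [weak_Mseq_vanish] with n = 1, T^0 of M / (xs) M is in S; hence so is the part of M / (xs) M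
    killed by a, and [serre_regular_element] supplies x. *)
Lemma weak_Mseq_extend M xs : finitely_generated M -> seq_in a xs ->
    weak_Mseq S M xs -> vanish_below S dC (size xs).+1 M ->
  exists x, [/\ x \in a, seq_in a (rcons xs x) & weak_Mseq S M (rcons xs x)].
Proof.
move=> M_fg axs w; rewrite -addn1 => /(weak_Mseq_vanish _ axs w)/(_ 0%N isT).
move=> /Hom_cohomology0 /(serre_regular_element R_noeth S_serre (quotmod_fg _ M_fg)).
have aL : linear_pred (V := R^o) (fun x : R => x \in a) by exact: linear_pred_submod.
case/(_ aL) => x xa Sx; exists x; split=> //.
  by move=> y; rewrite mem_rcons inE => /predU1P[-> //|/axs].
apply/weak_Mseq_rcons; split=> //; apply/sq_submod.
apply: (sq_subset _ _ _ Sx) => //; last by move=> y /eqP.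
exact: (linear_pred_comap ( *:%R x) (@linear_pred0 R _)).
Qed.

Lemma vanish_below_weak_Mseq M n : finitely_generated M ->
  vanish_below S dC n M <->
  exists xs, [/\ size xs = n, seq_in a xs & weak_Mseq S M xs].
Proof.
move=> M_fg; split=> [|[xs [<- axs w]]]; last first.
  by rewrite -[size xs]addn0; apply/weak_Mseq_vanish.
elim: n => [|n IH] v; first by exists [::].
have [|xs [xsn axs w]] := IH; first by move=> i /ltnW; exact: v.
rewrite -xsn in v; have [x [_ axsx wx]] := weak_Mseq_extend M_fg axs w v.
by exists (rcons xs x); rewrite size_rcons xsn.
Qed.

End WeakSequences.

(** * Koszul cohomology *)

Section FreeModules.
Variable R : comPzRingType.
Implicit Types M N : lmodType R.

Definition ffun_basis (I : finType) (i : I) : {ffun I -> R^o} :=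
  [ffun j => if j == i then 1 else 0].

Lemma ffun_basisE (I : finType) (c : {ffun I -> R^o}) :
  c = \sum_i (c i : R) *: ffun_basis i.
Proof.
apply/ffunP => j; rewrite sum_ffunE (bigD1 j) //= !ffunE eqxx big1 => [|i ij].
  by rewrite addr0; exact/esym/mulr1.
by rewrite !ffunE eq_sym (negPf ij) scaler0.
Qed.

Lemma hom_ffun_basis (I : finType) M (phi : homMod {ffun I -> R^o} M) c :
  val phi c = \sum_i (c i : R) *: val phi (ffun_basis i).
Proof.
rewrite -[LHS]/(hom_fun phi c) {1}[c]ffun_basisE linear_sum.
by apply: eq_bigr => i _; exact: homZ.
Qed.

Definition ffun_hom (I : finType) M (m : I -> M) (c : {ffun I -> R^o}) : M :=
  \sum_i (c i : R) *: m i.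

Lemma ffun_hom_linear (I : finType) M (m : I -> M) : linear (ffun_hom m).
Proof.
move=> r c d; rewrite /ffun_hom scaler_sumr -big_split; apply: eq_bigr => i _ /=.
by rewrite !ffunE scalerDl scalerA.
Qed.

Lemma ffun_hom_basis (I : finType) M (m : I -> M) i : ffun_hom m (ffun_basis i) = m i.
Proof.
rewrite /ffun_hom (bigD1 i) //= ffunE eqxx scale1r big1 ?addr0 // => j ji.
by rewrite ffunE (negPf ji) scale0r.
Qed.

Lemma ffun_projective (I : finType) : projective_module {ffun I -> R^o}.
Proof.
move=> M N s s_surj phi.
have [m mP] := choice (fun i => s_surj (val phi (ffun_basis i))).
exists (mkhom (lin_pack (ffun_hom_linear m))); apply: hom_ext => c.
rewrite [RHS]hom_ffun_basis -[LHS]/(s (ffun_hom m c)) linear_sum.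
by apply: eq_bigr => i _; rewrite linearZ_LR mP.
Qed.

End FreeModules.

(** The terms at (j, k) and (k, j) cancel. The diagonal has its own hypothesis, because antisymmetry
    does not make it vanish when 2 is a zero divisor. *)
Lemma sum_antisym (V : zmodType) n (F : 'I_n -> 'I_n -> V) :
  (forall j, F j j = 0) -> (forall j k : 'I_n, (j < k)%N -> F j k = - F k j) ->
  \sum_j \sum_k F j k = 0.
Proof.
move=> F0 FN.
transitivity (\sum_(j < n) (\sum_(k < n | (j < k)%N) F j k + \sum_(k < n | (k < j)%N) F j k)).
  apply: eq_bigr => j _; rewrite (bigID (fun k : 'I_n => (j < k)%N)) /=; congr (_ + _).
  rewrite (bigID (fun k : 'I_n => (k < j)%N)) /= [X in _ + X]big1 ?addr0.
    by apply: eq_bigl => k; case: ltngtP.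
  move=> k jk; suff -> : k = j by [].
  by apply/val_inj; move: jk; case: ltngtP.
rewrite big_split /= [X in _ + X](exchange_big_dep predT) //= -big_split big1 // => j _.
by rewrite -big_split big1 //= => k jk; rewrite FN // addNr.
Qed.

Section Koszul.
Variables (R : comPzRingType) (ys : seq R).
Local Notation I := 'I_(size ys).
Local Notation coef := (koszul_coef (ys := ys)).
Implicit Types (J : {set I}) (i j k : I).

(** For j not in J, e_j /\ e_J is [sg j J] times e_(j |: J). *)
Let sg (j : I) (J : {set I}) : R := (-1) ^+ #|[set k : I in J | (k < j)%N]|.

Let sgU j k J : j \notin J -> sg k (j |: J) = (if (j < k)%N then - sg k J else sg k J).
Proof.
move=> jJ; rewrite /sg; case: ifP => jk; last first.
  congr (_ ^+ #|pred_of_set _|); apply/setP => l; rewrite !inE andb_orl.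
  by case: eqVneq => //= ->; rewrite jk.
rewrite -[RHS]mulN1r -exprS; congr (_ ^+ _).
rewrite (_ : [set _ in _ | _] = j |: [set l in J | (l < k)%N]).
  by rewrite cardsU1 inE (negPf jJ).
by apply/setP => l; rewrite !inE andb_orl; case: eqVneq => //= ->; rewrite jk.
Qed.

Let sgD i J : sg i (J :\ i) = sg i J.
Proof.
congr (_ ^+ #|pred_of_set _|); apply/setP => l; rewrite !inE.
by case: eqVneq => //= ->; rewrite ltnn andbF.
Qed.

Let sg2 i J : sg i J * sg i J = 1.
Proof. by rewrite -expr2 sqrr_sign. Qed.

Lemma koszul_coef0 n (c : koszul ys n) J : #|J| != n -> coef c J = 0.
Proof. by move=> Jn; rewrite /koszul_coef insubF //; exact: negPf. Qed.

Lemma koszul_coefE n (c : koszul ys n) (J : {J : {set I} | #|J| == n}) :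
  coef c (val J) = c J.
Proof. by rewrite /koszul_coef valK. Qed.

Lemma koszul_ext n (c d : koszul ys n) :
  (forall J, #|J| = n -> coef c J = coef d J) -> c = d.
Proof.
move=> cd; apply/ffunP => J; rewrite -!koszul_coefE cd //.
exact/eqP/(valP J).
Qed.

Lemma koszul_coefD n (c d : koszul ys n) J : coef (c + d) J = coef c J + coef d J.
Proof.
rewrite /koszul_coef; case: insubP => [J' _ _|_]; last by rewrite addr0.
by rewrite ffunE.
Qed.

Lemma koszul_coefZ n r (c : koszul ys n) J : coef (r *: c) J = r * coef c J.
Proof.
rewrite /koszul_coef; case: insubP => [J' _ _|_]; last by rewrite mulr0.
by rewrite ffunE.
Qed.

Lemma koszul_coef_diff n (c : koszul ys n.+1) J : coef (koszul_diff c) J =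
  \sum_(j | j \notin J) sg j J * ys`_j * coef c (j |: J).
Proof.
rewrite {1}/koszul_coef; case: insubP => [J' _ <-|Jn]; first by rewrite ffunE.
rewrite big1 // => j jJ; rewrite koszul_coef0 ?mulr0 //.
by rewrite cardsU1 jJ.
Qed.

(** The coefficient at J is a sum over ordered pairs of distinct j, k outside J; by [sgU],
    exchanging j and k changes exactly one of the two signs. *)
Lemma koszul_diff2 n (c : koszul ys n.+2) : koszul_diff (koszul_diff c) = 0.
Proof.
apply: koszul_ext => J _; rewrite [RHS](_ : _ = 0); last first.
  by rewrite /koszul_coef; case: insubP => // J' _ _; rewrite ffunE.
rewrite koszul_coef_diff big_mkcond /=.
pose F j k := if (j \notin J) && (k \notin j |: J) then
  sg j J * ys`_j * (sg k (j |: J) * ys`_k * coef c (k |: (j |: J))) else 0.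
rewrite (eq_bigr (fun j => \sum_k F j k)) => [|j _]; last first.
  case: ifP => jJ; last by rewrite big1 // => k _; rewrite /F jJ.
  rewrite koszul_coef_diff mulr_sumr big_mkcond; apply: eq_bigr => k _.
  by rewrite /F jJ.
apply: sum_antisym => [j|j k jk]; rewrite /F; first by rewrite !inE eqxx andbF.
have jk' : j != k by rewrite -val_eqE ltn_eqF.
rewrite !inE !negb_or eq_sym jk' /= andbC; case: ifP => [/andP[kJ jJ]|_]; last first.
  by rewrite oppr0.
rewrite !sgU // jk ltnNge (ltnW jk) /= finset.setUCA.
by rewrite !mulNr mulrN; congr (- _); rewrite mulrCA.
Qed.

(** Exterior multiplication by e_i on the left, the homotopy for multiplication by y_i. *)
Definition koszul_wedge i n (c : koszul ys n) : koszul ys n.+1 :=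
  [ffun J : {J : {set I} | #|J| == n.+1} =>
     if i \in val J then sg i (val J) * coef c (val J :\ i) else 0].

Lemma koszul_wedge_linear i n : linear (@koszul_wedge i n).
Proof.
move=> r c d; apply/ffunP => J; rewrite !ffunE; case: ifP => _; last first.
  by rewrite scaler0 addr0.
by rewrite koszul_coefD koszul_coefZ mulrDr; congr (_ + _); exact: mulrCA.
Qed.

Lemma koszul_coef_wedge i n (c : koszul ys n) J :
  coef (koszul_wedge i c) J = if i \in J then sg i J * coef c (J :\ i) else 0.
Proof.
rewrite {1}/koszul_coef; case: insubP => [J' _ <-|Jn]; first by rewrite ffunE.
case: ifP => // iJ; rewrite koszul_coef0 ?mulr0 //.
by move: Jn; rewrite (cardsD1 i) iJ.
Qed.

Lemma koszul_diff_wedge i n (c : koszul ys n) J : i \notin J ->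
  coef (koszul_diff (koszul_wedge i c)) J = ys`_i * coef c J.
Proof.
move=> iJ; rewrite koszul_coef_diff (bigD1 i) //= big1 => [|j /andP[jJ ji]].
  rewrite koszul_coef_wedge finset.setU11 finset.setU1K // -[sg i (i |: J)]sgD finset.setU1K //.
  by rewrite addr0 mulrACA mulrA -mulrA [sg i J * _]mulrC -!mulrA mulrA sg2 mul1r.
by rewrite koszul_coef_wedge !inE eq_sym (negPf ji) (negPf iJ) mulr0.
Qed.

(** At J without i the second term vanishes. At J containing i, its summand j = i gives y_i c_J, and
    the other summands cancel the first term because e_i and e_j anticommute. *)
Lemma koszul_homotopy i n (c : koszul ys n.+1) :
  koszul_diff (koszul_wedge i c) + koszul_wedge i (koszul_diff c) = ys`_i *: c.
Proof.
apply: koszul_ext => J _; rewrite koszul_coefD koszul_coefZ.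
have [iJ|iJ] := boolP (i \in J); last first.
  by rewrite koszul_diff_wedge // koszul_coef_wedge (negPf iJ) addr0.
rewrite koszul_coef_wedge iJ !koszul_coef_diff [X in _ + _ * X](bigD1 i) ?inE ?eqxx //=.
rewrite finset.setD1K // sgD mulrDr addrCA [X in X + _]mulrA [X in X * _ + _]mulrA sg2 mul1r.
rewrite mulr_sumr [X in _ + (_ + X)](eq_bigl (fun j => j \notin J)) => [|j]; last first.
  by rewrite !inE; case: eqVneq => [->|_]; rewrite ?iJ ?andbT.
rewrite -big_split big1 ?addr0 // => j jJ /=.
have ij : i != j by apply: contraNneq jJ => <-.
rewrite koszul_coef_wedge !inE iJ orbT sgU //.
rewrite -{1}(finset.setD1K iJ) sgU ?inE ?eqxx //.
rewrite (_ : (j |: J) :\ i = j |: (J :\ i)); last first.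
  by apply/setP => l; rewrite !inE; case: (eqVneq l i) => // ->; rewrite (negPf ij).
set u := sg j _; set v := sg i J; set w := coef _ _; set y := ys`_j.
have uv : u * y * (v * w) = v * (u * y * w) by rewrite mulrCA mulrA.
by case: (ltngtP i j) (ij) => [||/val_inj ->]; rewrite ?eqxx // => _ _;
   rewrite ?mulNr ?mulrN uv ?addNr.
Qed.

Variables (S : lmodType R -> Prop) (S_serre : serre_class S).

(** Evaluation at the basis embeds Hom(K_n, L) into a finite power of L. *)
Lemma koszul_serre L : S L ->
  forall n, S (Hom_cohomology (fun m => @koszul_diff R ys m) L n).
Proof.
move=> /(sq_module S_serre) SL n; apply/sq_Hom_cohomology => //.
pose e (J : {J : {set I} | #|J| == n}) : {linear homMod (koszul ys n) L -> L} :=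
  hom_eval L (ffun_basis R J : koszul ys n).
apply: (sq_jointly_inj S_serre (s := enum {: {J : {set I} | #|J| == n}})
  (e := e) _ _ _ _ _ _ SL) => //.
- exact: cocycle_linear.
- exact: cobound_linear.
- exact: linear_pred0.
move=> phi _ phi0; rewrite (_ : phi = 0); first exact: (cobound_linear _ _).1.
apply: hom_ext => c; rewrite [LHS]hom_ffun_basis big1 // => J _.
by have /= -> := phi0 J (mem_enum _ _); rewrite scaler0.
Qed.

Variables (a : ideal R) (ysa : generates ys a).

(** Multiplication by a generator of a is null-homotopic, and the x that send [phi] to a coboundary
    form an ideal. *)
Lemma koszul_annihilated x : x \in a ->
  forall M n (phi : homMod (koszul ys n) M),
  hom_cocycle (fun m => @koszul_diff R ys m) phi ->
  hom_cobound (fun m => @koszul_diff R ys m) (x *: phi).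
Proof.
rewrite ysa => xy M n phi dphi.
have bL := cobound_linear (hom_diff (fun m => @koszul_diff R ys m) M) n.
apply: (genmod_sub (V := R^o) (A := fun x => hom_cobound _ (x *: phi)) _ _ xy).
  split=> [|r u v bu bv]; first by rewrite scale0r; exact: bL.1.
  by rewrite scalerDl -scalerA; exact: bL.2.
move=> y /(nthP 0)[j jys <-]; pose k := Ordinal jys.
case: n phi dphi {bL} => [|n] phi dphi.
  (* In degree 0 the only coboundary is 0: here y_j c is itself the boundary of e_k /\ c, so [phi]
     kills it. *)
  have {}dphi c : val phi (koszul_diff c) = 0.
    exact: (congr1 (fun h : homMod (koszul ys 1) M => val h c) dphi).
  apply: hom_ext => c; transitivity (val phi (ys`_j *: c)); first exact/esym/homZ.
  rewrite -[RHS](dphi (koszul_wedge k c)); congr (val phi _).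
  apply: koszul_ext => J /cards0_eq ->.
  by rewrite koszul_diff_wedge ?inE // koszul_coefZ.
have {}dphi c : val phi (koszul_diff c) = 0.
  exact: (congr1 (fun h : homMod (koszul ys n.+2) M => val h c) dphi).
exists (homMod_comp (lin_pack (@koszul_wedge_linear k n)) phi).
apply: hom_ext => c; transitivity (val phi (ys`_j *: c)); last exact: homZ.
rewrite -(koszul_homotopy k) -[RHS]/(hom_fun phi (_ + _)) linearD /= dphi.
by rewrite add0r.
Qed.

(** An m killed by a is the value, at the basis element of K_0, of the cocycle that multiplies m by
    the single coefficient. *)
Lemma koszul_cohomology0 M :
  S (Hom_cohomology (fun n => @koszul_diff R ys n) M 0) ->
  sq_in S (fun m : M => forall r : R, r \in a -> r *: m = 0) (fun m => m = 0).
Proof.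
have J0P : #|finset.set0 : {set I}| == 0%N by rewrite cards0.
pose J0 : {J : {set I} | #|J| == 0%N} := Sub finset.set0 J0P.
move=> /(sq_Hom_cohomology S_serre) SM.
pose e : {linear homMod (koszul ys 0) M -> M} := hom_eval M (ffun_basis R J0 : koszul ys 0).
apply: (sq_transfer _ (linear_rel_fun e) _ _ SM).
- exact: cocycle_linear.
- move=> m am; exists (mkhom (lin_pack (ffun_hom_linear (fun=> m)))); last first.
    exact: ffun_hom_basis.
  apply: hom_ext => c; rewrite /= /ffun_hom big1 // => J _.
  rewrite ffunE scaler_suml big1 // => j _.
  rewrite mulrAC -scalerA am ?scaler0 // ysa.
  exact/(mem_genmod (V := R^o))/mem_nth.
- by move=> phi _ _ _ <- ->.
Qed.

End Koszul.

(** * Ext through injective resolutions *)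

Section FreeProjective.
Variable R : comPzRingType.
Implicit Types M N : lmodType R.
Variable X : choiceType.

Definition free_hom M (m : X -> M) (c : freemod R X) : M :=
  \sum_(x \in [set: X]) (val c x : R) *: m x.

Lemma free_hom_finite M (m : X -> M) (c : freemod R X) (D : set X) :
  finite_set D -> (forall x, val c x != 0 -> D x) ->
  free_hom m c = \sum_(x <- fset_set D) (val c x : R) *: m x.
Proof.
move=> Dfin cD; rewrite -fsbig_finite // /free_hom; apply/esym/fsbig_widen => //.
move=> x [_ /= xD]; apply: contra_notP xD => h; apply: cD => /=.
by apply/eqP; apply: contra_not h => ->; rewrite scale0r.
Qed.

Lemma freemod_supp (c : freemod R X) : finite_set [set x | val c x != 0]%classic.
Proof. exact/asboolP/(valP c). Qed.

Lemma free_hom_linear M (m : X -> M) : linear (free_hom m).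
Proof.
move=> r c d.
pose D : set X := ([set x | val c x != 0] `|` [set x | val d x != 0])%classic.
have Dfin : finite_set D by rewrite finite_setU; split; exact: freemod_supp.
have valE x : val (r *: c + d) x = r *: val c x + val d x by [].
rewrite !(free_hom_finite m Dfin) => [|x dx|x cx|x]; [|by right|by left|].
  rewrite scaler_sumr -big_split; apply: eq_bigr => x _ /=.
  by rewrite [X in X *: _ = _]valE scalerDl scalerA.
have [c0|] := eqVneq (val c x) 0; last by left.
by rewrite valE c0 scaler0 add0r; right.
Qed.

Definition freemod_indic (x : X) : prodmod (fun _ : X => R^o) :=
  fun y => if y == x then 1 else 0.

Lemma freemod_indic_finite (x : X) : freemod_indic x \in finite_supp (N := fun _ : X => R^o).
Proof.
apply/asboolP; apply: sub_finite_set (finite_set1 x) => y /=.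
by rewrite /freemod_indic; case: (eqVneq y x) => // _; rewrite eqxx.
Qed.

Definition freemod_basis (x : X) : freemod R X :=
  Sub (freemod_indic x) (freemod_indic_finite x).

Lemma free_hom_basis M (m : X -> M) x : free_hom m (freemod_basis x) = m x.
Proof.
rewrite (free_hom_finite m (finite_set1 x)) => [|y].
  by rewrite fset_set1 big_seq_fset1 /= /freemod_indic eqxx scale1r.
by rewrite /= /freemod_indic; case: (eqVneq y x) => // _; rewrite eqxx.
Qed.

Lemma freemod_basisE (c : freemod R X) :
  c = \sum_(x <- fset_set [set x | val c x != 0]%classic) (val c x : R) *: freemod_basis x.
Proof.
pose ev y : {linear freemod R X -> R^o} := lin_pack (f := fun c : freemod R X => val c y)
  (fun _ _ _ => erefl).
apply: val_inj; apply/funext => y; rewrite -[RHS]/(ev y _) linear_sum.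
rewrite (eq_bigr (fun x => (val c x : R) * freemod_indic x y)) //.
have [c0|cy] := eqVneq (val c y) 0.
  rewrite c0 big_seq big1 // => x; rewrite in_fset_set; last exact: freemod_supp.
  rewrite inE /= => cx; rewrite /freemod_indic.
  by have [yx|_] := eqVneq y x; [rewrite -yx c0 eqxx in cx|rewrite mulr0].
rewrite (big_fsetD1 y) /=; last first.
  by rewrite in_fset_set ?inE //; exact: freemod_supp.
rewrite big_seq [X in _ + X]big1 => [|x].
  by rewrite addr0 /freemod_indic eqxx mulr1.
by rewrite in_fsetD1 /freemod_indic eq_sym => /andP[/negPf -> _]; rewrite mulr0.
Qed.

Lemma freemod_projective : projective_module (freemod R X).
Proof.
move=> M N s s_surj phi.
have [m mP] := choice (fun x => s_surj (val phi (freemod_basis x))).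
exists (mkhom (lin_pack (free_hom_linear m))); apply: hom_ext => c.
pose sm := hom_fun (hom_post s (mkhom (lin_pack (free_hom_linear m)))).
rewrite -[LHS]/(sm c) -[RHS]/(hom_fun phi c) [c]freemod_basisE !linear_sum.
apply: eq_bigr => x _; rewrite !linearZ_LR; congr (_ *: _).
rewrite -[RHS]mP -(free_hom_basis m x) //.
Qed.

End FreeProjective.

(** * Isomorphic subquotients and connecting isomorphisms *)

Section QuotIso.
Variable R : comPzRingType.
Implicit Types U V W : lmodType R.

(* A / B and C / D are isomorphic, through the linear relation rho. *)
Definition quot_iso U V (A B : U -> Prop) (C D : V -> Prop) : Prop :=
  exists rho : U -> V -> Prop, [/\ linear_rel rho,
    forall u, A u -> exists2 v, C v & rho u v,
    forall v, C v -> exists2 u, A u & rho u v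
    & forall u v, A u -> C v -> rho u v -> (B u <-> D v)].

Lemma quot_iso_refl U (A B : U -> Prop) : quot_iso A B A B.
Proof.
exists eq; split=> [|u Au|u Au|u _ _ _ <-//]; [exact: linear_rel_eq| |]; by exists u.
Qed.

Lemma quot_iso_sym U V (A B : U -> Prop) (C D : V -> Prop) :
  quot_iso A B C D -> quot_iso C D A B.
Proof.
move=> [rho [[rho0 rhoL] rhoA rhoC rhoB]]; exists (fun v u => rho u v); split=> //.
  by split=> // r u v u' v'; exact: rhoL.
by move=> v u Cv Au uv; exact: (iff_sym (rhoB _ _ Au Cv uv)).
Qed.

Lemma quot_iso_trans U V W (A B : U -> Prop) (C D : V -> Prop) (E F : W -> Prop) :
  linear_pred C -> quot_iso A B C D -> quot_iso C D E F -> quot_iso A B E F.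
Proof.
move=> CL [rho [rhoL rhoA rhoC rhoB]] [sg [sgL sgC sgE sgD]].
exists (fun u w => exists v, [/\ C v, rho u v & sg v w]); split.
- split=> [|r u w u' w' [v [Cv uv vw]] [v' [Cv' uv' vw']]].
    by exists 0; split; [exact: CL.1|exact: rhoL.1|exact: sgL.1].
  by exists (r *: v + v'); split; [exact: CL.2|exact: rhoL.2|exact: sgL.2].
- by move=> u /rhoA[v Cv uv]; have [w Ew vw] := sgC v Cv; exists w => //; exists v.
- by move=> w /sgE[v Cv vw]; have [u Au uv] := rhoC v Cv; exists u => //; exists v.
- move=> u w Au Ew [v [Cv uv vw]]; exact: iff_trans (rhoB _ _ Au Cv uv) (sgD _ _ Cv Ew vw).
Qed.

Lemma quot_iso_sq (S : lmodType R -> Prop) U V (A B : U -> Prop) (C D : V -> Prop) :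
  linear_pred A -> linear_pred C -> quot_iso A B C D -> sq_in S A B <-> sq_in S C D.
Proof.
move=> AL CL [rho [rhoL rhoA rhoC rhoB]]; split=> h.
  by apply: (sq_transfer AL rhoL rhoC _ h) => u v Au Cv /(rhoB _ _ Au Cv) [].
apply: (sq_transfer CL (rho := fun v u => rho u v) _ rhoA _ h).
  by case: rhoL => ? rL; split=> // r u v u' v'; exact: rL.
by move=> v u Cv Au /(rhoB _ _ Au Cv) [].
Qed.

Lemma quot_iso_annihilated U V (A B : U -> Prop) (C D : V -> Prop) r :
  linear_pred A -> linear_pred C -> quot_iso A B C D ->
  (forall u, A u -> B (r *: u)) -> forall v, C v -> D (r *: v).
Proof.
move=> AL CL [rho [rhoL rhoA rhoC rhoB]] Br v Cv.
have [u Au uv] := rhoC v Cv; apply/(rhoB (r *: u)).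
- exact: linear_predZ.
- exact: linear_predZ.
- by have := rhoL.2 r _ _ _ _ uv rhoL.1; rewrite !addr0.
- exact: Br.
Qed.

Section Connecting.
Variables (K' K K'' : nat -> lmodType R).
Variables (d' : forall n, {linear K' n -> K' n.+1}).
Variables (d : forall n, {linear K n -> K n.+1}).
Variables (d'' : forall n, {linear K'' n -> K'' n.+1}).
Variables (f : forall n, {linear K' n -> K n}) (g : forall n, {linear K n -> K'' n}).
Hypothesis dd : forall i v, d i.+1 (d i v) = 0.
Hypothesis fd : forall i v, f i.+1 (d' i v) = d i (f i v).
Hypothesis gd : forall i v, g i.+1 (d i v) = d'' i (g i v).
Hypothesis fg : forall i, short_exact (f i) (g i).

(** The connecting relation is z = g k, d k = f u. As K is assumed acyclic in degree i + 1 only, the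
    denominator is the image of the cocycles of K; this form covers i = 0. *)
Lemma connecting_iso i :
  (forall v : K i.+1, cocycle d v -> cobound d v) ->
  quot_iso (cocycle d'' (i := i)) (fun z => exists2 k, cocycle d k & g i k = z)
    (cocycle d' (i := i.+1)) (cobound d' (i := i.+1)).
Proof.
move=> acyc; have f_inj j u : f j u = 0 -> u = 0.
  by case: (fg j) => inj _ _; rewrite -{1}(linear0 (f j)) => /inj.
have g_ker j v : g j v = 0 -> exists u, f j u = v by case: (fg j) => _ ex _ /ex.
have gf j u : g j (f j u) = 0 by case: (fg j) => _ ex _; apply/ex; exists u.
exists (fun z u => exists2 k, g i k = z & d i k = f i.+1 u); split.
- split=> [|r c u c' u' [w wc wu] [w' wc' wu']].
    by exists 0; rewrite !linear0.
  by exists (r *: w + w'); rewrite !linearP ?wc ?wu ?wc' ?wu'.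
- move=> z dz; have [k kz] : exists k, g i k = z by case: (fg i).
  have [u uk] : exists u, f i.+1 u = d i k by apply: g_ker; rewrite gd kz.
  exists u; last by exists k.
  by apply: f_inj; rewrite fd uk dd.
- move=> u du; have [k ku] : cobound d (f i.+1 u).
    by apply: acyc; rewrite /cocycle -fd du linear0.
  by exists (g i k); [rewrite /cocycle -gd ku gf|exists k].
- move=> z u dz du [k kz ku]; split=> [[k' dk' k'z]|[t tu]].
    have [t tE] : exists t, f i t = k - k' by apply: g_ker; rewrite linearB kz k'z subrr.
    exists t; apply/eqP; rewrite -subr_eq0; apply/eqP/f_inj.
    by rewrite linearB fd tE linearB ku dk' subr0 subrr.
  exists (k - f i t); last by rewrite linearB gf subr0.
  by rewrite /cocycle linearB -fd tu ku subrr.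
Qed.

Lemma connecting_iso_acyclic i :
  (forall v : K i.+1, cocycle d v -> cobound d v) ->
  (forall v : K i.+2, cocycle d v -> cobound d v) ->
  quot_iso (cocycle d'' (i := i.+1)) (cobound d'' (i := i.+1))
    (cocycle d' (i := i.+2)) (cobound d' (i := i.+2)).
Proof.
move=> acyc1 /connecting_iso[rho [rhoL rhoA rhoC rhoB]]; exists rho; split=> //.
move=> u v du dv uv; apply: iff_trans (rhoB _ _ du dv uv); split=> [[w <-]|[k /acyc1[t <-] <-]].
  have [t <-] : exists t, g i t = w by case: (fg i).
  by exists (d i t); [exact: dd|exact: gd].
by exists (g i t); rewrite gd.
Qed.

End Connecting.
End QuotIso.

Section InjectiveHom.
Variables (R : comPzRingType) (E : lmodType R).
Hypothesis E_inj : injective_module E.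
Implicit Types U V W : lmodType R.

(** [phi] descends to the image of f, and injectivity of E extends it from there to V. *)
Lemma injective_extend U V (f : {linear U -> V}) (phi : homMod U E) :
  (forall u, f u = 0 -> val phi u = 0) ->
  exists psi : homMod V E, forall u, val psi (f u) = val phi u.
Proof.
move=> fphi.
have [|b|y [u u0 ->]|g gP] := @linear_rel_total R (submod (imm f)) E
  (fun b y => exists2 u, val b = f u & y = hom_fun phi u).
- have [r0 rL] := linear_rel_span f (hom_fun phi).
  by split=> // r b y b' y' by_ b'y'; exact: rL.
- by have /asboolP[u ub] := valP b; exists (val phi u), u.
- by apply: fphi; rewrite -u0.
have [h hP] := E_inj g (@val_inj _ _ _ : injective (val : {linear submod (imm f) -> V})).
exists (mkhom h) => u.
have fu : f u \in imm f by apply/asboolP; exists u.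
rewrite -[LHS]/(h (val (Sub (f u) fu : submod (imm f)))) hP.
have [u' /= uu' ->] := gP (Sub (f u) fu : submod (imm f)).
apply/eqP; rewrite -subr_eq0 -[_ - _]/(hom_fun phi u' - hom_fun phi u) -linearB /=.
by apply/eqP/fphi; rewrite linearB -uu' subrr.
Qed.

Lemma injective_short_exact U V W (f : {linear U -> V}) (g : {linear V -> W}) :
  short_exact f g ->
  short_exact (homMod_comp (W := E) g) (homMod_comp (W := E) f).
Proof.
move=> [f_inj fg g_surj]; split=> [phi psi e|phi|psi].
- apply: hom_ext => w; have [v <-] := g_surj w.
  exact: (congr1 (fun h : homMod V E => val h v) e).
- split=> [phif|[psi <-]]; last first.
    apply: hom_ext => u; rewrite /= (_ : g (f u) = 0) ?hom0 //.
    by apply/fg; exists u.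
  have [v /fg[u <-]|psi psiP] := injective_extend (f := g) (phi := phi).
    exact: (congr1 (fun h : homMod U E => val h u) phif).
  by exists psi; apply: hom_ext => v; exact: psiP.
- have [u fu|phi phiP] := injective_extend (f := f) (phi := psi).
    by rewrite (_ : u = 0) ?hom0 //; apply: f_inj; rewrite fu linear0.
  by exists phi; apply: hom_ext.
Qed.

End InjectiveHom.

Lemma hom_annihilated (R : comPzRingType) (N M : lmodType R) r :
  (forall n : N, r *: n = 0) -> forall phi : homMod N M, r *: phi = 0.
Proof.
move=> rN phi; apply: hom_ext => n; transitivity (val phi (r *: n)).
  exact/esym/homZ.
by rewrite rN hom0.
Qed.

(** * Comparison of Hom(P0, C) with Hom(N, E) *)

Section Augmentation.
Variables (R : comPzRingType) (P1 P0 N C E E' : lmodType R).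
Variables (dP : {linear P1 -> P0}) (aug : {linear P0 -> N}).
Variables (j : {linear C -> E}) (d : {linear E -> E'}).
Hypothesis aug_surj : forall n, exists p, aug p = n.
Hypothesis aug_exact : forall p, aug p = 0 <-> exists b, dP b = p.
Hypothesis j_inj : injective j.
Hypothesis j_exact : forall x, d x = 0 <-> exists m, j m = x.

(** A cocycle u of Hom(P0, C) is a homomorphism N -> C preceded by [aug], and a cocycle v of Hom(N,
    E) is one followed by j; related cocycles come from the same N -> C. *)
Definition aug_rel (u : homMod P0 C) (v : homMod N E) : Prop :=
  hom_post j u = homMod_comp aug v.

Lemma aug_relP u v : aug_rel u v <-> forall p, j (val u p) = val v (aug p).
Proof.
split=> [uv p|uv]; first exact: (congr1 (fun h : homMod P0 E => val h p) uv).
by apply: hom_ext => p; exact: uv.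
Qed.

Lemma aug_rel_linear : linear_rel aug_rel.
Proof. exact: linear_rel_comp. Qed.

Lemma hom_aug0 M (v : homMod N M) b : val v (aug (dP b)) = 0.
Proof. by rewrite (_ : aug _ = 0) ?hom0 //; apply/aug_exact; exists b. Qed.

Lemma hom_cocycle0P M (u : homMod P0 M) :
  homMod_comp dP u = 0 <-> forall b, val u (dP b) = 0.
Proof.
split=> [du b|du]; first exact: (congr1 (fun h : homMod P1 M => val h b) du).
by apply: hom_ext => b; exact: du.
Qed.

Lemma aug_rel_total u : homMod_comp dP u = 0 ->
  exists2 v, hom_post d v = 0 & aug_rel u v.
Proof.
move=> /hom_cocycle0P du.
have [|n|y [p /esym/aug_exact[b <-] ->]|v vP] := @hom_rel R N E
  (fun n y => exists2 p, n = aug p & y = (j \o hom_fun u) p).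
- exact: linear_rel_span.
- by have [p pn] := aug_surj n; exists (j (val u p)), p.
- by rewrite /= du linear0.
exists v; last first.
  apply/aug_relP => p; have [p' pp' ->] := vP (aug p); congr (j _).
  have /aug_exact[b bE] : aug (p - p') = 0 by rewrite linearB pp' subrr.
  apply/eqP; rewrite -subr_eq0 -[_ - _]/(hom_fun u p - hom_fun u p') -linearB -bE.
  exact/eqP/du.
apply: hom_ext => n; apply/j_exact.
by have [p _ vn] := vP n; exists (val u p); exact: esym vn.
Qed.

Lemma aug_rel_surj v : hom_post d v = 0 ->
  exists2 u, homMod_comp dP u = 0 & aug_rel u v.
Proof.
move=> dv; have [|p|m|u uP] := @hom_rel R P0 C (fun p m => (hom_fun v \o aug) p = j m).
- exact: linear_rel_comp.
- have [|m mE] := (j_exact (val v (aug p))).1; last by exists m.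
  exact: (congr1 (fun h : homMod N E' => val h (aug p)) dv).
- by rewrite linear0 -(linear0 j) => /j_inj.
exists u; last by apply/aug_relP => p; exact/esym/uP.
apply/hom_cocycle0P => b; apply: j_inj; rewrite linear0 -uP /=.
exact: hom_aug0.
Qed.

Lemma aug_rel_eq0 u v : aug_rel u v -> u = 0 <-> v = 0.
Proof.
move=> /aug_relP uv; split=> [u0|v0]; apply: hom_ext => x.
  by have [p <-] := aug_surj x; rewrite -uv u0; exact: (linear0 j).
by apply: j_inj; rewrite uv v0; exact/esym/(linear0 j).
Qed.

(** A cocycle k : P0 -> F kills the kernel of [aug], hence comes from a map N -> F; this matches the
    two denominators. *)
Lemma aug_rel_cobound (F : lmodType R) (q : {linear F -> C}) u v : injective_module F -> aug_rel u v ->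
  (exists2 k, homMod_comp dP k = 0 & hom_post q k = u) <->
  exists k, hom_post (j \o q) k = v.
Proof.
move=> F_inj /aug_relP uv; split=> [[k /hom_cocycle0P dk ku]|[k kv]].
  have [p /aug_exact[b <-] //|k' k'P] := injective_extend F_inj (f := aug) (phi := k).
  exists k'; apply: hom_ext => n; have [p <-] := aug_surj n.
  by rewrite -uv -ku /= k'P.
exists (homMod_comp aug k); first by apply/hom_cocycle0P => b; exact: hom_aug0.
by apply: hom_ext => p; apply: j_inj; rewrite uv -kv.
Qed.

End Augmentation.

Lemma submod_fg (R : comPzRingType) (V : lmodType R) (A : submodClosed V) :
  noetherian_module V -> finitely_generated (submod A).
Proof.
move=> /(_ _ (linear_pred_submod A))[t [At tP]].
have [s sE] : exists s : seq (submod A), map val s = t.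
  elim: t At {tP} => [|x t IH] At; first by exists [::].
  have [|s <-] := IH; first by move=> v vt; apply: At; rewrite inE vt orbT.
  by exists (Sub x (At x (mem_head _ _)) :: s).
exists s => u.
have [u' su' /val_inj <- //] : exists2 u', u' \in genmod s & val u' = val u.
apply: (genmod_sub (A := fun v => exists2 u', u' \in genmod s & val u' = v) _ _ (tP _ (valP u))).
  exact: (linear_pred_im (val : {linear submod A -> V}) (linear_pred_submod (genmod s))).
by rewrite -sE => _ /mapP[x xs ->]; exists x => //; exact: mem_genmod.
Qed.

(** * Balancing of Ext and its behaviour modulo S *)

Section Ext.
Variable R : comPzRingType.
Implicit Types L M N : lmodType R.

Lemma free_res_proj N n : projective_module (free_res N n).
Proof. exact: freemod_projective. Qed.

Lemma free_res_diff2 N n c : free_res_diff N n (free_res_diff N n.+1 c) = 0.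
Proof. by apply/free_res_exactS; exists c. Qed.

Lemma free_res_acyclic N E i (phi : homMod (free_res N i.+1) E) :
  injective_module E ->
  hom_cocycle (free_res_diff N) phi -> hom_cobound (free_res_diff N) phi.
Proof.
move=> E_inj dphi.
have [|psi psiP] := injective_extend E_inj (f := free_res_diff N i) (phi := phi).
  move=> u /free_res_exactS[c <-].
  exact: (congr1 (fun h : homMod (free_res N i.+2) E => val h c) dphi).
by exists psi; apply: hom_ext.
Qed.

Lemma cosyzygy_short_exact M j :
  short_exact (@inj_emb R (cosyzygy M j))
    (quotmod_pi (imm (@inj_emb R (cosyzygy M j)))).
Proof.
split=> [|x|y]; [exact: inj_emb_inj| |exact: quotmod_pi_surj].
apply: (iff_trans (quotmod_pi_eq0 _ _)); exact: (iff_sym (rwP (asboolP _))).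
Qed.

(** Hom of the free resolution into an injective module is acyclic in positive degrees, so each
    cosyzygy lowers the degree by one. Giving l by an equation avoids transport between cosyzygies
    with equal indices. *)
Lemma Ext_shift N M i j l : l = (j + i)%N ->
  quot_iso (@hom_cocycle R _ (free_res_diff N) (cosyzygy M j) i.+1)
    (@hom_cobound R _ (free_res_diff N) (cosyzygy M j) i.+1)
    (@hom_cocycle R _ (free_res_diff N) (cosyzygy M l) 1)
    (@hom_cobound R _ (free_res_diff N) (cosyzygy M l) 1).
Proof.
elim: i j => [|i IH] j lE; first by rewrite lE addn0; exact: quot_iso_refl.
apply: quot_iso_trans (IH j.+1 _); last by rewrite lE addSnnS.
  exact: cocycle_linear.
apply: quot_iso_sym.
apply: (connecting_iso_acyclic (d := hom_diff (free_res_diff N) (inj_res M j))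
  (f := fun n => @hom_post R (free_res N n) _ _ (@inj_emb R (cosyzygy M j)))
  (g := fun n => @hom_post R (free_res N n) _ _ (quotmod_pi (imm (@inj_emb R (cosyzygy M j)))))).
- by move=> n phi; apply: hom_diff2; exact: free_res_diff2.
- by move=> n phi; exact: hom_diff_post.
- by move=> n phi; exact: hom_diff_post.
- by move=> n; apply: hom_short_exact; [exact: free_res_proj|exact: cosyzygy_short_exact].
- by move=> phi; apply: free_res_acyclic; exact: injmod_injective.
- by move=> phi; apply: free_res_acyclic; exact: injmod_injective.
Qed.

Definition Hom_inj_diff N M n :
    {linear homMod N (inj_res M n) -> homMod N (inj_res M n.+1)} :=
  @hom_post R N _ _ (inj_res_diff M n).

Lemma inj_res_diff_eq0 M i (x : inj_res M i) :
  inj_res_diff M i x = 0 <-> exists m : cosyzygy M i, inj_emb m = x.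
Proof.
apply: (iff_trans (inj_emb_pi_eq0 _ _)); exact: (iff_sym (rwP (asboolP _))).
Qed.

(** Degree i + 1 is shifted to Ext^1(N, cosyzygy M i), then identified by the connecting map with
    Hom(N, cosyzygy M i.+1) modulo the maps that lift to [inj_res M i], and [aug_rel] carries this
    to the complex Hom(N, inj_res M). *)
Lemma Ext_iso N M i :
  quot_iso (@hom_cocycle R _ (free_res_diff N) M i)
    (@hom_cobound R _ (free_res_diff N) M i)
    (cocycle (Hom_inj_diff N M) (i := i)) (cobound (Hom_inj_diff N M) (i := i)).
Proof.
have iso0 j B D :
    (forall u v, aug_rel (@free_aug R N) (@inj_emb R (cosyzygy M j)) u v -> B u <-> D v) ->
    quot_iso (@hom_cocycle R _ (free_res_diff N) (cosyzygy M j) 0) B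
      (cocycle (Hom_inj_diff N M) (i := j)) D.
  move=> BD; exists (aug_rel (@free_aug R N) (@inj_emb R (cosyzygy M j))); split.
  - exact: aug_rel_linear.
  - move=> u; apply: aug_rel_total; [exact: free_aug_surj|exact: free_res_exact0|].
    exact: inj_res_diff_eq0.
  - move=> v; apply: aug_rel_surj; [exact: free_res_exact0|exact: inj_emb_inj|].
    exact: inj_res_diff_eq0.
  - by move=> u v _ _; exact: BD.
case: i => [|i].
  apply: (iso0 0%N (fun u => u = 0) (fun v => v = 0)) => u v; apply: aug_rel_eq0.
    exact: free_aug_surj.
  exact: inj_emb_inj.
apply: quot_iso_trans (Ext_shift N M (j := 0) (add0n i)) _.
  exact: cocycle_linear.
apply: quot_iso_trans (quot_iso_sym (connecting_iso
  (d := hom_diff (free_res_diff N) (inj_res M i))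
  (f := fun n => @hom_post R (free_res N n) _ _ (@inj_emb R (cosyzygy M i)))
  (g := fun n => @hom_post R (free_res N n) _ _ (quotmod_pi (imm (@inj_emb R (cosyzygy M i)))))
  (i := 0) _ _ _ _ _)) _.
- exact: cocycle_linear.
- by move=> n phi; apply: hom_diff2; exact: free_res_diff2.
- by move=> n phi; exact: hom_diff_post.
- by move=> n phi; exact: hom_diff_post.
- by move=> n; apply: hom_short_exact; [exact: free_res_proj|exact: cosyzygy_short_exact].
- by move=> phi; apply: free_res_acyclic; exact: injmod_injective.
apply: (iso0 i.+1
  (fun u => exists2 k, homMod_comp (free_res_diff N 0) k = 0 &
     hom_post (quotmod_pi (imm (@inj_emb R (cosyzygy M i)))) k = u)
  (fun v => exists k, Hom_inj_diff N M i k = v)) => u v; apply: aug_rel_cobound.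
- exact: free_aug_surj.
- exact: free_res_exact0.
- exact: inj_emb_inj.
- exact: injmod_injective.
Qed.

Variables (S : lmodType R -> Prop) (S_serre : serre_class S).

Lemma sq_Ext N M i : S (Ext i N M) <->
  sq_in S (cocycle (Hom_inj_diff N M) (i := i)) (cobound (Hom_inj_diff N M) (i := i)).
Proof.
apply: (iff_trans (sq_Hom_cohomology S_serre (free_res_diff N) M i)).
by apply: quot_iso_sq (Ext_iso N M i); exact: cocycle_linear.
Qed.

Lemma inj_res_diff2 M n x : inj_res_diff M n.+1 (inj_res_diff M n x) = 0.
Proof. by apply/inj_res_exactS; exists x. Qed.

Lemma Hom_inj_diff2 N M n phi : Hom_inj_diff N M n.+1 (Hom_inj_diff N M n phi) = 0.
Proof. by apply: hom_ext => u; exact: inj_res_diff2. Qed.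

Lemma Hom_inj_first L N (P : lmodType R) M (f : {linear L -> N}) (g : {linear N -> P}) i :
    short_exact f g ->
    sq_in S (cocycle (Hom_inj_diff N M) (i := i)) (cobound (Hom_inj_diff N M) (i := i)) ->
    (forall j, i = j.+1 -> S (Ext j L M)) ->
  S (Ext i P M).
Proof.
move=> fg SN SL; apply/sq_Ext.
apply: (les_first S_serre (d := Hom_inj_diff N M) (d'' := Hom_inj_diff L M)
  (f := fun n => homMod_comp (W := inj_res M n) g)
  (g := fun n => homMod_comp (W := inj_res M n) f)) => //.
- exact: Hom_inj_diff2.
- by move=> n phi; exact: hom_ext.
- by move=> n phi; exact: hom_ext.
- by move=> n; exact: (injective_short_exact (@injmod_injective R (cosyzygy M n)) fg).
- by move=> j /SL /sq_Ext.
Qed.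

Hypothesis R_noeth : noetherian R.

(** In degree 0, evaluation at generators of N embeds Hom(N, L) into a finite power of L. For the
    step, take F free of finite rank onto N: Ext^(i+1)(F, L) vanishes, so Ext^(i+1)(N, L) is a
    quotient of Ext^i of the kernel, which is finitely generated. *)
Lemma Ext_serre N L i : finitely_generated N -> S L -> S (Ext i N L).
Proof.
move=> + SL; elim: i N => [|i IH] N [s sP].
  apply/sq_Ext; apply: (sq_jointly_inj S_serre (s := s)
    (e := fun n => hom_eval (inj_res L 0) n) (C := fun x => x \in imm (@inj_emb R L))
    (D := fun x => x = 0)).
  - exact: cocycle_linear.
  - exact: cobound_linear.
  - exact: linear_pred_submod.
  - exact: linear_pred0.
  - move=> n v _ dv; apply/asboolP; apply: (proj1 (@inj_res_diff_eq0 L 0 _)).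
    exact: (congr1 (fun h : homMod N _ => val h n) dv).
  - move=> v _ v0; apply: hom_ext => n.
    apply: (genmod_sub (A := fun n => val v n = 0) _ v0 (sP n)).
    exact: (linear_pred_comap (hom_fun v) (@linear_pred0 R _)).
  apply: (sq_transfer _ (linear_rel_fun (@inj_emb R L)) _ _ ((sq_module S_serre L).2 SL)) => //.
    by move=> x /asboolP[l lx]; exists l.
  by move=> l _ _ _ <- ->; exact: linear0.
pose F : lmodType R := {ffun 'I_(size s) -> R^o}.
pose g : {linear F -> N} := lin_pack (ffun_hom_linear (fun j : 'I_(size s) => s`_j)).
have fg : short_exact (val : {linear submod (kerm g) -> F}) g.
  split=> [|x|n]; first exact: val_inj.
    split=> [gx|[u <-]]; last by apply/eqP; exact: valP u.
    by have xK : x \in kerm g by [apply/eqP]; exists (Sub x xK : submod (kerm g)).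
  have /asboolP[c ->] := sP n; exists [ffun j => c j].
  by rewrite /= /ffun_hom; apply: eq_bigr => j _; rewrite ffunE.
apply: (Hom_inj_first fg).
  apply: sq_trivial => // phi dphi.
  (* The cocycle lands in the cosyzygy and then lifts to [inj_res L i], as F is projective. *)
  have [psi psiP] : exists psi : homMod F (cosyzygy L i.+1), hom_post (@inj_emb R _) psi = phi.
    have [|x|m|psi psiP] := @hom_rel R F (cosyzygy L i.+1)
      (fun x m => hom_fun phi x = inj_emb m).
    - exact: linear_rel_comp.
    - have [|m mE] := (inj_res_diff_eq0 (val phi x)).1; last by exists m.
      exact: (congr1 (fun h : homMod F _ => val h x) dphi).
    - by rewrite linear0 -(linear0 (@inj_emb R (cosyzygy L i.+1))) => /inj_emb_inj.
    by exists psi; apply: hom_ext => x; exact/esym/psiP.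
  have [chi chiP] := @ffun_projective R 'I_(size s) _ _
    (quotmod_pi (imm (@inj_emb R (cosyzygy L i)))) (@quotmod_pi_surj R _ _) psi.
  by exists chi; rewrite -psiP -chiP; exact: hom_ext.
move=> j [<-]; apply: IH.
have F_fg : finitely_generated F.
  exists [seq ffun_basis R j | j <- enum 'I_(size s)] => c.
  rewrite [c]ffun_basisE; apply: rpred_sum => k _; apply: rpredZ; apply: mem_genmod.
  by apply: map_f; rewrite mem_enum.
exact/submod_fg/fg_noetherian.
Qed.

(** r acts as zero on the complex Hom(N, inj_res M); [Ext_iso] carries this to the free resolution,
    where it holds up to coboundaries. *)
Lemma Ext_annihilated N M r i : (forall n : N, r *: n = 0) ->
  forall phi, @hom_cocycle R _ (free_res_diff N) M i phi ->
  @hom_cobound R _ (free_res_diff N) M i (r *: phi).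
Proof.
move=> rN; apply: (quot_iso_annihilated _ _ (quot_iso_sym (Ext_iso N M i))).
- exact: cocycle_linear.
- exact: cocycle_linear.
move=> phi _; rewrite (hom_annihilated rN); exact: (cobound_linear _ _).1.
Qed.

Lemma hom_cyclic (b : ideal R) M (m : M) : (forall r : R, r \in b -> r *: m = 0) ->
  exists phi : homMod (quotmod b) M, forall r : R, val phi (quotmod_pi b r) = r *: m.
Proof.
move=> bm; have mL : linear (fun r : R^o => (r : R) *: m).
  by move=> r s t; rewrite scalerDl [in RHS]scalerA.
have bm' (r s : R^o) : quotmod_pi b r = quotmod_pi b s -> (r : R) *: m = (s : R) *: m.
  by move=> /quotmod_eq/bm; rewrite scalerBl => /eqP; rewrite subr_eq0 => /eqP.
have [|y|n [r r0 ->]|phi phiP] := @hom_rel R (quotmod b) M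
  (fun y n => exists2 r, y = quotmod_pi b r & n = lin_pack mL r).
- exact: linear_rel_span.
- by have [r <-] := quotmod_pi_surj y; exists (lin_pack mL r), r.
- by apply: bm; apply/quotmod_pi_eq0.
by exists phi => r; have [s rs ->] := phiP (quotmod_pi b r); exact/esym/bm'.
Qed.

Lemma quotmod_pi_scale1 (b : ideal R) (r : R) :
  quotmod_pi b r = r *: quotmod_pi b 1.
Proof. by rewrite -linearZ_LR; congr quotmod_pi; exact/esym/mulr1. Qed.

Lemma hom_cyclic1 (b : ideal R) M (m : M) : (forall r : R, r \in b -> r *: m = 0) ->
  exists phi : homMod (quotmod b) M, val phi (quotmod_pi b 1) = m.
Proof. by move=> /hom_cyclic[phi phiP]; exists phi; rewrite phiP scale1r. Qed.

Lemma hom_cyclic_ext (b : ideal R) M (phi psi : homMod (quotmod b) M) :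
  val phi (quotmod_pi b 1) = val psi (quotmod_pi b 1) -> phi = psi.
Proof.
move=> pp; apply: hom_ext => y; have [r <-] := quotmod_pi_surj y.
by rewrite (quotmod_pi_scale1 b r) !homZ pp.
Qed.

Lemma Ext0_quotient (b : ideal R) M : S (Ext 0 (quotmod b) M) ->
  sq_in S (fun m : M => forall r : R, r \in b -> r *: m = 0) (fun m => m = 0).
Proof.
pose ev : {linear homMod (quotmod b) (inj_res M 0) -> injmod M} :=
  hom_eval (injmod M) (quotmod_pi b 1).
move=> /sq_Ext SE; apply: (sq_transfer _ (linear_rel_comp ev (@inj_emb R M)) _ _ SE).
- exact: cocycle_linear.
- move=> m bm; have [|phi phiP] := @hom_cyclic1 b (inj_res M 0) (inj_emb m).
    by move=> r /bm rm; rewrite -linearZ_LR rm; exact: linear0.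
  exists phi; last exact: phiP.
  apply: hom_cyclic_ext; apply: (proj2 (@inj_res_diff_eq0 M 0 _)).
  by exists m; exact: esym phiP.
- by move=> phi m _ _ /= e phi0; apply: inj_emb_inj; rewrite -e phi0; exact/esym/linear0.
Qed.

End Ext.

(** * Local cohomology *)

Section LocalCohomology.
Variables (R : comPzRingType) (S : lmodType R -> Prop).
Hypotheses (R_noeth : noetherian R) (S_serre : serre_class S).
Variable a : ideal R.
Implicit Types M N : lmodType R.

Lemma ideal_pow_expr n x : x \in a -> x ^+ n \in ideal_pow a n.
Proof.
move=> xa; elim: n => [|n IH]; first by [].
apply/asboolP; exists [:: (x, x ^+ n)]; rewrite big_seq1 exprS; split=> // p.
by rewrite inE => /eqP ->.
Qed.

Lemma ideal_pow_sub n r : r \in ideal_pow a n.+1 -> r \in a.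
Proof.
move=> /asboolP[s [sP ->]]; rewrite big_seq; apply: rpred_sum => p /sP[pa _].
by rewrite -[_ *: _]/(p.1 * p.2) mulrC; exact: (@rpredZ _ _ a p.2 p.1).
Qed.

Lemma quotmod_annihilated (b : ideal R) (r : R) : r \in b -> forall n : quotmod b, r *: n = 0.
Proof.
move=> rb n; have [s <-] := quotmod_pi_surj n; rewrite -linearZ_LR.
by apply/quotmod_pi_eq0; rewrite -[_ *: _]/(r * s) mulrC; exact: (@rpredZ _ _ b s r).
Qed.

Lemma cyclic_fg (b : ideal R) : finitely_generated (quotmod b).
Proof.
apply: quotmod_fg; exists [:: 1] => r; apply/asboolP.
by exists (fun=> r); rewrite big_ord1; exact/esym/mulr1.
Qed.

(** [weak_Mseq_vanish] with n = 0. It serves for R/a^k and for the kernel of R/a^(k+1) -> R/a, on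
    which elements of a act nilpotently. *)
Lemma weak_Mseq_Ext M N xs : finitely_generated N ->
    (forall x, x \in a -> exists k, forall n : N, x ^+ k *: n = 0) ->
    seq_in a xs -> weak_Mseq S M xs ->
  forall i, (i < size xs)%N -> S (Ext i N M).
Proof.
move=> N_fg aN axs w; rewrite -[size xs]addn0.
apply/(@weak_Mseq_vanish R S S_serre _ (free_res_diff N) _ _ _ a _ M xs 0) => //.
- exact: free_res_proj.
- exact: free_res_diff2.
- by move=> L SL i; exact: Ext_serre.
move=> x /aN[k xk]; exists k => P i phi; exact: Ext_annihilated.
Qed.

Lemma Ext_vanish_weak_Mseq M n : finitely_generated M ->
  (forall i, (i < n)%N -> S (Ext i (quotmod a) M)) <->
  exists xs, [/\ size xs = n, seq_in a xs & weak_Mseq S M xs].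
Proof.
apply: (@vanish_below_weak_Mseq R S S_serre _ (free_res_diff (quotmod a)) _ _ _ a) => //.
- exact: free_res_proj.
- exact: free_res_diff2.
- by move=> L SL i; apply: Ext_serre => //; exact: cyclic_fg.
- move=> x xa; exists 1%N => P i phi; rewrite expr1; apply: Ext_annihilated.
  exact: quotmod_annihilated.
- by move=> P; exact: Ext0_quotient.
Qed.

Lemma Ext_weak_Mseq_extend M xs : finitely_generated M -> seq_in a xs ->
    weak_Mseq S M xs -> (forall i, (i < (size xs).+1)%N -> S (Ext i (quotmod a) M)) ->
  exists x, [/\ x \in a, seq_in a (rcons xs x) & weak_Mseq S M (rcons xs x)].
Proof.
move=> M_fg axs w v.
apply: (@weak_Mseq_extend R S S_serre _ (free_res_diff (quotmod a)) _ _ _ a _ R_noeth) => //.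
- exact: free_res_proj.
- exact: free_res_diff2.
- by move=> L SL i; apply: Ext_serre => //; exact: cyclic_fg.
- move=> x xa; exists 1%N => P i phi; rewrite expr1; apply: Ext_annihilated.
  exact: quotmod_annihilated.
- by move=> P; exact: Ext0_quotient.
Qed.

Lemma koszul_vanish_weak_Mseq M ys n : finitely_generated M -> generates ys a ->
  (forall i, (i < n)%N -> S (koszul_cohomology ys i M)) <->
  exists xs, [/\ size xs = n, seq_in a xs & weak_Mseq S M xs].
Proof.
move=> M_fg ysa; apply: (@vanish_below_weak_Mseq R S S_serre _ (fun n => @koszul_diff R ys n) _ _ _ a) => //.
- by move=> k; exact: ffun_projective.
- by move=> k c; exact: koszul_diff2.
- by move=> L SL i; exact: koszul_serre.
- by move=> x xa; exists 1%N => P i phi; rewrite expr1; exact: koszul_annihilated xa _ _ _.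
- by move=> P; exact: koszul_cohomology0.
Qed.

Hypothesis S_sum : closed_under_direct_sums S.

Definition Gamma_diff M n : {linear Gamma a (inj_res M n) -> Gamma a (inj_res M n.+1)} :=
  @Gamma_map R a _ _ (inj_res_diff M n).

Lemma sq_local_cohomology M i : S (local_cohomology i a M) <->
  sq_in S (cocycle (Gamma_diff M) (i := i)) (cobound (Gamma_diff M) (i := i)).
Proof. exact: sq_cohomology. Qed.

(** A cocycle killed by a^k is the value at 1 of a cocycle R/a^k -> [inj_res M i], so it belongs to
    a subquotient of Ext^i(R/a^k, M); [sq_union] assembles these. *)
Lemma local_cohomology_serre M i :
  (forall k, S (Ext i (quotmod (ideal_pow a k)) M)) -> S (local_cohomology i a M).
Proof.
move=> SExt; apply/sq_local_cohomology.
have annL k : linear_pred (fun z : Gamma a (inj_res M i) =>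
    forall r : R, r \in ideal_pow a k -> r *: val z = 0).
  exact: (linear_pred_comap (val : {linear Gamma a (inj_res M i) -> inj_res M i})
    (linear_pred_colon (fun r => r \in ideal_pow a k) (@linear_pred0 R _))).
apply: (sq_union S_serre (An := fun k z => cocycle (Gamma_diff M) z /\
  forall r : R, r \in ideal_pow a k -> r *: val z = 0)) => //.
- exact: cobound_linear.
- by move=> k; apply: linear_predI => //; exact: cocycle_linear.
- by move=> z dz; have /asboolP[k zk] := valP z; exists k.
move=> k; have /(sq_Ext S_serre) := SExt k; pose e := quotmod_pi (ideal_pow a k) 1.
apply: (sq_transfer (cocycle_linear _ _) (linear_rel_comp (hom_eval (inj_res M i) e)
  (val : {linear Gamma a (inj_res M i) -> inj_res M i}))).
  move=> z [dz zk]; have [phi phiP] := hom_cyclic1 zk; exists phi; last exact: phiP.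
  apply: hom_cyclic_ext; apply: (etrans (congr1 (inj_res_diff M i) phiP)).
  exact: (congr1 val dz).
move=> phi z dphi [dz zk] phiz; case: i M annL SExt phi z dphi dz zk phiz => [|i] M _ _ phi z.
  by move=> _ _ _ phiz phi0; apply: val_inj; rewrite -phiz phi0.
move=> _ _ _ phiz [psi psiP].
(* [psi] is defined on R/a^k, so its value at 1 is torsion and bounds inside the torsion complex. *)
have psi_tors : val psi e \in torsion a (M := inj_res M i).
  apply/asboolP; exists k => r rk; rewrite -homZ.
  by rewrite (quotmod_annihilated rk) hom0.
exists (Sub (val psi e) psi_tors); apply: val_inj; rewrite -phiz -psiP.
by [].
Qed.

(** The exponent is k + 1 because a^0 = R need not lie in a. *)
Lemma pow_quotient_subproof k :
  {p : homMod (quotmod (ideal_pow a k.+1)) (quotmod a) |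
    val p (quotmod_pi (ideal_pow a k.+1) 1) = quotmod_pi a 1}.
Proof.
apply/cid/hom_cyclic1 => r /ideal_pow_sub ra.
exact: (quotmod_annihilated ra (quotmod_pi a 1)).
Qed.

Definition pow_quotient k : {linear quotmod (ideal_pow a k.+1) -> quotmod a} :=
  hom_fun (sval (pow_quotient_subproof k)).

Lemma pow_quotientE k (r : R) :
  pow_quotient k (quotmod_pi (ideal_pow a k.+1) r) = quotmod_pi a r.
Proof.
rewrite (quotmod_pi_scale1 _ r) linearZ_LR (quotmod_pi_scale1 a r).
congr (r *: _); exact: (svalP (pow_quotient_subproof k)).
Qed.

Lemma pow_quotient_short_exact k : short_exact
  (val : {linear submod (kerm (pow_quotient k)) -> _}) (pow_quotient k).
Proof.
split=> [|x|y]; first exact: val_inj.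
  split=> [px|[u <-]]; last by apply/eqP; exact: valP u.
  have xK : x \in kerm (pow_quotient k) by apply/eqP.
  by exists (Sub x xK : submod (kerm (pow_quotient k))).
have [r <-] := quotmod_pi_surj y; exists (quotmod_pi (ideal_pow a k.+1) r).
exact: pow_quotientE.
Qed.

(** In positive degree z = d w with w killed by some a^k, so w is the value at 1 of a map on
    R/a^(k+1), whose coboundary is the pullback of [phi]. *)
Lemma cobound_pow M i (phi : homMod (quotmod a) (inj_res M i)) z :
    cobound (Gamma_diff M) (i := i) z -> val z = val phi (quotmod_pi a 1) ->
  exists k, cobound (Hom_inj_diff (quotmod (ideal_pow a k.+1)) M)
    (homMod_comp (pow_quotient k) phi : homMod _ (inj_res M i)).
Proof.
case: i phi z => [|i] phi z.
  move=> /= z0 zphi; exists 0%N; apply: hom_cyclic_ext.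
  apply: (etrans (congr1 (val phi) (pow_quotientE 0 1))); apply: (etrans (esym zphi)).
  by rewrite z0; exact: (linear0 (val : {linear Gamma a (inj_res M 0) -> _})).
case=> w <- zphi; have /asboolP[k wk] := valP w; exists k.
have [|psi psiP] := @hom_cyclic1 R (ideal_pow a k.+1) (inj_res M i) (val w).
  by move=> r rk; apply: wk; exact: ideal_powW rk.
exists psi; apply: hom_cyclic_ext.
apply: (etrans (congr1 (inj_res_diff M i) psiP)); apply: (etrans zphi).
exact: (congr1 (val phi) (esym (pow_quotientE k 1))).
Qed.

Lemma Ext_of_local_cohomology M i :
    (forall N, finitely_generated N ->
      (forall x, x \in a -> exists k, forall n : N, x ^+ k *: n = 0) ->
      forall j, (j < i)%N -> S (Ext j N M)) ->
  S (local_cohomology i a M) -> S (Ext i (quotmod a) M).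
Proof.
move=> SExt /sq_local_cohomology SH; apply/(sq_Ext S_serre).
pose one := quotmod_pi a 1.
pose ev : {linear homMod (quotmod a) (inj_res M i) -> inj_res M i} := hom_eval _ one.
pose iota : {linear Gamma a (inj_res M i) -> inj_res M i} := val.
(* [Q] cuts out the kernel of Ext^i(R/a, M) -> H^i_a(M), which is evaluation at 1. *)
pose Q phi := exists2 z, cobound (Gamma_diff M) z & iota z = ev phi.
have QL : linear_pred Q.
  exact: linear_pred_rel (cobound_linear _ _) (linear_rel_comp iota ev).
apply: (sq_ext S_serre (A' := Q)); [exact: cocycle_linear|by []|exact: cobound_linear| |].
  pose f k n : {linear homMod (quotmod a) (inj_res M n) -> _} :=
    homMod_comp (W := inj_res M n) (pow_quotient k).
  have bL k : linear_pred (fun phi => cobound (Hom_inj_diff (quotmod (ideal_pow a k.+1)) M) (f k i phi)).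
    exact: (linear_pred_comap (f k i) (cobound_linear _ _)).
  apply: (sq_union S_serre (An := fun k phi => cocycle (Hom_inj_diff (quotmod a) M) phi /\
    cobound (Hom_inj_diff (quotmod (ideal_pow a k.+1)) M) (f k i phi))) => //.
  - exact: cobound_linear.
  - move=> k; exact: (linear_predI (cocycle_linear _ _) (bL k)).
  - by move=> phi [dphi [z bz /(cobound_pow bz)[k kphi]]]; exists k.
  (* The kernel of Ext^i(R/a, M) -> Ext^i(R/a^(k+1), M) is a quotient of Ext^(i-1)(L, M). *)
  move=> k; pose L := submod (kerm (pow_quotient k)).
  apply: (les_left S_serre (d := Hom_inj_diff (quotmod (ideal_pow a k.+1)) M)
    (d'' := Hom_inj_diff L M) (f := f k) (g := fun n => homMod_comp (W := inj_res M n)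
      (val : {linear L -> quotmod (ideal_pow a k.+1)}))).
  - exact: Hom_inj_diff2.
  - by move=> n phi; exact: hom_ext.
  - by move=> n phi; exact: hom_ext.
  - move=> n; exact: (injective_short_exact (@injmod_injective R (cosyzygy M n))
      (pow_quotient_short_exact k)).
  move=> j ij; apply/(sq_Ext S_serre); apply: SExt; last by rewrite ij.
    exact/submod_fg/fg_noetherian/cyclic_fg.
  move=> x xa; exists k.+1 => u; apply: val_inj.
  exact: (quotmod_annihilated (ideal_pow_expr k.+1 xa) (val u)).
(* Modulo [Q], Ext^i(R/a, M) embeds into H^i_a(M): the value of [phi] at 1 is killed by a, hence
   torsion. *)
apply: (sq_transfer (cocycle_linear (Gamma_diff M) i) (linear_rel_comp iota ev) _ _ SH).
  move=> phi dphi; have phi_tors : val phi one \in torsion a (M := inj_res M i).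
    apply/asboolP; exists 1%N => r /ideal_pow_sub ra.
    by rewrite -homZ quotmod_annihilated ?hom0.
  exists (Sub (val phi one) phi_tors) => //; apply: val_inj.
  exact: (congr1 (fun h : homMod _ _ => val h one) dphi).
by move=> z phi _ _ zphi bz; exists z.
Qed.

End LocalCohomology.

Section LocalVanishing.
Variables (R : comPzRingType) (S : lmodType R -> Prop).
Hypotheses (R_noeth : noetherian R) (S_serre : serre_class S).
Hypothesis S_sum : closed_under_direct_sums S.
Variables (a : ideal R) (M : lmodType R).
Hypothesis M_fg : finitely_generated M.

(** By induction, the first n Ext modules give a weak M-sequence of length n, which puts Ext^j(N, M)
    in S for j < n and every N required by [Ext_of_local_cohomology]. *)
Lemma local_cohomology_vanish n :
  (forall i, (i < n)%N -> S (local_cohomology i a M)) <->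
  (forall i, (i < n)%N -> S (Ext i (quotmod a) M)).
Proof.
split=> [|/(Ext_vanish_weak_Mseq R_noeth S_serre _ _ M_fg)[xs [<- axs w]] i ixs].
  elim: n => [//|n IH] SH i; rewrite ltnS leq_eqVlt => /predU1P[->|]; last first.
    by apply: IH => j /ltnW; exact: SH.
  apply: Ext_of_local_cohomology => //; last exact: SH.
  have /(Ext_vanish_weak_Mseq R_noeth S_serre _ _ M_fg)[xs [<- axs w]] :
      forall j, (j < n)%N -> S (Ext j (quotmod a) M).
    by apply: IH => j /ltnW; exact: SH.
  by move=> N N_fg aN; exact: weak_Mseq_Ext axs w.
apply: local_cohomology_serre => // k.
apply: (weak_Mseq_Ext _ _ _ _ axs w) => //; first exact: cyclic_fg.
by move=> x xa; exists k; exact/quotmod_annihilated/ideal_pow_expr.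
Qed.

End LocalVanishing.

(** * Grades *)

Section Degrees.
Local Open Scope order_scope.
Local Open Scope ereal_scope.
Implicit Types P Q : nat -> Prop.

Lemma inf_degree_eq P n : P n -> (forall i, (i < n)%N -> ~ P i) ->
  inf_degree P = (n%:Z)%:E.
Proof.
move=> Pn Pmin; rewrite /inf_degree /infimum.
set A := (X in X == _); have An : A (n%:Z)%:E by exists n.
case: eqP => [A0|_]; first by rewrite A0 in An.
have inf_n : infimums A (n%:Z)%:E.
  split=> [_ [i Pi <-]|x]; last by move=> /(_ _ An).
  rewrite lee_fin lez_nat leqNgt; apply/negP => /Pmin; exact.
exact/(is_subset1_infimums (xgetI _ inf_n)).
Qed.

Lemma inf_degree_none P : (forall i, ~ P i) -> inf_degree P = +oo.
Proof.
move=> P0; rewrite /inf_degree; set A := (X in infimum _ X).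
suff -> : A = classical_sets.set0 by rewrite /infimum eqxx.
by apply/seteqP; split=> // x [i /P0].
Qed.

Lemma first_or_none P :
  (exists2 n, P n & forall i, (i < n)%N -> ~ P i) \/ forall i, ~ P i.
Proof.
have [[n Pn]|noP] := pselect (exists n, P n); last first.
  by right=> i Pi; apply: noP; exists i.
have exP : exists n, `[< P n >] by exists n; exact/asboolP.
case: (ex_minnP exP) => m /asboolP Pm mmin; left; exists m => // i im /asboolP/mmin.
by rewrite leqNgt im.
Qed.

(** The first failing degree is determined by the conditions on initial segments, the form in which
    the vanishing lemmas compare the cohomologies. *)
Lemma inf_degree_ext P Q :
  (forall n, (forall i, (i < n)%N -> ~ P i) <-> (forall i, (i < n)%N -> ~ Q i)) ->
  inf_degree P = inf_degree Q.
Proof.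
move=> PQ; have [[n Pn Pmin]|P0] := first_or_none P.
  rewrite (inf_degree_eq Pn Pmin); have Qmin := (PQ n).1 Pmin.
  rewrite (@inf_degree_eq Q n) //; apply: contrapT => Qn.
  have /(PQ n.+1).2/(_ n (ltnSn n)) : forall i, (i < n.+1)%N -> ~ Q i; last by [].
  by move=> i; rewrite ltnS leq_eqVlt => /predU1P[->|/Qmin].
rewrite !inf_degree_none // => i.
by apply: ((PQ i.+1).1 _ i (ltnSn i)) => j _; exact: P0.
Qed.

(** The degrees satisfying Q form the initial segment ending at the first degree in P, that degree
    included; 0 always belongs to it, so the supremum is not that of the empty set. *)
Lemma sup_degree_ext P Q :
  (forall n, Q n <-> (forall i, (i < n)%N -> ~ P i)) -> sup_degree Q = inf_degree P.
Proof.
move=> QP; rewrite /sup_degree /supremum.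
set A := (X in X == _); have A0 : A (0%:Z)%:E by exists 0%N => //; exact/QP.
case: eqP => [A_eq0|_]; first by rewrite A_eq0 in A0.
suff sup_A : supremums A (inf_degree P) by exact/(is_subset1_supremums (xgetI _ sup_A)).
have [[n Pn Pmin]|P0] := first_or_none P.
  rewrite (inf_degree_eq Pn Pmin); split=> [_ [i /QP Qi <-]|x]; last first.
    by apply; exists n => //; exact/QP.
  by rewrite lee_fin lez_nat leqNgt; apply/negP => /Qi; exact.
rewrite inf_degree_none //; split=> [x _|[m| |] mA]; rewrite ?leey //.
  (* Every natural number qualifies here, so |m| + 1 refutes the upper bound m. *)
  have /mA : A (`|m|.+1%:Z)%:E by exists `|m|.+1%N => //; apply/QP => i _; exact: P0.
  by by rewrite lee_fin => /le_trans/(_ (lez_abs m)); rewrite lez_nat ltnn.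
by have := mA _ A0.
Qed.

End Degrees.

Section Maximal.
Variables (R : comPzRingType) (S : lmodType R -> Prop).
Hypotheses (R_noeth : noetherian R) (S_serre : serre_class S).
Variables (a : ideal R) (M : lmodType R).
Hypothesis M_fg : finitely_generated M.

(** The sequence puts the Ext modules below its length in S; if the next one were in S too,
    [Ext_weak_Mseq_extend] would contradict maximality. *)
Lemma maximal_weak_Mseq_grade xs : maximal_in a (weak_Mseq S M) xs ->
  ((size xs)%:Z)%:E%E = Egrade S a M.
Proof.
move=> [w axs xs_max]; apply: esym.
have vanish n := Ext_vanish_weak_Mseq R_noeth S_serre a n M_fg.
have vanish_xs : forall i, (i < size xs)%N -> S (Ext i (quotmod a) M).
  by apply/vanish; exists xs.
apply: inf_degree_eq => [SE|i /vanish_xs Si]; last by apply.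
have [|x [xa _ wx]] := Ext_weak_Mseq_extend R_noeth S_serre M_fg axs w.
  by move=> i; rewrite ltnS leq_eqVlt => /predU1P[->|/vanish_xs].
exact: xs_max xa wx.
Qed.

Lemma mulM_quotient_serre xs : seq_in a xs ->
  S (quotmod (mulM [in xs] M)) -> S (quotmod (@mulM R a M)).
Proof.
move=> axs /(sq_module S_serre) h; apply/(sq_module S_serre); move: h.
apply: (sq_transfer _ (linear_rel_span (quotmod_pi (mulM [in xs] M))
  (quotmod_pi (@mulM R a M)))) => //.
  move=> y _; have [m <-] := quotmod_pi_surj y.
  by exists (quotmod_pi (mulM [in xs] M) m) => //; exists m.
move=> _ _ _ _ [m -> ->] /quotmod_pi_eq0 mxs; apply/quotmod_pi_eq0.
exact: mulM_subset mxs.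
Qed.

(* A weak sequence whose submodule (x_1, ..., x_n) M is maximal cannot be extended
   by any x without having x M inside it, which puts the whole colon module, hence
   M / (x_1, ..., x_n) M, in S. *)
Lemma Ext_vanish_quotient : (forall i, S (Ext i (quotmod a) M)) -> S (quotmod (@mulM R a M)).
Proof.
move=> v; pose F (A : M -> Prop) := exists xs : seq R,
  [/\ A = (fun m => m \in mulM [in xs] M), seq_in a xs & weak_Mseq S M xs].
have [||_ [xs [-> axs w]] xs_max] := noetherian_max (F := F) (fg_noetherian R_noeth M_fg).
- by move=> _ [xs [-> _ _]]; exact: linear_pred_submod.
- by exists (fun m => m \in mulM [in [::]] M), [::].
have [//|x [xa axsx wx]] := Ext_weak_Mseq_extend R_noeth S_serre M_fg axs w.
apply: (mulM_quotient_serre axs); apply/(sq_module S_serre).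
have [_ /(sq_submod S_serre) Sx] := (weak_Mseq_rcons S_serre M xs x).1 wx.
apply: (sq_subset (linear_pred_submod _) _ _ Sx) => // y _.
have [m <-] := quotmod_pi_surj y; apply/eqP; rewrite /= -linearZ_LR.
apply/quotmod_pi_eq0; apply: (xs_max (fun m => m \in mulM [in rcons xs x] M)).
- by exists (rcons xs x).
- by move=> u uxs; apply/mulM_rconsP; exists 0; rewrite scaler0 subr0.
by apply/mulM_rconsP; exists m; rewrite subrr rpred0.
Qed.

End Maximal.

Theorem theorem2p8 (R : comPzRingType) (R_noeth : noetherian R) (a : ideal R)
    (S : lmodType R -> Prop) (S_serre : serre_class S)
    (M : lmodType R) (M_fg : finitely_generated M) :
  [/\ forall xs : seq R, maximal_in a (weak_Mseq S M) xs ->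
        ((size xs)%:Z)%:E%E = Egrade S a M,
      Cgrade S a M = Egrade S a M /\
      (forall ys : seq R, generates ys a -> Egrade S a M = Kgrade S ys M),
      closed_under_direct_sums S -> Egrade S a M = Hgrade S a M
    & ~ S (quotmod (@mulM R a M)) ->
      (forall ys : seq R, generates ys a -> (Kgrade S ys M < +oo)%E) /\
      (forall xs ys : seq R, maximal_in a (Mseq S M) xs ->
        maximal_in a (Mseq S M) ys -> size xs = size ys)].
Proof.
(* The grades are infima of failures of S, while the vanishing lemmas speak of membership in S. *)
have notnot (T : nat -> lmodType R) n :
    (forall i, (i < n)%N -> ~ ~ S (T i)) <-> (forall i, (i < n)%N -> S (T i)).
  by split=> h i i_n; [exact: (contrapT (h i i_n))|move=> nSi; exact: (nSi (h i i_n))].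
have EK ys : generates ys a -> Egrade S a M = Kgrade S ys M.
  move=> ysa; apply: inf_degree_ext => n; rewrite !notnot.
  apply: (iff_trans (Ext_vanish_weak_Mseq R_noeth S_serre a n M_fg)).
  exact: iff_sym (koszul_vanish_weak_Mseq R_noeth S_serre n M_fg ysa).
split.
- exact: maximal_weak_Mseq_grade.
- split=> //; apply: sup_degree_ext => n; rewrite notnot.
  apply: iff_trans (iff_sym (Ext_vanish_weak_Mseq R_noeth S_serre a n M_fg)).
  by split=> -[xs [? ? ?]]; exists xs.
- move=> S_sum; apply: inf_degree_ext => n; rewrite !notnot.
  exact: iff_sym (local_cohomology_vanish R_noeth S_serre S_sum a M_fg n).
move=> aM; split=> [ys ysa|xs ys xs_max ys_max].
  rewrite -(EK _ ysa) /Egrade; have [[n nP nmin]|noP] :=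
    first_or_none (fun i => ~ S (Ext i (quotmod a) M)).
    by rewrite (inf_degree_eq nP nmin) ltry.
  by case: aM; apply: Ext_vanish_quotient => // i; exact: (contrapT (noP i)).
(* A weak extension of [zs] in a is an M-sequence, since M / (zs, x) M maps onto M / aM, which is
   not in S. *)
have weak zs : maximal_in a (Mseq S M) zs -> maximal_in a (weak_Mseq S M) zs.
  move=> [[w _] azs zs_max]; split=> // x xa wx; apply: (zs_max x xa); split=> // Sx.
  apply: aM; apply: mulM_quotient_serre Sx => // y.
  by rewrite mem_rcons inE => /predU1P[->//|/azs].
have := maximal_weak_Mseq_grade R_noeth S_serre M_fg (weak _ xs_max).
by rewrite -(maximal_weak_Mseq_grade R_noeth S_serre M_fg (weak _ ys_max)) => -[].
Qed.
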